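(* Let $\epsilon>0$, let $u_L\in\mathcal I_0$ with $u_L>0$, and let $u_R\in\mathcal I_0$ be such that $(u_L,u_R)$ verifies the Oleinik condition. Then there exists $0<a^*<1$ such that the following holds. Let $a_1,a_2>0$ with $\frac{a_2}{a_1}<a^*$. Then for any $u\in\mathcal S_{\text{weak},u_L,\epsilon}$, any $\overline t\in[0,\infty)$ and any $x_0\in\mathbb R$, there exists a Lipschitz path $h:[\overline t,\infty)\to\mathbb R$ with $h(\overline t)=x_0$ such that, writing $u_\pm(t)=u(t,h(t)\pm)$, $$a_1\bigl(\dot h(t)\,\eta(u_-(t)|u_L)-q(u_-(t);u_L)\bigr)-a_2\bigl(\dot h(t)\,\eta(u_+(t)|u_R)-q(u_+(t);u_R)\bigr)\le 0$$ for almost every $t\in[\overline t,\infty)$. Here $a^*$ depends only on the system, and continuously on $\epsilon$, $s_0=|u_L-u_R|$, $d(u_L,0)=|u_L|$, and on $d(u_R,\phi^\natural(u_L))=|u_R-\phi^\natural(u_L)|$ if $d(u_R,\phi^\natural(u_L))>0$.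
   Context: Setting. Fix $M>0$ and the state space $\mathcal I_0=[-M,M]$. The flux $f:\mathbb R\to\mathbb R$ is of class $C^4$ and concave-convex: $uf''(u)>0$ for $u\ne0$, $f'''(0)\neq0$, and $f'(u)\to+\infty$ as $|u|\to+\infty$. Consider the scalar conservation law $u_t+(f(u))_x=0$, $t>0$, $x\in\mathbb R$, with $u$ valued in $\mathcal I_0$. Fix a strictly convex entropy $\eta\in C^3$ ($\eta''>0$) with entropy flux $q$, $q'=\eta'f'$. For $k\in\mathbb R$ the Kruzkov entropy is $\eta_k(u)=|u-k|$ with flux $q_k(u)=\mathrm{sgn}(u-k)(f(u)-f(k))$. A weak solution $u\in L^\infty(\mathbb R^+\times\mathbb R;\mathcal I_0)$ is $\eta$-entropic (resp. $\eta_k$-entropic) if $(\eta(u))_t+(q(u))_x\le0$ (resp. with $\eta_k,q_k$) in the sense of distributions on $(0,\infty)\times\mathbb R$. ''Dependence on the system'' means dependence on $f,\eta,M$. Relative quantities: $\eta(a|b)=\eta(a)-\eta(b)-\eta'(b)(a-b)$ and $q(a;b)=q(a)-q(b)-\eta'(b)(f(a)-f(b))$. Strong Trace property: $u\in L^\infty(\mathbb R^+\times\mathbb R)$ has it if for every Lipschitz curve $t\mapsto h(t)$ there are bounded functions $u_-,u_+$ of $t$ such that for every $T>0$, $\lim_{n\to\infty}\int_0^T\sup_{y\in(0,1/n)}|u(t,h(t)+y)-u_+(t)|\,dt=\lim_{n\to\infty}\int_0^T\sup_{y\in(-1/n,0)}|u(t,h(t)+y)-u_-(t)|\,dt=0$.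 One writes $u_\pm(t)=u(t,h(t)\pm)$. Oleinik condition for $(u_L,u_R)$, $u_L\ne u_R$: $\frac{f(v)-f(u_L)}{v-u_L}\ge\frac{f(u_R)-f(u_L)}{u_R-u_L}$ for all $v$ strictly between $u_L$ and $u_R$. Auxiliary functions: for $u\neq0$, $\phi^\natural(u)$ is the unique $v\ne u$ with $f'(v)=\frac{f(u)-f(v)}{u-v}$; $\phi^\natural(0)=0$. With $E_\eta(u_-,u_+)=-\sigma(\eta(u_+)-\eta(u_-))+q(u_+)-q(u_-)$, $\sigma=\frac{f(u_-)-f(u_+)}{u_--u_+}$, for $u\ne0$, $\phi_0^\flat(u)$ is the unique $v\neq u$ with $E_\eta(u,v)=0$; $\phi_0^\flat(0)=0$. Class of solutions: $\mathcal S_{\text{weak},u_L,\epsilon}$ is the set of $u\in L^\infty(\mathbb R^+\times\mathbb R;\mathcal I_0)$ that are weak solutions of $u_t+(f(u))_x=0$, are $\eta$-entropic and $\eta_{\phi^\natural(u_L)}$-entropic, have the Strong Trace property, and such that for every Lipschitz curve $h$, $(u_-(t),u_+(t))\notin B(\phi_0^\flat(u_L),\epsilon)\times B(u_L,\epsilon)$ for almost every $t>0$. $B(c,r)$ is the ball (interval) of center $c$ and radius $r$. *)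

(* Defs.v *)
From HB Require Import structures.
From mathcomp Require Import all_boot all_order all_algebra.
From mathcomp Require Import all_classical all_reals all_analysis.

Set Implicit Arguments.
Unset Strict Implicit.
Unset Printing Implicit Defensive.

Import Order.TTheory GRing.Theory Num.Theory.
Import numFieldNormedType.Exports.

Local Open Scope ring_scope.
Local Open Scope classical_set_scope.

Section System.
Context {R : realType}.
Implicit Types (f eta q : R -> R) (n : nat).

Definition of_class_C n f :=
  (forall i, (i < n)%N -> forall x, derivable (derive1n i f) x 1) /\
  continuous (derive1n n f).

Definition concave_convex_flux f :=
  [/\ of_class_C 4 f,
      forall u, u != 0 -> 0 < u * derive1n 2 f u,
      derive1n 3 f 0 != 0,
      derive1 f @ +oo --> +oo &
      derive1 f @ -oo --> +oo].

Definition strictly_convex_entropy eta :=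
  of_class_C 3 eta /\ forall u, 0 < derive1n 2 eta u.

Definition entropy_flux f eta q :=
  forall u : R, is_derive u (1 : R) q (derive1 eta u * derive1 f u).

Definition kruzkov_entropy (k u : R) : R := `|u - k|.

Definition kruzkov_flux f (k u : R) : R := Num.sg (u - k) * (f u - f k).

Definition rel_entropy eta (a b : R) : R :=
  eta a - eta b - derive1 eta b * (a - b).

Definition rel_flux f eta q (a b : R) : R :=
  q a - q b - derive1 eta b * (f a - f b).

Definition oleinik f (uL uR : R) :=
  uL != uR /\
  forall v, Num.min uL uR < v < Num.max uL uR ->
    (f uR - f uL) / (uR - uL) <= (f v - f uL) / (v - uL).

(* [xget 0 A] picks an element of [A], and is [0] if [A] is empty; for the
   fluxes and entropies considered here and [u != 0], both sets below are
   singletons. *)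
Definition phi_natural f (u : R) : R :=
  if u == 0 then 0
  else xget 0 [set v | v != u /\ derive1 f v = (f u - f v) / (u - v)].

Definition shock_speed f (um up : R) : R := (f um - f up) / (um - up).

Definition entropy_dissipation f eta q (um up : R) : R :=
  - shock_speed f um up * (eta up - eta um) + q up - q um.

Definition phi_flat0 f eta q (u : R) : R :=
  if u == 0 then 0
  else xget 0 [set v | v != u /\ entropy_dissipation f eta q u v = 0].

End System.

(* Points of the plane are written [z = (t, x)]. An element of
   L^oo(R^+ x R) is represented by a Borel function on [R * R], whose values
   for [t <= 0] are irrelevant. *)
Section Solutions.
Context {R : realType}.
Implicit Types (f eta q h : R -> R) (u phi : R * R -> R) (M : R).

Definition half_plane : set (R * R) := [set z | 0 < z.1].

Definition plane_measure :=
  (@lebesgue_measure R \x @lebesgue_measure R)%E.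

Definition partial_t phi (z : R * R) : R := 'D_((1, 0) : R * R) phi z.

Definition partial_x phi (z : R * R) : R := 'D_((0, 1) : R * R) phi z.

Fixpoint of_class_C2d n phi : Prop :=
  if n is m.+1 then
    [/\ continuous phi,
        forall z, derivable phi z ((1, 0) : R * R),
        forall z, derivable phi z ((0, 1) : R * R),
        of_class_C2d m (partial_t phi) &
        of_class_C2d m (partial_x phi)]
  else continuous phi.

Definition test_function phi :=
  [/\ forall n, of_class_C2d n phi,
      compact (closure [set z | phi z != 0]) &
      closure [set z | phi z != 0] `<=` half_plane].

(* The pairing of [phi] with the distribution [- (A(u)_t + B(u)_x)]. *)
Definition weak_pairing (A B : R -> R) u phi : R :=
  \int[plane_measure]_(z in half_plane)
    (A (u z) * partial_t phi z + B (u z) * partial_x phi z).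

Definition Linfty_valued M u :=
  measurable_fun half_plane u /\
  {ae plane_measure, forall z, half_plane z -> - M <= u z <= M}.

Definition weak_solution f u :=
  forall phi, test_function phi -> weak_pairing id f u phi = 0.

Definition entropic eta q u :=
  forall phi, test_function phi -> (forall z, 0 <= phi z) ->
    0 <= weak_pairing eta q u phi.

Definition lipschitz_curve (t0 : R) h := exists k : R, k.-lipschitz_(`[t0, +oo[) h.

(* [v] is the trace of [u] along [h], for times larger than [t0], from the side
   determined by the neighbourhoods [Y n] of [0] in the space variable. *)
Definition one_sided_trace (Y : nat -> set R) (t0 : R) u h (v : R -> R) :=
  [/\ measurable_fun `]t0, +oo[ v,
      [bounded v t | t in `]t0, +oo[] &
      forall T, t0 < T ->
        (fun n => (\int[lebesgue_measure]_(t in `]t0, T[)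
           ereal_sup [set `|u (t, h t + y)%R - v t|%:E | y in Y n])%E)
        @ \oo --> 0%E].

Definition right_trace : R -> (R * R -> R) -> (R -> R) -> (R -> R) -> Prop :=
  one_sided_trace (fun n => `]0, n.+1%:R^-1[).

Definition left_trace : R -> (R * R -> R) -> (R -> R) -> (R -> R) -> Prop :=
  one_sided_trace (fun n => `](- n.+1%:R^-1), 0[).

Definition strong_trace u :=
  forall h, lipschitz_curve 0 h ->
    exists um up, left_trace 0 u h um /\ right_trace 0 u h up.

Definition avoids_along_curves (A B : set R) u :=
  forall h um up, lipschitz_curve 0 h ->
    left_trace 0 u h um -> right_trace 0 u h up ->
    {ae lebesgue_measure, forall t : R, 0 < t -> ~ (A (um t) /\ B (up t))}.

Definition S_weak f eta q M (uL eps : R) : set (R * R -> R) :=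
  [set u | [/\ Linfty_valued M u /\ weak_solution f u,
               entropic eta q u,
               entropic (kruzkov_entropy (phi_natural f uL))
                        (kruzkov_flux f (phi_natural f uL)) u,
               strong_trace u &
               avoids_along_curves (ball (phi_flat0 f eta q uL) eps)
                                   (ball uL eps) u]].

End Solutions.

(* Main.v *)
(* The path [h] is a Filippov trajectory of the discontinuous field [V (u (t, x))].
   The Lipschitz function [V] is [f'(uL) - d] near [uL], for a small [d], and is
   smaller than all the characteristic speeds away from [uL]. It is bounded, so
   trajectories exist as limits of Euler polygons for averages of the field.
   At almost every [t], the strong traces are limits in the mean at [(t, h t)],
   on both sides of [h]. Hence [h'(t)] lies between [V (u_-)] and [V (u_+)];
   testing the equation and the entropy inequalities with small bumps moving
   at speed [h'(t)] gives the Rankine-Hugoniot condition and the entropy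
   inequalities for the jump from [u_-] to [u_+].

   It remains to compare the relative entropy fluxes at such a jump. If
   [u_- = u_+], then [h'(t) = V (u_-)] and the left flux is bounded above by
   [- c |u_- - uL|^2], or by [- c], while the right flux is nonnegative near
   [uL]. If [u_-] is near [uL] and the speed is at most [f'(uL) - d], then
   the Kruzkov inequality at the tangency point [phi_natural f uL] controls the
   graph of [f] between [u_+] and [u_-], and the right flux is at least
   [- C |u_- - uL|^2]. Otherwise [u_+] is near [uL] and [u_-] is not: either the
   entropy inequality fails, or the left flux is at most [- c], because [u_-] is
   not near [phi_flat0 f eta q uL]. In all cases a small enough ratio [a2 / a1]
   concludes. *)

Require Import Defs.
From HB Require Import structures.
From mathcomp Require Import all_boot all_order all_algebra.
From mathcomp Require Import all_classical all_reals all_analysis.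
From mathcomp Require Import measurable_realfun ring lra.

Set Implicit Arguments.
Unset Strict Implicit.
Unset Printing Implicit Defensive.

Import Order.TTheory GRing.Theory Num.Theory.
Import numFieldNormedType.Exports.

Local Open Scope ring_scope.
Local Open Scope classical_set_scope.

(** * Calculus in one variable *)

Section OneVariable.
Context {R : realType}.
Implicit Types (f g : R -> R) (a b x y : R).

(** The traces along a path are available only once the path is given, so the path is built from the
    values of [u] alone, and the inclusion for its speed is kept in integrated form, against
    essential values, until traces can be used. The strong trace property controls suprema whose
    measurability in time is not granted; a largest measurable minorant and an exchange of null sets
    by Tonelli turn it into almost everywhere bounds.

    The loss on the right is of order two near [uL] because the slope of a shock from [u_-] differs
    from that of the chord from [uL] by O([|u_- - uL|]), whereas the slopes of these chords vary at
    least quadratically: completing a square leaves [|u_- - uL|^2], the order of the gain on the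
    left.

    All constants are uniform over one parameter [m], a lower bound of [eps], [uL] and [uL - uR],
    and over all entropy fluxes [q]. They come from compactness, which says nothing of their
    continuity in [m]; a 1-Lipschitz threshold is recovered at the end from monotonicity alone. *)

Lemma is_derive_addf f g x a b :
  is_derive x 1 f a -> is_derive x 1 g b -> is_derive x 1 (fun y => f y + g y) (a + b).
Proof. by move=> df dg; exact: is_deriveD. Qed.

Lemma is_derive_oppf f x a :
  is_derive x 1 f a -> is_derive x 1 (fun y => - f y) (- a).
Proof. by move=> df; exact: is_deriveN. Qed.

Lemma is_derive_mulf f g x a b :
  is_derive x 1 f a -> is_derive x 1 g b ->
  is_derive x 1 (fun y => f y * g y) (f x * b + g x * a).
Proof. by move=> df dg; exact: is_deriveM. Qed.

Lemma is_derive_invf f x a : f x != 0 ->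
  is_derive x 1 f a -> is_derive x 1 (fun y => (f y)^-1) (- f x ^- 2 * a).
Proof. by move=> f0 df; exact: is_deriveV. Qed.

Lemma is_derive_compf f g x a b :
  is_derive (g x) 1 f a -> is_derive x 1 g b -> is_derive x 1 (fun y => f (g y)) (a * b).
Proof. by move=> df dg; exact: is_derive1_comp. Qed.

Lemma is_derive_continuous f x a : is_derive x 1 f a -> {for x, continuous f}.
Proof.
by move=> [df _]; apply: differentiable_continuous; rewrite -derivable1_diffP.
Qed.

End OneVariable.

Ltac derivef :=
  lazymatch goal with
  | |- is_derive _ _ (fun _ => ?c) _ => exact: is_derive_cst
  | |- is_derive _ _ (fun y => @?f y + @?g y) _ =>
    eapply (@is_derive_addf _ f g); derivef
  | |- is_derive _ _ (fun y => - (@?f y)) _ => eapply (@is_derive_oppf _ f); derivef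
  | |- is_derive _ _ (fun y => @?f y * @?g y) _ =>
    eapply (@is_derive_mulf _ f g); derivef
  | |- is_derive _ _ (fun y => (@?f y)^-1) _ =>
    eapply (@is_derive_invf _ f); [|derivef]
  | |- is_derive _ _ (fun y => ?f y) _ => first [eassumption | eauto | exact: is_derive_id]
  | |- is_derive _ _ (fun y => y) _ => exact: is_derive_id
  | |- is_derive _ _ ?f _ => first [eassumption | eauto]
  end.

Ltac derive_eq := notypeclasses refine (@is_derive_eq _ _ _ _ _ _ _ _ _ _); [derivef|rewrite /=].

(* Hides a nonlinear hypothesis from [lra]. *)
Record delayed (P : Prop) : Prop := Delay { reveal : P }.
Ltac delay H := apply Delay in H.

(** * Mean value inequalities and bounds by compactness *)

Section MeanValue.
Context {R : realType}.
Implicit Types (f g df dg : R -> R) (a b c x y B : R).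

Lemma mean_value g dg a b : a < b ->
  (forall x, a <= x <= b -> is_derive x 1 g (dg x)) ->
  exists c, a < c < b /\ g b - g a = dg c * (b - a).
Proof.
move=> ab dgE; have [| |c] := @MVT R g dg a b ab.
- by move=> x; rewrite in_itv/= => /andP[ax xb]; apply: dgE; rewrite !ltW.
- apply: derivable_within_continuous => x; rewrite in_itv/= => /dgE dx.
  exact: ex_derive.
by rewrite in_itv/= => acb gE; exists c.
Qed.

Lemma mean_value_ge g dg a b c : a <= b ->
  (forall x, a <= x <= b -> is_derive x 1 g (dg x)) ->
  (forall x, a < x < b -> c <= dg x) -> c * (b - a) <= g b - g a.
Proof.
rewrite le_eqVlt => /predU1P[<- _ _|ab dgE cdg]; first by rewrite !subrr mulr0.
have [x [xab ->]] := mean_value ab dgE.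
by rewrite ler_pM2r ?subr_gt0// cdg.
Qed.

Lemma mean_value_le g dg a b c : a <= b ->
  (forall x, a <= x <= b -> is_derive x 1 g (dg x)) ->
  (forall x, a < x < b -> dg x <= c) -> g b - g a <= c * (b - a).
Proof.
rewrite le_eqVlt => /predU1P[<- _ _|ab dgE cdg]; first by rewrite !subrr mulr0.
have [x [xab ->]] := mean_value ab dgE.
by rewrite ler_pM2r ?subr_gt0// cdg.
Qed.

Lemma derive_ge0_le g dg a b : a <= b ->
  (forall x, a <= x <= b -> is_derive x 1 g (dg x)) ->
  (forall x, a < x < b -> 0 <= dg x) -> g a <= g b.
Proof. by move=> ab dgE /(mean_value_ge ab dgE); rewrite mul0r subr_ge0. Qed.

Lemma derive_le0_le g dg a b : a <= b ->
  (forall x, a <= x <= b -> is_derive x 1 g (dg x)) ->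
  (forall x, a < x < b -> dg x <= 0) -> g b <= g a.
Proof. by move=> ab dgE /(mean_value_le ab dgE); rewrite mul0r subr_le0. Qed.

Lemma derive_gt0_lt g dg a b : a < b ->
  (forall x, a <= x <= b -> is_derive x 1 g (dg x)) ->
  (forall x, a < x < b -> 0 < dg x) -> g a < g b.
Proof.
move=> ab dgE g0; have [c [cab gE]] := mean_value ab dgE.
by rewrite -subr_gt0 gE mulr_gt0 ?g0// subr_gt0.
Qed.

Lemma derive_lt0_lt g dg a b : a < b ->
  (forall x, a <= x <= b -> is_derive x 1 g (dg x)) ->
  (forall x, a < x < b -> dg x < 0) -> g b < g a.
Proof.
move=> ab dgE g0; have [c [cab gE]] := mean_value ab dgE.
by rewrite -subr_lt0 gE pmulr_llt0 ?g0// subr_gt0.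
Qed.

Lemma derive_bounded_lipschitz g dg B c :
  (forall x, is_derive x 1 g (dg x)) ->
  (forall x, - B <= x <= B -> `|dg x| <= c) ->
  forall x y, - B <= x <= B -> - B <= y <= B -> `|g x - g y| <= c * `|x - y|.
Proof.
move=> dgE dgc.
have H x y : - B <= x <= B -> - B <= y <= B -> y < x -> `|g x - g y| <= c * `|x - y|.
  move=> xB yB yx; have [z [zyx ->]] := mean_value yx (fun z _ => dgE z).
  by rewrite normrM ler_wpM2r// dgc//; lra.
move=> x y xB yB; have [xy|yx|->] := ltgtP x y.
- by rewrite distrC (distrC x) H.
- exact: H.
- by rewrite !subrr normr0 mulr0.
Qed.

Lemma continuous_bounded g B : continuous g ->
  exists c : R, 0 < c /\ forall x, - B <= x <= B -> `|g x| <= c.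
Proof.
move=> cg; have [B0|B0] := leP 0 B; last first.
  by exists 1; split => // x; lra.
have BB : - B <= B by lra.
have cng : {within `[- B, B], continuous (fun x => `|g x|)}.
  apply: continuous_subspaceT => x.
  exact: (continuous_comp (cg x) (@norm_continuous _ _ _)).
have [c _ cP] := EVT_max BB cng.
exists (`|g c| + 1); split; first by have := normr_ge0 (g c); lra.
by move=> x xB; have := cP x; rewrite in_itv/= => /(_ xB); lra.
Qed.

Lemma continuous_pos_lower_bound g a b : continuous g ->
  (forall x, a <= x <= b -> 0 < g x) ->
  exists c : R, 0 < c /\ forall x, a <= x <= b -> c <= g x.
Proof.
move=> cg g0; have [ab|ba] := leP a b; last first.
  by exists 1; split => // x; lra.
have [c cab cP] := EVT_min ab (@continuous_subspaceT _ _ _ _ cg).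
exists (g c); split; first by rewrite g0//; rewrite in_itv/= in cab.
by move=> x xab; apply: cP; rewrite in_itv.
Qed.

Lemma min_spec x y : 0 < x -> 0 < y -> exists z, [/\ 0 < z, z <= x & z <= y].
Proof.
move=> x0 y0; exists (Num.min x y).
by split; [rewrite lt_min x0|rewrite ge_min lexx|rewrite ge_min lexx orbT].
Qed.

End MeanValue.

Section AlmostEverywhere.
Context {R : realType}.
Local Notation mu := (@lebesgue_measure R).
Implicit Types P Q S : R -> Prop.

Lemma ae_imp P Q : {ae mu, forall x, P x} -> (forall x, P x -> Q x) ->
  {ae mu, forall x, Q x}.
Proof. by move=> H PQ; apply: (@filterS _ _ (ae_filter_ringOfSetsType mu)) H. Qed.

Lemma ae_imp2 P Q S : {ae mu, forall x, P x} -> {ae mu, forall x, Q x} ->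
  (forall x, P x -> Q x -> S x) -> {ae mu, forall x, S x}.
Proof. by move=> HP HQ PQ; apply: (@filterS2 _ _ (ae_filter_ringOfSetsType mu)) HP HQ. Qed.

End AlmostEverywhere.

(** * Shocks of a concave-convex flux *)

Section FluxShape.
Context {R : realType} (f f1 f2 : R -> R).
Context (df : forall x : R, is_derive x (1 : R) f (f1 x)).
Context (df1 : forall x : R, is_derive x (1 : R) f1 (f2 x)).
Context (cf2 : continuous f2).
Context (f2_pos : forall x : R, 0 < x -> 0 < f2 x).
Context (f2_neg : forall x : R, x < 0 -> f2 x < 0).
Context (f1_ninfty : forall A : R, exists x : R, x < 0 /\ A < f1 x).
Implicit Types (a b c d h k v w x y B m : R).

Definition chord a v : R := (f v - f a) / (v - a).
(** Height of the graph over [a] above the tangent at [v]. It has the sign of the derivative of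
    [chord a] at [v], and for [a > 0] its negative zero is the tangency point [phi_natural f a]. *)
Definition relf a v : R := f a - f v - f1 v * (a - v).

Lemma f1_increasing x y : 0 <= x -> x < y -> f1 x < f1 y.
Proof.
move=> x0 xy; apply: (derive_gt0_lt xy (fun z _ => df1 z)) => z xzy.
by apply: f2_pos; lra.
Qed.

Lemma f1_decreasing x y : y <= 0 -> x < y -> f1 y < f1 x.
Proof.
move=> y0 xy; apply: (derive_lt0_lt xy (fun z _ => df1 z)) => z xzy.
by apply: f2_neg; lra.
Qed.

Lemma is_derive_relf a v : is_derive v (1 : R) (relf a) (- f2 v * (a - v)).
Proof. by rewrite /relf; derive_eq; ring. Qed.

Lemma relfxx a : relf a a = 0. Proof. by rewrite /relf; ring. Qed.

Lemma relf_increasing_neg a v w : 0 < a -> v < w -> w <= 0 -> relf a v < relf a w.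
Proof.
move=> a0 vw w0; apply: (derive_gt0_lt vw (fun z _ => is_derive_relf a z)) => z vzw.
by have := f2_neg (x := z); nra.
Qed.

Lemma relf_decreasing_pos a v w : 0 <= v -> v < w -> w <= a -> relf a w < relf a v.
Proof.
move=> v0 vw wa; apply: (derive_lt0_lt vw (fun z _ => is_derive_relf a z)) => z vzw.
by have := f2_pos (x := z); nra.
Qed.

Lemma relf_gt0_right a v : 0 < a -> a < v -> 0 < relf a v.
Proof.
move=> a0 av; rewrite -(relfxx a).
apply: (derive_gt0_lt av (fun z _ => is_derive_relf a z)) => z vzw.
by have := f2_pos (x := z); nra.
Qed.

Lemma relf_gt0_left a v : 0 <= v -> v < a -> 0 < relf a v.
Proof. by move=> v0 va; rewrite -(relfxx a); apply: relf_decreasing_pos. Qed.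

Lemma relf_ge_sqr h a v : (forall x, v <= x <= a -> h <= f2 x) -> v <= a ->
  h / 2 * (a - v) ^+ 2 <= relf a v.
Proof.
move=> hP va.
have D z : is_derive z (1 : R) (fun z => relf a z - h / 2 * ((a - z) * (a - z)))
    (- f2 z * (a - z) + h * (a - z)).
  by have ? := is_derive_relf a z; derive_eq; field.
rewrite -subr_ge0; apply: (@le_trans _ _ (relf a a - h / 2 * ((a - a) * (a - a)))).
  by rewrite relfxx subrr !mul0r mulr0 subrr.
apply: (derive_le0_le va (fun z _ => D z)) => z zP.
by have := hP z; nra.
Qed.

(** [H v = f a - f v + v * f1 v] is nondecreasing on the negative axis, so
    [relf a v = H v - a * f1 v] becomes negative as soon as [f1 v] exceeds [H 0 / a], while it is
    positive at 0. *)
Lemma tangent_exists a : 0 < a -> exists k, k < 0 /\ relf a k = 0.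
Proof.
move=> a0; pose H v := relf a v + a * f1 v.
have dH v : is_derive v (1 : R) H (f2 v * v).
  have ? := is_derive_relf a v.
  by rewrite /H; derive_eq; ring.
have [v [v0 Hv]] := f1_ninfty (H 0 / a).
have Hv0 : H v <= H 0.
  apply: (derive_ge0_le (ltW v0) (fun z _ => dH z)) => z vz0.
  by have := f2_neg (x := z); nra.
have r0 : 0 < relf a 0 by apply: relf_gt0_left.
have rv : relf a v < 0.
  move: Hv; rewrite ltr_pdivrMr//; rewrite /H in Hv0 *; lra.
have [| |k] := @IVT _ (relf a) v 0 0 (ltW v0).
- apply: continuous_subspaceT => z; exact: is_derive_continuous (is_derive_relf a z).
- by rewrite ge_min le_max (ltW rv) (ltW r0) orbT.
rewrite in_itv/= => /andP[vk k0] rk; exists k; split => //.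
by rewrite lt_neqAle k0 andbT; apply: contra_eq_neq rk => ->; rewrite gt_eqF.
Qed.

Lemma relf_lt0 a k v : 0 < a -> k < 0 -> relf a k = 0 -> v < k -> relf a v < 0.
Proof. by move=> a0 k0 <- vk; apply: relf_increasing_neg => //; lra. Qed.

Lemma relf_gt0 a k v : 0 < a -> k < 0 -> relf a k = 0 -> k < v -> v != a -> 0 < relf a v.
Proof.
move=> a0 k0 rk kv; rewrite neq_lt => /orP[va|av]; last exact: relf_gt0_right.
have [v0|v0] := leP 0 v; first exact: relf_gt0_left.
by rewrite -rk; apply: relf_increasing_neg => //; lra.
Qed.

Lemma phi_naturalE a k : 0 < a -> k < 0 -> relf a k = 0 -> phi_natural f a = k.
Proof.
move=> a0 k0 rk; rewrite /phi_natural gt_eqF//.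
have f1E x : derive1 f x = f1 x by rewrite derive1E; apply: derive_val.
apply: xget_unique => /= [|v [va]]; rewrite f1E.
  have ak : a - k != 0 by rewrite gt_eqF//; lra.
  split; first by rewrite lt_eqF//; lra.
  by apply: (mulIf ak); rewrite divfK//; move: rk; rewrite /relf; lra.
move=> E; have av : a - v != 0 by rewrite subr_eq0 eq_sym.
have rv : relf a v = 0 by rewrite /relf E divfK//; lra.
have [vk|kv|//] := ltgtP v k.
  by have := relf_lt0 a0 k0 rk vk; lra.
by have := relf_gt0 a0 k0 rk kv va; lra.
Qed.

(** Otherwise [f1] would stay below [f1 k] on []k, a[], and the chord over [[k, a]] could not have
    slope [f1 k]. *)
Lemma tangent_slope a k : 0 < a -> k < 0 -> relf a k = 0 -> f1 k < f1 a.
Proof.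
move=> a0 k0 rk; rewrite ltNge; apply/negP => ak.
have ka : k < a by lra.
have [c [kca E]] := mean_value ka (fun z _ => df z).
have fck : f1 c < f1 k.
  have [c0|c0] := leP c 0; first by apply: f1_decreasing => //; lra.
  by apply: lt_le_trans ak; apply: f1_increasing; lra.
by move: rk; rewrite /relf; nra.
Qed.

Lemma f1_le_right a k v : 0 < a -> k < 0 -> relf a k = 0 -> k <= v <= a -> f1 v <= f1 a.
Proof.
move=> a0 k0 rk kva; have ka := tangent_slope a0 k0 rk.
have [v0|v0] := leP 0 v.
  have [->//|va] := eqVneq v a.
  by apply/ltW/f1_increasing => //; rewrite lt_neqAle va; lra.
have [->|vk] := eqVneq v k; first exact: ltW.
apply: le_trans (ltW ka); apply/ltW/f1_decreasing; first lra.
by rewrite lt_neqAle eq_sym vk; lra.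
Qed.

(** [relf a km] is the integral of [f1 - f1 km] over [[m, a]], hence nonnegative, whereas [relf a]
    is negative left of [k]. *)
Lemma tangent_nincr m a km k : 0 < m -> m <= a -> km < 0 -> relf m km = 0 ->
  k < 0 -> relf a k = 0 -> k <= km.
Proof.
move=> m0 ma km0 rm k0 rk; have a0 : 0 < a by lra.
rewrite leNgt; apply/negP => kmk.
have := relf_lt0 a0 k0 rk kmk; apply/negP; rewrite -leNgt.
have -> : relf a km = f a - f m - f1 km * (a - m).
  by move: rm; rewrite /relf; lra.
rewrite subr_ge0; apply: (mean_value_ge ma (fun z _ => df z)) => z maz.
apply/ltW/(lt_trans (tangent_slope m0 km0 rm)); apply: f1_increasing; lra.
Qed.

Lemma is_derive_chord a v : v != a -> is_derive v (1 : R) (chord a) (relf a v / (v - a) ^+ 2).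
Proof.
move=> va; have va' : v - a != 0 by rewrite subr_eq0.
by rewrite /chord /relf; derive_eq => //; field.
Qed.

Lemma chord_increasing_left a k v w : 0 < a -> k < 0 -> relf a k = 0 ->
  k <= v -> v < w -> w < a -> chord a v < chord a w.
Proof.
move=> a0 k0 rk kv vw wa.
apply: (derive_gt0_lt vw (fun z zvw => @is_derive_chord a z _)) => z vzw.
  by rewrite lt_eqF//; lra.
apply: divr_gt0; last by rewrite exprn_even_gt0//= subr_eq0 lt_eqF//; lra.
by apply: relf_gt0 rk _ _ => //; [lra|rewrite lt_eqF//; lra].
Qed.

Lemma chord_increasing_right a v w : 0 < a -> a < v -> v < w -> chord a v < chord a w.
Proof.
move=> a0 av vw.
apply: (derive_gt0_lt vw (fun z zvw => @is_derive_chord a z _)) => z vzw.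
  by rewrite gt_eqF//; lra.
apply: divr_gt0; last by rewrite exprn_even_gt0//= subr_eq0 gt_eqF//; lra.
by apply: relf_gt0_right; lra.
Qed.

Lemma chord_decreasing a k v w : 0 < a -> k < 0 -> relf a k = 0 ->
  v < w -> w <= k -> chord a w < chord a v.
Proof.
move=> a0 k0 rk vw wk.
apply: (derive_lt0_lt vw (fun z zvw => @is_derive_chord a z _)) => z vzw.
  by rewrite lt_eqF//; lra.
rewrite pmulr_llt0; last by rewrite invr_gt0 exprn_even_gt0//= subr_eq0 lt_eqF//; lra.
by apply: relf_lt0 rk _ => //; lra.
Qed.

(** An end state [b > a] or [b < k] is preceded by chords of smaller slope: the midpoint of [a] and
    [b], respectively of [k] and [b], violates the condition. *)
Lemma oleinik_bounds a k b : 0 < a -> k < 0 -> relf a k = 0 ->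
  oleinik f a b -> k <= b < a.
Proof.
move=> a0 k0 rk [ab olE].
have Sb : (f b - f a) / (b - a) = chord a b by [].
have [ab'|ba] := ltP a b.
  have := olE ((a + b) / 2); rewrite Sb -/(chord a ((a + b) / 2)).
  have : chord a ((a + b) / 2) < chord a b by apply: chord_increasing_right; lra.
  move=> H /(_ _)/wrap[]; last by rewrite leNgt H.
  by rewrite (min_l (ltW ab')) (max_r (ltW ab')); lra.
have ba' : b < a by rewrite lt_neqAle ba eq_sym ab.
rewrite ba' andbT leNgt; apply/negP => bk.
have := olE ((k + b) / 2); rewrite Sb -/(chord a ((k + b) / 2)).
have : chord a ((k + b) / 2) < chord a b by apply: chord_decreasing rk _ _ => //; lra.
move=> H /(_ _)/wrap[]; last by rewrite leNgt H.
by rewrite (min_r ba) (max_l ba); lra.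
Qed.

Lemma relf_growth_neg m g a p x : 0 < m -> m <= a -> 0 < g -> p <= x -> x <= 0 ->
  (forall z, p <= z <= x -> g <= - f2 z) -> g * m * (x - p) <= relf a x - relf a p.
Proof.
move=> m0 ma g0 px x0 gP; apply: (mean_value_ge px (fun z _ => is_derive_relf a z)).
by move=> z zP; apply: ler_pM; [lra|lra|apply: gP; lra|lra].
Qed.

Lemma sqr_sub_bound B x a : - B <= x <= B -> - B <= a <= B -> x != a ->
  0 < (x - a) ^+ 2 <= 4 * B ^+ 2.
Proof.
move=> xB aB xa; rewrite exprn_even_gt0//= ?subr_eq0// xa/=.
have : 0 <= (2 * B - (x - a)) * (2 * B + (x - a)) by apply: mulr_ge0; lra.
by rewrite !expr2; lra.
Qed.

(** The derivative of [chord a] is [relf a] divided by a square at most [4 * B ^+ 2], so a linear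
    lower bound on [relf a] integrates to a quadratic one on the chord. *)
Lemma chord_growth B c a p w v : 0 <= c -> - B <= p -> p <= w -> w <= v -> v < a ->
  - B <= a <= B ->
  (forall x, p <= x <= v -> 2 * c * (4 * B ^+ 2) * (x - p) <= relf a x) ->
  c * (v - w) ^+ 2 <= chord a v - chord a w.
Proof.
move=> c0 Bp pw wv va aB rP.
have D z : z != a -> is_derive z (1 : R) (fun z => chord a z - c * ((z - p) * (z - p)))
    (relf a z / (z - a) ^+ 2 - 2 * c * (z - p)).
  by move=> za; have ? := is_derive_chord za; derive_eq; ring.
have zne z : w <= z <= v -> z != a by move=> zP; rewrite lt_eqF//; lra.
have := derive_ge0_le wv (fun z zP => D z (zne z zP)) => /(_ _)/wrap[|H].
  move=> z zP; have zv : w <= z <= v by lra.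
  have zB : - B <= z <= B by lra.
  have /andP[s0 sB] := sqr_sub_bound zB aB (zne z zv).
  rewrite subr_ge0 ler_pdivlMr//; apply: le_trans (rP z _); last by lra.
  rewrite [leRHS]mulrAC; apply: ler_wpM2l => //.
  by apply: mulr_ge0; [apply: mulr_ge0|]; lra.
have cp : 0 <= c * ((w - p) * (v - w)).
  by apply: mulr_ge0 => //; apply: mulr_ge0; lra.
by rewrite expr2; lra.
Qed.

Lemma chord_decay B c a k w v : 0 <= c -> - B <= w -> w <= v -> v <= k -> k < a ->
  - B <= a <= B ->
  (forall x, - B <= x <= k -> relf a x <= - (2 * c * (4 * B ^+ 2) * (k - x))) ->
  c * (v - w) ^+ 2 <= chord a w - chord a v.
Proof.
move=> c0 Bw wv vk ka aB rP.
have D z : z != a -> is_derive z (1 : R) (fun z => chord a z - c * ((k - z) * (k - z)))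
    (relf a z / (z - a) ^+ 2 + 2 * c * (k - z)).
  by move=> za; have ? := is_derive_chord za; derive_eq; ring.
have zne z : w <= z <= v -> z != a by move=> zP; rewrite lt_eqF//; lra.
have := derive_le0_le wv (fun z zP => D z (zne z zP)) => /(_ _)/wrap[|H].
  move=> z zP; have zv : w <= z <= v by lra.
  have zB : - B <= z <= B by lra.
  have /andP[s0 sB] := sqr_sub_bound zB aB (zne z zv).
  rewrite -(opprK (2 * c * _)) subr_le0 ler_pdivrMr//.
  apply: (le_trans (rP z _)); first by lra.
  rewrite mulNr lerN2 [leRHS]mulrAC; apply: ler_wpM2l => //.
  by apply: mulr_ge0; [apply: mulr_ge0|]; lra.
have cp : 0 <= c * ((k - v) * (v - w)).
  by apply: mulr_ge0 => //; apply: mulr_ge0; lra.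
by rewrite expr2; lra.
Qed.

(** Three ranges. Up to [km / 2], away from the inflection point 0, [f2] is bounded away from 0 and
    [relf a] grows linearly; up to 0 it keeps increasing; on the positive side it decreases to its
    value at [a - d], which convexity bounds below. *)
Lemma relf_lower m g h d a k p x B : 0 < m -> m <= a -> a <= B -> 0 < g ->
  k < 0 -> relf a k = 0 -> 0 < d -> d <= m / 2 ->
  forall km, km < 0 -> p <= km ->
  (forall z, p <= z <= km / 2 -> g <= - f2 z) -> (forall z, m / 2 <= z <= B -> h <= f2 z) ->
  k <= p -> p <= x -> x <= a - d ->
  x <= km / 2 /\ g * m * (x - p) <= relf a x \/
  g * m * (- km / 2) <= relf a x \/ h / 2 * d ^+ 2 <= relf a x.
Proof.
move=> m0 ma aB g0 k0 rk d0 dm km km0 pkm gP hP kp px xa.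
have a0 : 0 < a by lra.
have rp : 0 <= relf a p.
  have [->|kp'] := eqVneq p k; first by rewrite rk.
  apply/ltW/(relf_gt0 a0 k0 rk); first by rewrite lt_neqAle eq_sym kp'.
  by rewrite lt_eqF//; lra.
have rlow z : p <= z <= km / 2 -> g * m * (z - p) <= relf a z.
  move=> zP; suff : g * m * (z - p) <= relf a z - relf a p by lra.
  by apply: relf_growth_neg => //; [lra|lra|move=> y yP; apply: gP; lra].
have [xkm|kmx] := leP x (km / 2).
  by left; split => //; apply: rlow; lra.
right; have [x0|x0] := leP x 0.
  left; apply: (@le_trans _ _ (relf a (km / 2))); last first.
    by apply/ltW/relf_increasing_neg.
  have kmp : p <= km / 2 <= km / 2 by lra.
  apply: le_trans (rlow _ kmp); apply: ler_wpM2l; last by lra.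
  by apply: mulr_ge0; lra.
right; apply: (@le_trans _ _ (relf a (a - d))).
  have {1}-> : d = a - (a - d) by ring.
  by apply: relf_ge_sqr; [move=> z zP; apply: hP; lra|lra].
have [->//|xd] := eqVneq x (a - d).
apply/ltW/relf_decreasing_pos; [lra| |lra].
by rewrite lt_neqAle xd.
Qed.

(** The tangency point [km] of [m] lies to the right of that of every [a >= m], so bounds of [f2] on
    intervals fixed by [m] and [B] serve all [a] at once. The point [p] stands for the larger of [k]
    and [- B'], as [k] may lie outside the window. *)
Lemma relf_quantitative m B d : 0 < m -> m <= B -> 0 < d ->
  exists B' c : R, [/\ B <= B', 0 < c & forall a k, m <= a <= B -> k < 0 -> relf a k = 0 ->
  (forall p x, k <= p -> - B' <= p -> p <= - B' \/ p <= k -> p <= x -> x <= a - d ->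
    c * (x - p) <= relf a x) /\
  (forall x, - B' <= x <= k -> relf a x <= - (c * (k - x)))].
Proof.
move=> m0; move: B => B0 mB0 d0.
have [km [km0 rkm]] := tangent_exists m0.
have [B BB0 Bkm] : exists2 B, B0 <= B & - B <= km.
  by exists (Num.max B0 (- km)); [rewrite le_max lexx|rewrite lerNl le_max lexx orbT].
have mB : m <= B by lra.
have [g [g0 gP]] : exists g : R, 0 < g /\ forall x : R, - B <= x <= km / 2 -> g <= - f2 x.
  apply: continuous_pos_lower_bound => [x|x xP].
    by apply: continuousN; exact: cf2.
  by have := @f2_neg x; lra.
have [h [h0 hP]] : exists h : R, 0 < h /\ forall x : R, m / 2 <= x <= B -> h <= f2 x.
  by apply: continuous_pos_lower_bound => // x xP; apply: f2_pos; lra.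
have m20 : 0 < m / 2 by lra.
have [d' [d'0 d'd d'm]] := min_spec d0 m20.
have gm0 : 0 < g * m by apply: mulr_gt0.
have gmk0 : 0 < g * m * (- km / 2) by apply: mulr_gt0; lra.
have hd0 : 0 < h / 2 * d' ^+ 2 by apply: mulr_gt0; [lra|apply: exprn_gt0].
have [c1 [c10 c1a c1b]] := min_spec gmk0 hd0.
have cB0 : 0 < c1 / (2 * B) by apply: divr_gt0; lra.
have [c [c0 ca cb]] := min_spec gm0 cB0.
delay rkm; delay gm0; delay gmk0; delay hd0; delay cB0; delay c1a; delay c1b.
exists B, c; split => // a k aB0 k0 rk; delay rk.
have kkm : k <= km.
  by apply: (tangent_nincr m0 _ km0 (reveal rkm) k0 (reveal rk)); lra.
split => [p x kp Bp pBk px xa|x xP]; last first.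
  have : g * m * (k - x) <= relf a k - relf a x.
    apply: relf_growth_neg => //; try lra.
    by move=> z zP; apply: gP; lra.
  have : c * (k - x) <= g * m * (k - x) by apply: ler_wpM2r => //; lra.
  by rewrite (reveal rk); lra.
have pkm : p <= km by case: pBk; lra.
have xp : 0 <= x - p by lra.
(* Where [relf a] is merely at least [c1], the linear bound follows from [x - p <= 2 * B]. *)
have big : c1 <= relf a x -> c * (x - p) <= relf a x.
  apply: le_trans; apply: (le_trans (ler_wpM2r xp cb)).
  have xpB : x - p <= 2 * B by lra.
  by rewrite -mulrA ger_pMr// ler_pdivrMl ?mulr1//; lra.
have [] := @relf_lower m g h d' a k p x B m0 _ _ g0 k0 (reveal rk) d'0 d'm km km0 pkm _ hP kp px _.
- by lra.
- by lra.
- by move=> z zP; apply: gP; lra.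
- by lra.
- by move=> [_]; apply: le_trans; apply: ler_wpM2r.
by case=> H; apply: big; [exact: le_trans (reveal c1a) H|exact: le_trans (reveal c1b) H].
Qed.

Lemma chord_quantitative B m d : 0 < m -> m <= B -> 0 < d ->
  exists c : R, 0 < c /\ forall a k, m <= a <= B -> k < 0 -> relf a k = 0 ->
  (forall w v, k <= w -> - B <= w -> w <= v -> v <= a - d ->
    c * (v - w) ^+ 2 <= chord a v - chord a w) /\
  (forall w v, - B <= w -> w <= v -> v <= k ->
    c * (v - w) ^+ 2 <= chord a w - chord a v).
Proof.
move=> m0 mB d0; have [B' [c2 [BB c20 rP]]] := relf_quantitative m0 mB d0.
(* [4 * B' ^+ 2] bounds the denominator in the derivative of [chord], and [2 * c] comes from
   differentiating a square with coefficient [c]. *)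
have [c c0 cE] : exists2 c, 0 < c & 2 * c * (4 * B' ^+ 2) = c2.
  exists (c2 / (8 * B' ^+ 2)); last by field; rewrite gt_eqF//; lra.
  by apply: divr_gt0 => //; apply: mulr_gt0 => //; apply: exprn_gt0; lra.
exists c; split => // a k aB k0 rk; have [r1 r2] := rP a k aB k0 rk.
have aB' : - B' <= a <= B' by lra.
split => [w v kw Bw wv va|w v Bw wv vk].
  have [p [pB' pBk kp pw]] :
      exists p, [/\ - B' <= p, p <= - B' \/ p <= k, k <= p & p <= w].
    have [kB|Bk] := leP k (- B'); last by exists k; split => //; [exact: ltW|right].
    by exists (- B'); split => //; [left|lra].
  apply: (@chord_growth B' c a p) => //; [exact: ltW|lra|].
  by rewrite cE => x xP; apply: r1 => //; lra.
apply: (@chord_decay B' c a k) => //; [exact: ltW|lra|lra|].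
by rewrite cE.
Qed.

End FluxShape.

(** * Relative entropy fluxes through a moving path *)

Section RelativeQuantities.
Context {R : realType} (f f1 eta e1 e2 q : R -> R).
Context (df : forall x : R, is_derive x (1 : R) f (f1 x)).
Context (de : forall x : R, is_derive x (1 : R) eta (e1 x)).
Context (de1 : forall x : R, is_derive x (1 : R) e1 (e2 x)).
Context (dq : forall x : R, is_derive x (1 : R) q (e1 x * f1 x)).
Implicit Types (a b c d g k kap s v w x y B E L : R).

Definition releta b v : R := eta v - eta b - e1 b * (v - b).
(** Relative entropy flux through a path of speed [s]; its values at the two traces are the brackets
    of the theorem. *)
Definition relQ s b v : R :=
  s * releta b v - (q v - q b - e1 b * (f v - f b)).

Lemma is_derive_releta b v : is_derive v (1 : R) (releta b) (e1 v - e1 b).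
Proof. by rewrite /releta; derive_eq; ring. Qed.

Lemma is_derive_relQ s b v :
  is_derive v (1 : R) (relQ s b) ((e1 v - e1 b) * (s - f1 v)).
Proof.
by have ? := is_derive_releta b v; rewrite /relQ; derive_eq; ring.
Qed.

Lemma relQxx s b : relQ s b b = 0.
Proof. by rewrite /relQ /releta; ring. Qed.

Lemma relQD s d b v : relQ (s + d) b v = relQ s b v + d * releta b v.
Proof. by rewrite /relQ; ring. Qed.

Lemma releta_ge_sqr kap B b v :
  (forall x, - B <= x <= B -> kap <= e2 x) -> - B <= b <= B -> - B <= v <= B ->
  kap / 2 * (v - b) ^+ 2 <= releta b v.
Proof.
move=> e2P bB vB.
have D z : is_derive z (1 : R) (fun z => releta b z - kap / 2 * ((z - b) * (z - b)))
    (e1 z - e1 b - kap * (z - b)).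
  by have ? := is_derive_releta b z; derive_eq; field.
suff : releta b b - kap / 2 * ((b - b) * (b - b)) <=
       releta b v - kap / 2 * ((v - b) * (v - b)).
  by rewrite /releta !subrr !mulr0 !subr0 subr_ge0.
have [bv|vb] := leP b v.
  apply: (derive_ge0_le bv (fun z _ => D z)) => z zP; rewrite subr_ge0.
  apply: (mean_value_ge _ (fun x _ => de1 x)); first lra.
  by move=> x xP; apply: e2P; lra.
apply: (derive_le0_le (ltW vb) (fun z _ => D z)) => z zP.
have zb : z <= b by lra.
have := @mean_value_ge _ _ _ _ _ kap zb (fun x _ => de1 x) => /(_ _)/wrap[x xP|]; last lra.
by apply: e2P; lra.
Qed.

Lemma relQ_le0 s b v : (forall x, 0 < e2 x) ->
  (forall w, b <= w <= v \/ v <= w <= b -> s <= f1 w) -> relQ s b v <= 0.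
Proof.
move=> e2_pos sP; rewrite -(relQxx s b).
have [bv|vb] := leP b v.
  apply: (derive_le0_le bv (fun z _ => is_derive_relQ s b z)) => z zP.
  have bz : b <= z by lra.
  have H := derive_ge0_le bz (fun x _ => de1 x) (fun x _ => ltW (e2_pos x)).
  by apply: mulr_ge0_le0; first lra; have := sP z; lra.
apply: (derive_ge0_le (ltW vb) (fun z _ => is_derive_relQ s b z)) => z zP.
have zb : z <= b by lra.
have H := derive_ge0_le zb (fun x _ => de1 x) (fun x _ => ltW (e2_pos x)).
by apply: mulr_le0; first lra; have := sP z; lra.
Qed.

(** The margin [d] is spent on the entropy term: the flux is already nonpositive at speed [s + d],
    and slowing down by [d] subtracts [d * releta b v]. *)
Lemma relQ_le_sqr kap d s B b v : (forall x, 0 < e2 x) -> 0 <= d ->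
  (forall x, - B <= x <= B -> kap <= e2 x) -> - B <= b <= B -> - B <= v <= B ->
  (forall w, b <= w <= v \/ v <= w <= b -> s + d <= f1 w) ->
  relQ s b v <= - (d * (kap / 2 * (v - b) ^+ 2)).
Proof.
move=> e2_pos d0 e2P bB vB sP; have := relQ_le0 e2_pos sP; rewrite relQD.
have := ler_wpM2l d0 (releta_ge_sqr e2P bB vB); lra.
Qed.

Lemma relQ_lipschitz E1 L1 s B b v w : - B <= b <= B -> - B <= v <= B -> - B <= w <= B ->
  (forall x, - B <= x <= B -> `|e1 x| <= E1) ->
  (forall x, - B <= x <= B -> `|f1 x| <= L1) -> `|s| <= L1 + 1 ->
  `|relQ s b v - relQ s b w| <= 2 * E1 * (2 * L1 + 1) * `|v - w|.
Proof.
move=> bB vB wB E1P L1P sL.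
apply: (derive_bounded_lipschitz (is_derive_relQ s b)) vB wB => x xB.
rewrite normrM; apply: ler_pM => //.
  by apply: (le_trans (ler_normB _ _)); have := E1P x xB; have := E1P b bB; lra.
by apply: (le_trans (ler_normB _ _)); have := L1P x xB; lra.
Qed.

Lemma relQ_bounded E1 L1 s B b v : - B <= b <= B -> - B <= v <= B ->
  (forall x, - B <= x <= B -> `|e1 x| <= E1) ->
  (forall x, - B <= x <= B -> `|f1 x| <= L1) -> `|s| <= L1 + 1 ->
  `|relQ s b v| <= 2 * E1 * (2 * L1 + 1) * (2 * B).
Proof.
move=> bB vB E1P L1P sL; rewrite -[relQ s b v]subr0 -(relQxx s b).
apply: (le_trans (relQ_lipschitz bB vB bB E1P L1P sL)).
have e0 : 0 <= E1 by apply: le_trans (E1P b bB).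
have l0 : 0 <= L1 by apply: le_trans (L1P b bB).
apply: ler_wpM2l; first by rewrite !mulr_ge0//; lra.
by rewrite ler_norml; lra.
Qed.

(* [relQ s b] plus a multiple of the affine defect [f w - c - s w]: its
   derivative has the sign of this defect, and it equals [relQ s b] wherever
   the defect vanishes. *)
Definition relP c s b w : R := relQ s b w + (e1 w - e1 b) * (f w - c - s * w).

Lemma is_derive_relP c s b w :
  is_derive w (1 : R) (relP c s b) (e2 w * (f w - c - s * w)).
Proof.
by have ? := is_derive_relQ s b w; rewrite /relP; derive_eq; ring.
Qed.

Lemma relPxx c s b : relP c s b b = 0.
Proof. by rewrite /relP relQxx subrr mul0r addr0. Qed.

Lemma relPE c s b v : f v - c - s * v = 0 -> relP c s b v = relQ s b v.
Proof. by move=> E; rewrite /relP E mulr0 addr0. Qed.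

(** [relP] is integrated from [b], where it vanishes, to [v], where it equals [relQ]. Only a
    one-sided bound on the defect enters: from below if [b <= v], from above otherwise. *)
Lemma relQ_ge_defect c s b v E2 g B : 0 <= g -> - B <= b <= B -> - B <= v <= B ->
  (forall x, - B <= x <= B -> 0 <= e2 x <= E2) -> f v - c - s * v = 0 ->
  (forall w, b <= w <= v -> - g <= f w - c - s * w) ->
  (forall w, v <= w <= b -> f w - c - s * w <= g) ->
  - (E2 * g * (2 * B)) <= relQ s b v.
Proof.
move=> g0 bB vB E2P fv right left; rewrite -(relPE b fv).
have E20 : 0 <= E2 by have := E2P b bB; lra.
have Eg0 : 0 <= E2 * g by rewrite mulr_ge0.
have [bv|vb] := leP b v.
  have := @mean_value_ge _ _ _ _ _ (- (E2 * g)) bv (fun z _ => is_derive_relP c s b z).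
  move=> /(_ _)/wrap[z zP|].
    have zE : 0 <= e2 z <= E2 by apply: E2P; lra.
    have zG : - g <= f z - c - s * z by apply: right; lra.
    apply: (@le_trans _ _ (e2 z * - g)).
      by rewrite mulrN lerN2; apply: ler_wpM2r => //; lra.
    by apply: ler_wpM2l => //; lra.
  rewrite relPxx subr0; apply: le_trans; rewrite mulNr lerN2.
  by apply: ler_wpM2l => //; lra.
have := @mean_value_le _ _ _ _ _ (E2 * g) (ltW vb) (fun z _ => is_derive_relP c s b z).
move=> /(_ _)/wrap[z zP|].
  have zE : 0 <= e2 z <= E2 by apply: E2P; lra.
  have zG : f z - c - s * z <= g by apply: left; lra.
  apply: (@le_trans _ _ (e2 z * g)).
    by apply: ler_wpM2l => //; lra.
  by apply: ler_wpM2r => //; lra.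
rewrite relPxx sub0r => H; rewrite lerNl; apply: (le_trans H).
by apply: ler_wpM2l => //; lra.
Qed.

End RelativeQuantities.

(** * Entropy dissipation of shocks issued from a given left state *)

Section ShockDissipation.
Context {R : realType} (f f1 f2 eta e1 e2 : R -> R).
Context (df : forall x : R, is_derive x (1 : R) f (f1 x)).
Context (df1 : forall x : R, is_derive x (1 : R) f1 (f2 x)).
Context (cf2 : continuous f2).
Context (f2_pos : forall x : R, 0 < x -> 0 < f2 x).
Context (f2_neg : forall x : R, x < 0 -> f2 x < 0).
Context (f1_ninfty : forall A : R, exists x : R, x < 0 /\ A < f1 x).
Context (de : forall x : R, is_derive x (1 : R) eta (e1 x)).
Context (de1 : forall x : R, is_derive x (1 : R) e1 (e2 x)).
Context (ce2 : continuous e2).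
Context (e2_pos : forall x : R, 0 < e2 x).
Implicit Types (q : R -> R) (a b c d k m v w x y z B : R).

Local Notation "'entropy_flux_for' q" :=
  (forall x : R, is_derive x (1 : R) q (e1 x * f1 x)) (at level 10).

(* Minus the entropy dissipation of the discontinuity joining [a] to [v]. *)
Definition dissip q a v : R := chord f a v * (eta v - eta a) - (q v - q a).

Lemma dissip_relQ q a v : v != a -> dissip q a v = relQ f eta e1 q (chord f a v) a v.
Proof.
move=> va; rewrite /dissip /relQ /releta /chord; field.
by rewrite subr_eq0.
Qed.

Lemma entropy_dissipationE q a v : v != a ->
  entropy_dissipation f eta q a v = - dissip q a v.
Proof.
move=> va; rewrite /entropy_dissipation /shock_speed /dissip /chord.
have -> : (f a - f v) / (a - v) = (f v - f a) / (v - a).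
  by rewrite -opprB -(opprB v a) invrN mulrNN.
by ring.
Qed.

(** The fraction is the derivative of [chord f a], and [releta eta e1 v a] is positive by convexity.
    For [a > 0] the dissipation [dissip q a] thus increases up to the tangency point, decreases from
    there to 0 at [a], and is negative beyond. *)
Lemma is_derive_dissip q a v : entropy_flux_for q -> v != a ->
  is_derive v (1 : R) (dissip q a)
    (- (relf f f1 a v / (v - a) ^+ 2) * releta eta e1 v a).
Proof.
move=> dq va; have ? := is_derive_chord df va; have ? := dq v.
rewrite /dissip; derive_eq.
rewrite /chord /relf /releta; field.
by rewrite subr_eq0.
Qed.

Lemma e2_lower_bound B : exists kap : R, 0 < kap /\ forall x : R, - B <= x <= B -> kap <= e2 x.
Proof. exact: continuous_pos_lower_bound. Qed.

Lemma defect_chord a v w : w != a -> v != a ->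
  f w - (f a - chord f a v * a) - chord f a v * w = (w - a) * (chord f a w - chord f a v).
Proof.
move=> wa va; rewrite /chord; field.
by rewrite !subr_eq0 wa va.
Qed.

Lemma defect_chord_end a v : v != a ->
  f v - (f a - chord f a v * a) - chord f a v * v = 0.
Proof. by move=> va; rewrite defect_chord// subrr mulr0. Qed.

(** For the line through the two states, [relP] is nonincreasing from [v], where it is the
    dissipation, to [a], where it is 0. The bound is its drop over the middle third of [[v, v + d]],
    on which all factors of its derivative stay away from 0. *)
Lemma dissip_ge_left m B d : 0 < m -> m <= B -> 0 < d ->
  exists c : R, 0 < c /\ forall q, entropy_flux_for q ->
  forall a k v, m <= a <= B -> k < 0 -> relf f f1 a k = 0 ->
  k <= v -> - B <= v -> v <= a - d -> c <= dissip q a v.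
Proof.
move=> m0 mB d0; have d3 : 0 < d / 3 by lra.
have [c [c0 cP]] := chord_quantitative df df1 cf2 f2_pos f2_neg f1_ninfty m0 mB d3.
have [kap [kap0 kapP]] := e2_lower_bound B.
exists (kap * ((d / 3) * (c * (d / 3) ^+ 2)) * (d / 3)); split.
  by repeat apply: mulr_gt0 => //; exact: exprn_gt0.
move=> q dq a k v aB k0 rk kv Bv va; have a0 : 0 < a by lra.
have va' : v != a by rewrite lt_eqF//; lra.
have [cP1 _] := cP a k aB k0 rk.
set s := chord f a v; pose C := f a - s * a.
have defE w : w != a -> f w - C - s * w = (w - a) * (chord f a w - s).
  by move=> wa; exact: defect_chord.
rewrite dissip_relQ// -(relPE eta e1 q a (defect_chord_end va')).
have D z := is_derive_relP df de de1 dq C s a z.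
have nincr x y : v <= x -> x <= y -> y <= a -> relP f eta e1 q C s a y <= relP f eta e1 q C s a x.
  move=> vx xy ya; apply: (derive_le0_le xy (fun z _ => D z)) => z zP.
  apply: mulr_ge0_le0; first exact: ltW.
  rewrite defE; last by rewrite lt_eqF//; lra.
  apply: mulr_le0_ge0; first lra.
  have [->|vz] := eqVneq z v; first by rewrite subrr.
  rewrite subr_ge0; apply/ltW/(chord_increasing_left df df1 f2_pos f2_neg a0 k0 rk kv); last lra.
  by rewrite lt_neqAle eq_sym vz; lra.
have h1 : v <= v + d / 3 by lra.
have h2 : v + d / 3 <= v + 2 * (d / 3) by lra.
have h3 : v + 2 * (d / 3) <= a by lra.
apply: le_trans (nincr v (v + d / 3) _ h1 _); [|lra|lra].
have pge0 : 0 <= relP f eta e1 q C s a (v + 2 * (d / 3)).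
  by rewrite -(relPxx f eta e1 q C s a); apply: nincr; lra.
set X := kap * _.
have := @mean_value_le _ _ _ _ _ (- X) h2 (fun z _ => D z).
have -> : v + 2 * (d / 3) - (v + d / 3) = d / 3 by ring.
move=> /(_ _)/wrap[z zP|]; last lra.
rewrite defE; last by rewrite lt_eqF//; lra.
rewrite lerNr -mulrN /X; apply: ler_pM.
- exact: ltW.
- by rewrite !mulr_ge0 ?exprn_ge0//; lra.
- by apply: kapP; lra.
rewrite -mulNr opprB; apply: ler_pM.
- lra.
- by rewrite mulr_ge0 ?exprn_ge0//; lra.
- lra.
apply: le_trans (cP1 v z kv Bv _ _); [|lra|lra].
by rewrite ler_pM2l// ler_sqr ?nnegrE; lra.
Qed.

Lemma chord_growth_right h a v w : 0 < a -> a < v -> v <= w ->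
  (forall z, a <= z <= w -> h <= f2 z) -> h / 2 * (w - v) <= chord f a w - chord f a v.
Proof.
move=> a0 av vw hP.
have D z : v <= z <= w -> is_derive z (1 : R) (chord f a) (relf f f1 a z / (z - a) ^+ 2).
  by move=> zP; apply: is_derive_chord => //; rewrite gt_eqF//; lra.
apply: (mean_value_ge vw D) => z zP.
have za : 0 < z - a by lra.
rewrite ler_pdivlMr ?exprn_gt0//.
have D' y : is_derive y (1 : R) (fun y => relf f f1 a y - h / 2 * ((y - a) * (y - a)))
    (f2 y * (y - a) - h * (y - a)).
  by have ? := is_derive_relf df df1 a y; derive_eq; field.
have az : a <= z by lra.
have := derive_ge0_le az (fun z _ => D' z) => /(_ _)/wrap[y yP|].
  by have : h <= f2 y by [apply: hP; lra]; nra.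
by rewrite relfxx subrr mul0r mulr0 subr0 subr_ge0.
Qed.

Lemma dissip_le_right m B d : 0 < m -> m <= B -> 0 < d ->
  exists c : R, 0 < c /\ forall q, entropy_flux_for q ->
  forall a v, m <= a <= B -> a + d <= v -> v <= B -> dissip q a v <= - c.
Proof.
move=> m0 mB d0; have d3 : 0 < d / 3 by lra.
have [kap [kap0 kapP]] := e2_lower_bound B.
have [h [h0 hP]] : exists h : R, 0 < h /\ forall x : R, m <= x <= B -> h <= f2 x.
  by apply: continuous_pos_lower_bound => // x xP; apply: f2_pos; lra.
exists (kap * ((d / 3) * (h / 2 * (d / 3))) * (d / 3)); split.
  by repeat apply: mulr_gt0 => //; lra.
move=> q dq a v aB av vB; have a0 : 0 < a by lra.
have va' : v != a by rewrite gt_eqF//; lra.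
set s := chord f a v; pose C := f a - s * a.
have defE w : w != a -> f w - C - s * w = (w - a) * (chord f a w - s).
  by move=> wa; exact: defect_chord.
rewrite dissip_relQ// -(relPE eta e1 q a (defect_chord_end va')).
have D z := is_derive_relP df de de1 dq C s a z.
have nincr x y : a <= x -> x <= y -> y <= v -> relP f eta e1 q C s a y <= relP f eta e1 q C s a x.
  move=> ax xy yv; apply: (derive_le0_le xy (fun z _ => D z)) => z zP.
  apply: mulr_ge0_le0; first exact: ltW.
  rewrite defE; last by rewrite gt_eqF//; lra.
  apply: mulr_ge0_le0; first lra.
  rewrite subr_le0; apply/ltW/(chord_increasing_right df df1 f2_pos a0); lra.
have h2 : a + d / 3 <= a + 2 * (d / 3) by lra.
apply: (@le_trans _ _ (relP f eta e1 q C s a (a + 2 * (d / 3)))).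
  by apply: nincr; lra.
have pge0 : relP f eta e1 q C s a (a + d / 3) <= 0.
  by rewrite -(relPxx f eta e1 q C s a); apply: nincr; lra.
set X := kap * _.
have := @mean_value_le _ _ _ _ _ (- X) h2 (fun z _ => D z).
have -> : a + 2 * (d / 3) - (a + d / 3) = d / 3 by ring.
move=> /(_ _)/wrap[z zP|]; last lra.
rewrite defE; last by rewrite gt_eqF//; lra.
rewrite lerNr -mulrN /X; apply: ler_pM.
- exact: ltW.
- by rewrite !mulr_ge0//; lra.
- by apply: kapP; lra.
rewrite -mulrN opprB; apply: ler_pM.
- lra.
- by rewrite mulr_ge0//; lra.
- lra.
have az : a < z by lra.
have zv : z <= v by lra.
apply: le_trans (@chord_growth_right h a z v a0 az zv _).
  by apply: ler_wpM2l; lra.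
by move=> y yP; apply: hP; lra.
Qed.

(** Left of [k], [dissip q a + g * chord f a] is nondecreasing, [g] being a lower bound of the
    relative entropy at distance at least [m] from [a]. The quadratic variation of the chord is
    inherited. *)
Lemma dissip_growth m B : 0 < m -> m <= B ->
  exists c : R, 0 < c /\ forall q, entropy_flux_for q ->
  forall a k v w, m <= a <= B -> k < 0 -> relf f f1 a k = 0 ->
  - B <= w -> w <= v -> v <= k -> c * (v - w) ^+ 2 <= dissip q a v - dissip q a w.
Proof.
move=> m0 mB; have [c [c0 cP]] :=
  chord_quantitative df df1 cf2 f2_pos f2_neg f1_ninfty m0 mB ltr01.
have [kap [kap0 kapP]] := e2_lower_bound B.
have g0 : 0 < kap / 2 * m ^+ 2 by rewrite mulr_gt0 ?exprn_gt0//; lra.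
exists (kap / 2 * m ^+ 2 * c); split; first exact: mulr_gt0.
move=> q dq a k v w aB k0 rk Bw wv vk; have a0 : 0 < a by lra.
have [_ cP2] := cP a k aB k0 rk.
set g := kap / 2 * m ^+ 2 in g0 *.
have zne z : w <= z <= v -> z != a by move=> zP; rewrite lt_eqF//; lra.
have D z : w <= z <= v -> is_derive z (1 : R) (fun z => dissip q a z + g * chord f a z)
    (relf f f1 a z / (z - a) ^+ 2 * (g - releta eta e1 z a)).
  move=> /zne za; have ? := is_derive_dissip dq za; have ? := is_derive_chord df za.
  by derive_eq; ring.
have := derive_ge0_le wv D => /(_ _)/wrap[z zP|].
  have za : 0 < (z - a) ^+ 2.
    by rewrite exprn_even_gt0//= subr_eq0 lt_eqF//; lra.
  apply: mulr_le0.
    rewrite pmulr_lle0 ?invr_gt0//.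
    by apply/ltW/(relf_lt0 df df1 f2_neg a0 k0 rk); lra.
  rewrite subr_le0.
  have zB : - B <= z <= B by lra.
  have aB' : - B <= a <= B by lra.
  apply: le_trans (releta_ge_sqr de de1 kapP zB aB').
  by apply: ler_wpM2l; [lra|rewrite ler_sqr ?nnegrE; lra].
have := ler_wpM2l (ltW g0) (cP2 w v Bw wv vk); rewrite -mulrA; lra.
Qed.

(** The dissipation is negative right of [a], positive on [[k, a[] and strictly increasing left of
    [k]: it has at most one zero other than [a]. *)
Lemma phi_flat0E q a k b : entropy_flux_for q -> 0 < a -> k < 0 -> relf f f1 a k = 0 ->
  b < k -> dissip q a b = 0 -> phi_flat0 f eta q a = b.
Proof.
move=> dq a0 k0 rk bk Eb; rewrite /phi_flat0 gt_eqF//.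
have ba : b != a by rewrite lt_eqF//; lra.
apply: xget_unique => /= [|v [va]]; first by rewrite entropy_dissipationE// Eb oppr0.
rewrite entropy_dissipationE// => /eqP; rewrite oppr_eq0 => /eqP Ev.
have [av|va'] := leP a v.
  have av' : a < v by rewrite lt_neqAle eq_sym va.
  have vd : 0 < v - a by lra.
  have [c [c0 cP]] := @dissip_le_right a v (v - a) a0 (ltW av') vd.
  have := cP q dq a v; rewrite lexx (ltW av') Ev subrKC lexx => /(_ erefl erefl erefl); lra.
have [kv|vk] := leP k v.
  have vd : 0 < a - v by lra.
  have aB : a <= Num.max a (- v) by rewrite le_max lexx.
  have vB : - Num.max a (- v) <= v by rewrite lerNl le_max lexx orbT.
  have [c [c0 cP]] := @dissip_ge_left a (Num.max a (- v)) (a - v) a0 aB vd.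
  have := cP q dq a k v; rewrite lexx aB Ev => /(_ erefl k0 rk kv vB).
  by rewrite subKr lexx => /(_ erefl); lra.
have H x y : x <= y -> y < k -> dissip q a x = 0 -> dissip q a y = 0 -> x = y.
  move=> xy yk Ex Ey.
  have aB : a <= Num.max a (- x) by rewrite le_max lexx.
  have xB : - Num.max a (- x) <= x by rewrite lerNl le_max lexx orbT.
  have [c [c0 cP]] := @dissip_growth a (Num.max a (- x)) a0 aB.
  have := cP q dq a k y x; rewrite lexx aB Ex Ey => /(_ erefl k0 rk xB xy (ltW yk)).
  rewrite subrr pmulr_rle0// => yx.
  have /eqP : (y - x) ^+ 2 == 0 by rewrite eq_le yx sqr_ge0.
  by move=> /eqP; rewrite sqrf_eq0 subr_eq0 => /eqP.
by have [vb|/ltW bv] := leP v b; [apply: H|apply/esym/H].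
Qed.

(** Left of the tangency point, the position of the zero [phi_flat0] relative to [v] is read off the
    sign of the dissipation at [v - m]; its growth over a length [m] then gives the constant. *)
Lemma dissip_dichotomy m M d : 0 < m -> m <= M -> m <= 1 -> 0 < d ->
  exists c : R, 0 < c /\ forall q, entropy_flux_for q ->
  forall a v, m <= a <= M -> - M <= v <= M -> d <= `|v - a| ->
  m <= `|v - phi_flat0 f eta q a| -> dissip q a v <= - c \/ c <= dissip q a v.
Proof.
move=> m0 mM m1 d0.
have [c1 [c10 cP1]] := dissip_le_right m0 mM d0.
(* The window is enlarged by 1 because the dissipation is also evaluated at [v - m], with
   [m <= 1]. *)
have mM1 : m <= M + 1 by lra.
have [c2 [c20 cP2]] := dissip_ge_left m0 mM1 d0.
have [c3 [c30 cP3]] := dissip_growth m0 mM1.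
have c3m : 0 < c3 * m ^+ 2 by rewrite mulr_gt0// exprn_gt0.
have [c4 [c40 c41 c42]] := min_spec c10 c20.
have [c [c0 ca cb]] := min_spec c40 c3m.
exists c; split => // q dq a v aM vM dva mvb; have a0 : 0 < a by lra.
have [k [k0 rk]] := tangent_exists df df1 f2_pos f2_neg f1_ninfty a0.
have [av|va] := leP a v.
  move: dva; rewrite ger0_norm ?subr_ge0// => dva; left.
  by have := cP1 q dq a v aM => /(_ _ _)/wrap[||]; lra.
move: dva; rewrite ltr0_norm ?subr_lt0// => dva.
have aM' : m <= a <= M + 1 by lra.
have [kv|vk] := leP k v.
  by right; have := cP2 q dq a k v aM' k0 rk kv => /(_ _ _)/wrap[||]; lra.
have grow x y := cP3 q dq a k y x aM' k0 rk.
delay rk; delay mvb; delay c3m; delay cb; delay c41; delay c42.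
have vmm : v - (v - m) = m by ring.
have mmv : v + m - v = m by ring.
have kka : k != a by rewrite lt_eqF//; lra.
have Xk : 0 < dissip q a k.
  have kd : 0 < a - k by lra.
  have aB : a <= Num.max a (- k) by rewrite le_max lexx.
  have kB : - Num.max a (- k) <= k by rewrite lerNl le_max lexx orbT.
  have [c' [c'0 c'P]] := @dissip_ge_left a (Num.max a (- k)) (a - k) a0 aB kd.
  have := c'P q dq a k k; rewrite lexx aB => /(_ erefl k0 (reveal rk) (lexx _) kB).
  by rewrite subKr lexx => /(_ erefl); lra.
have [Xm|Xm] := leP 0 (dissip q a (v - m)).
  right; have : c3 * (v - (v - m)) ^+ 2 <= dissip q a v - dissip q a (v - m).
    by apply: grow; lra.
  by move: (reveal cb); rewrite vmm; lra.
left.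
(* A zero lies between [v - m] and [k]. It is [phi_flat0], hence at distance at least [m] from [v],
   hence at least [v + m]. *)
have vmk : v - m <= k by lra.
have [| |b] := @IVT _ (dissip q a) (v - m) k 0 vmk.
- apply: derivable_within_continuous => x; rewrite in_itv/= => xP.
  have xa : x != a by rewrite lt_eqF//; lra.
  by have ? := is_derive_dissip dq xa; exact: ex_derive.
- by rewrite ge_min le_max (ltW Xm) (ltW Xk) orbT.
rewrite in_itv/= => bP Xb.
have bk : b < k by rewrite lt_neqAle; apply/andP; split; [|lra];
  apply: contra_eq_neq Xb => ->; rewrite gt_eqF.
have vmb : b != v - m by apply: contra_eq_neq Xb => ->; rewrite lt_eqF.
have {}mvb := reveal mvb; rewrite (phi_flat0E dq a0 k0 (reveal rk) bk Xb) in mvb.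
have vb : v + m <= b.
  have [vb|bv] := leP v b; first by move: mvb; rewrite ler0_norm; lra.
  move: mvb; rewrite gtr0_norm ?subr_gt0// => mvb.
  by move: vmb; rewrite eq_le; lra.
have : c3 * (v + m - v) ^+ 2 <= dissip q a (v + m) - dissip q a v.
  by apply: grow; lra.
have : c3 * (b - (v + m)) ^+ 2 <= dissip q a b - dissip q a (v + m).
  by apply: grow; lra.
have := mulr_ge0 (ltW c30) (sqr_ge0 (b - (v + m))).
by move: (reveal cb); rewrite mmv Xb; lra.
Qed.

End ShockDissipation.

(** * Right flux across a shock whose left state is close to [uL] *)

Section ShockEstimates.
Context {R : realType} (f f1 f2 eta e1 e2 : R -> R).
Context (df : forall x : R, is_derive x (1 : R) f (f1 x)).
Context (df1 : forall x : R, is_derive x (1 : R) f1 (f2 x)).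
Context (cf2 : continuous f2).
Context (f2_pos : forall x : R, 0 < x -> 0 < f2 x).
Context (f2_neg : forall x : R, x < 0 -> f2 x < 0).
Context (f1_ninfty : forall A : R, exists x : R, x < 0 /\ A < f1 x).
Context (de : forall x : R, is_derive x (1 : R) eta (e1 x)).
Context (de1 : forall x : R, is_derive x (1 : R) e1 (e2 x)).
Context (ce2 : continuous e2).
Context (e2_pos : forall x : R, 0 < e2 x).
Implicit Types (q : R -> R) (a b c d k m v w x y z s um up B C D L E M : R).

Local Notation "'entropy_flux_for' q" :=
  (forall x : R, is_derive x (1 : R) q (e1 x * f1 x)) (at level 10).
Local Notation relQ := (relQ f eta e1).

Lemma quadratic_upper c x y : 0 < c -> x * y - c * y ^+ 2 <= x ^+ 2 / (4 * c).
Proof.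
move=> c0; rewrite -subr_ge0.
have -> : x ^+ 2 / (4 * c) - (x * y - c * y ^+ 2) = c * (y - x / (2 * c)) ^+ 2.
  by field; rewrite gt_eqF.
by rewrite mulr_ge0 ?sqr_ge0// ltW.
Qed.

Lemma rankine_hugoniot_mean s um up : um != up -> s * (up - um) = f up - f um ->
  exists z, (um < z < up \/ up < z < um) /\ s = f1 z.
Proof.
rewrite neq_lt => /orP[lt|lt] E.
  have [z [zP zE]] := mean_value lt (fun x _ => df x); exists z; split; first by left.
  by apply: (@mulIf _ (up - um)); rewrite ?E// subr_eq0 gt_eqF.
have [z [zP zE]] := mean_value lt (fun x _ => df x); exists z; split; first by right.
apply: (@mulIf _ (um - up)); first by rewrite subr_eq0 gt_eqF.
by rewrite -zE -opprB mulrN E opprB.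
Qed.

(** The derivative [(e1 z - e1 b) * (f1 a - f1 z)] is nonnegative on [[b, a]], since [f1 a] is the
    largest value of [f1] on [[k, a]]. On [[a - m / 2, a - m / 4]] both factors are bounded
    below. *)
Lemma speed_gap m M : 0 < m -> m <= M ->
  exists c : R, 0 < c /\ forall q, entropy_flux_for q ->
  forall a k b, m <= a <= M -> k < 0 -> relf f f1 a k = 0 -> k <= b -> - M <= b ->
  b <= a - m -> c <= relQ q (f1 a) b a.
Proof.
move=> m0 mM; have [kap [kap0 kapP]] := e2_lower_bound ce2 e2_pos M.
have [h [h0 hP]] : exists h : R, 0 < h /\ forall x : R, m / 2 <= x <= M -> h <= f2 x.
  by apply: continuous_pos_lower_bound => // x xP; apply: f2_pos; lra.
exists (kap * (m / 2) * (h * (m / 4)) * (m / 4)); split.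
  by repeat apply: mulr_gt0 => //; lra.
move=> q dq a k b aM k0 rk kb Mb ba; have a0 : 0 < a by lra.
have D z := is_derive_relQ df de dq (f1 a) b z.
have kapE z : b <= z <= M -> kap * (z - b) <= e1 z - e1 b.
  move=> zP; apply: (mean_value_ge _ (fun x _ => de1 x)); first lra.
  by move=> x xP; apply: kapP; lra.
have incr x y : b <= x -> x <= y -> y <= a -> relQ q (f1 a) b x <= relQ q (f1 a) b y.
  move=> bx xy ya; apply: (derive_ge0_le xy (fun z _ => D z)) => z zP.
  apply: mulr_ge0.
    have zM : b <= z <= M by lra.
    have := kapE z zM; have : 0 <= kap * (z - b) by apply: mulr_ge0; lra.
    by lra.
  by rewrite subr_ge0; apply: (f1_le_right df df1 f2_pos f2_neg a0 k0 rk); lra.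
have h2 : a - m / 2 <= a - m / 4 by lra.
apply: (@le_trans _ _ (relQ q (f1 a) b (a - m / 4))); last by apply: incr; lra.
have p0 : 0 <= relQ q (f1 a) b (a - m / 2).
  by rewrite -(relQxx f eta e1 q (f1 a) b); apply: incr; lra.
set X := _ * (h * _).
have := @mean_value_ge _ _ _ _ _ X h2 (fun z _ => D z).
have -> : a - m / 4 - (a - m / 2) = m / 4 by field.
move=> /(_ _)/wrap[z zP|]; last lra.
have zM : b <= z <= M by lra.
apply: ler_pM.
- by rewrite mulr_ge0//; lra.
- by rewrite mulr_ge0//; lra.
- by apply: le_trans (kapE z zM); rewrite ler_pM2l//; lra.
apply: (@le_trans _ _ (h * (a - z))); first by rewrite ler_pM2l//; lra.
have za : z <= a by lra.
by apply: (mean_value_ge za (fun x _ => df1 x)) => x xP; apply: hP; lra.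
Qed.

(* The shock reaches [up] beyond the tangency point [k]: the Kruzkov condition
   keeps the graph of [f] below the chord at [k], hence on [k, um]. *)
Lemma defect_le0_beyond k s C um up w : k < 0 -> up < k -> 0 < um ->
  f um - C - s * um = 0 -> f up - C - s * up = 0 -> f k - C - s * k <= 0 ->
  k <= w <= um -> f w - C - s * w <= 0.
Proof.
move=> k0 upk um0 Gum Gup Gk wP; pose G w := f w - C - s * w.
have DG z : is_derive z (1 : R) G (f1 z - s) by rewrite /G; derive_eq; ring.
(* On the concave side: a positive value at [x] would require a slope of [f] above [s] right of [k]
   and one at most [s] left of it. *)
have G0 x : k <= x <= 0 -> G x <= 0.
  move=> xP; have [<-//|kx] := eqVneq k x.
  have kx' : k < x by rewrite lt_neqAle kx; lra.
  rewrite leNgt; apply/negP => Gx.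
  have [z [zP zE]] := mean_value kx' (fun x _ => DG x).
  have [y [yP yE]] := mean_value upk (fun x _ => DG x).
  have yz : f1 z < f1 y by apply: (f1_decreasing df1 f2_neg); lra.
  have z0 : 0 < f1 z - s.
    by rewrite -(@pmulr_lgt0 _ (x - k)) -?zE /G; [rewrite -/(G x); move: Gx Gk; rewrite /G; lra|lra].
  have y0 : f1 y - s <= 0.
    by rewrite -(@pmulr_lle0 _ (k - up)) -?yE /G; [move: Gup Gk; lra|lra].
  by lra.
have [w0|w0] := leP w 0; first by apply: G0; lra.
have [->|wum] := eqVneq w um; first by rewrite Gum.
have wum' : w < um by rewrite lt_neqAle wum; lra.
(* On the convex side, the values at 0 and at [um] are at most 0, hence so is every value in
   between. *)
rewrite leNgt; apply/negP => Gw.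
have [z [zP zE]] := mean_value w0 (fun x _ => DG x).
have [y [yP yE]] := mean_value wum' (fun x _ => DG x).
have zy : f1 z < f1 y by apply: (f1_increasing df1 f2_pos); lra.
have G00 : G 0 <= 0 by apply: G0; lra.
have z0 : 0 < f1 z - s.
  by rewrite -(@pmulr_lgt0 _ (w - 0)) -?zE; [move: G00 Gw; rewrite /G; lra|lra].
have y0 : f1 y - s <= 0.
  by rewrite -(@pmulr_lle0 _ (um - w)) -?yE; [move: Gum Gw; rewrite /G; lra|lra].
by lra.
Qed.

(** The sign at [k] bounds [s] by the slope of the chord from [k] to [um], which is within
    O([|um - a|]) of the tangent slope [f1 k]. Left of [k] the flux is strongly concave, so the
    defect is at most a linear term minus a square. *)
Lemma defect_le_beyond m L h k a s C um w : 0 < m -> 0 < h -> 0 <= L -> k < 0 ->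
  relf f f1 a k = 0 -> m / 2 <= um -> f um - C - s * um = 0 -> f k - C - s * k <= 0 ->
  `|f um - f a| <= L * `|um - a| -> `|f1 k| <= L -> w <= k ->
  (forall z, w <= z <= k -> f2 z <= - h) ->
  f w - C - s * w <= (4 * L / m * `|um - a|) ^+ 2 / (4 * (h / 2)).
Proof.
move=> m0 h0 L0 k0 rk mum Gum Gk fL kL wk hP.
have sk : s - f1 k <= 4 * L / m * `|um - a|.
  have kum : 0 < um - k by lra.
  have : (s - f1 k) * (um - k) <= 2 * L * `|um - a|.
    have -> : (s - f1 k) * (um - k) =
        s * (um - k) - f1 k * (um - a) - (f a - f k) + relf f f1 a k.
      by rewrite /relf; ring.
    have : - (f1 k * (um - a)) <= L * `|um - a|.
      by rewrite -mulrN; apply: (le_trans (ler_norm _)); rewrite normrM normrN ler_wpM2r.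
    have := le_trans (ler_norm _) fL; rewrite rk; lra.
  move=> H; have Lu : 0 <= 2 * L * `|um - a| by rewrite !mulr_ge0.
  rewrite -(ler_pM2r kum); apply: (le_trans H).
  have -> : 4 * L / m * `|um - a| = 2 * L * `|um - a| * (2 / m) by field; rewrite gt_eqF.
  rewrite -(mulrA (2 * L * _)) ler_peMr// mulrAC ler_pdivlMr// mul1r; lra.
have D z : is_derive z (1 : R) (fun z => f z - f1 k * z + h / 2 * ((k - z) * (k - z)))
    (f1 z - f1 k - h * (k - z)) by derive_eq; field.
have fw : f w <= f k + f1 k * (w - k) - h / 2 * (k - w) ^+ 2.
  have := derive_ge0_le wk (fun z _ => D z) => /(_ _)/wrap[z zP|].
    have zk : z <= k by lra.
    have := @mean_value_le _ _ _ _ _ (- h) zk (fun x _ => df1 x) => /(_ _)/wrap[x xP|].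
      by apply: hP; lra.
    by lra.
  by rewrite subrr mul0r mulr0 addr0 expr2; lra.
have h20 : 0 < h / 2 by lra.
apply: le_trans (quadratic_upper _ (k - w) h20).
have := @ler_wpM2r _ (k - w) _ _ _ sk => /(_ _)/wrap[|]; first lra.
by lra.
Qed.

(** One endpoint of the chord is moved from [a] to [um]; the distance [d] from [a] to [up] controls
    the division. *)
Lemma shock_slope_close M L d s um up a : (forall x, - M <= x <= M -> `|f1 x| <= L) ->
  - M <= um <= M -> - M <= a <= M -> - M <= up <= M -> 0 < d -> um != up ->
  d <= `|a - up| -> s * (up - um) = f up - f um ->
  `|s - chord f a up| <= 2 * L / d * `|um - a|.
Proof.
move=> LP umM aM upM d0 umup daup RH.
have aup : up - a != 0 by apply: contraTneq daup; rewrite distrC => ->; rewrite normr0 -ltNge.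
have E : (s - chord f a up) * (a - up) = s * (a - um) + (f um - f a).
  have : chord f a up * (up - a) = f up - f a by rewrite /chord divfK.
  by lra.
have [z [zP sz]] := rankine_hugoniot_mean umup RH.
have sL : `|s| <= L by rewrite sz; apply: LP; lra.
rewrite mulrAC ler_pdivlMr//.
apply: (@le_trans _ _ (`|s - chord f a up| * `|a - up|)); first exact: ler_wpM2l.
rewrite -normrM E; apply: (le_trans (ler_normD _ _)).
have fL := derive_bounded_lipschitz df LP umM aM.
rewrite normrM (distrC a um).
by have := ler_wpM2r (normr_ge0 (um - a)) sL; lra.
Qed.

(** The defect is [a - w] times a difference of chord slopes, at least quadratic in [up - w], plus a
    slope error of size [S] times [up - w]. Completing the square leaves a multiple of [S ^+ 2]. *)
Lemma defect_ge_left a c d w up s C S : 0 < c -> 0 < d -> d <= a - w -> w <= up ->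
  up < a -> c * (up - w) ^+ 2 <= chord f a up - chord f a w ->
  `|s - chord f a up| <= S -> f up - C - s * up = 0 ->
  - (S ^+ 2 / (4 * (d * c))) <= f w - C - s * w.
Proof.
move=> c0 d0 daw wup upa cP sS Gup.
have wa : w - a != 0 by rewrite subr_eq0 lt_eqF//; lra.
have upa' : up - a != 0 by rewrite subr_eq0 lt_eqF.
have Gw : f w - C - s * w =
    (a - w) * (chord f a up - chord f a w) + (s - chord f a up) * (up - w).
  have : f w - f a = chord f a w * (w - a) by rewrite /chord divfK.
  have : f up - f a = chord f a up * (up - a) by rewrite /chord divfK.
  by lra.
have dc0 : 0 < d * c by apply: mulr_gt0.
have S' : d * c * (up - w) ^+ 2 <= (a - w) * (chord f a up - chord f a w).
  rewrite -mulrA; apply: ler_pM => //; first exact: ltW.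
  by rewrite mulr_ge0 ?sqr_ge0// ltW.
have T : - ((s - chord f a up) * (up - w)) <= S * (up - w).
  rewrite -mulNr; apply: ler_wpM2r; first by rewrite subr_ge0.
  by apply: le_trans sS; rewrite -normrN ler_norm.
have := quadratic_upper S (up - w) dc0.
by rewrite Gw; lra.
Qed.

Lemma defect_le_right a c d w up s C S : 0 < c -> 0 < d -> d <= a - w -> up <= w ->
  c * (w - up) ^+ 2 <= chord f a w - chord f a up ->
  `|s - chord f a up| <= S -> f up - C - s * up = 0 ->
  f w - C - s * w <= S ^+ 2 / (4 * (d * c)).
Proof.
move=> c0 d0 daw wup cP sS Gup.
have wa : w - a != 0 by rewrite subr_eq0 lt_eqF//; lra.
have upa' : up - a != 0 by rewrite subr_eq0 lt_eqF//; lra.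
have Gw : f w - C - s * w =
    - ((a - w) * (chord f a w - chord f a up)) + (chord f a up - s) * (w - up).
  have : f w - f a = chord f a w * (w - a) by rewrite /chord divfK.
  have : f up - f a = chord f a up * (up - a) by rewrite /chord divfK.
  by lra.
have dc0 : 0 < d * c by apply: mulr_gt0.
have S' : d * c * (w - up) ^+ 2 <= (a - w) * (chord f a w - chord f a up).
  rewrite -mulrA; apply: ler_pM => //; first exact: ltW.
  by rewrite mulr_ge0 ?sqr_ge0// ltW.
have T : (chord f a up - s) * (w - up) <= S * (w - up).
  apply: ler_wpM2r; first by rewrite subr_ge0.
  by apply: le_trans sS; rewrite distrC ler_norm.
have := quadratic_upper S (w - up) dc0.
by rewrite Gw; lra.
Qed.

Lemma common_quadratic_bound x1 y1 x2 y2 : 0 < y1 -> 0 < y2 ->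
  exists Z : R, 0 <= Z /\ forall r : R,
    (x1 * r) ^+ 2 / y1 <= Z * r ^+ 2 /\ (x2 * r) ^+ 2 / y2 <= Z * r ^+ 2.
Proof.
move=> y10 y20.
have p1 : 0 <= x1 ^+ 2 / y1 by rewrite divr_ge0 ?sqr_ge0 ?ltW.
have p2 : 0 <= x2 ^+ 2 / y2 by rewrite divr_ge0 ?sqr_ge0 ?ltW.
exists (x1 ^+ 2 / y1 + x2 ^+ 2 / y2); split => [|r]; first exact: addr_ge0.
rewrite !exprMn mulrDl ![_ / _ * r ^+ 2]mulrAC.
by split; [rewrite lerDl|rewrite lerDr]; rewrite mulrAC mulr_ge0 ?sqr_ge0.
Qed.

(** By [relQ_ge_defect] it is enough to bound by O([|um - a| ^+ 2]) the defect of the shock line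
    between [b] and [up]. The growth of chord slopes does it when [k <= up]; when [up < k], the
    Kruzkov inequality locates [k] under the shock line and is exploited on both sides of [k]. *)
Lemma shock_right_estimate m M d : 0 < m -> m <= M -> 0 < d -> d <= m ->
  exists C9 : R, 0 <= C9 /\ forall q, entropy_flux_for q ->
  forall a k b s um up, m <= a <= M -> k < 0 -> relf f f1 a k = 0 ->
  k <= b -> - M <= b -> b <= a - m ->
  - M <= um <= M -> `|um - a| <= m / 2 -> - M <= up <= a - d -> up < um ->
  s * (up - um) = f up - f um ->
  (up < k -> f k - (f um - s * um) - s * k <= 0) ->
  - (C9 * `|um - a| ^+ 2) <= relQ q s b up.
Proof.
move=> m0 mM d0 dm.
have [c [c0 cP]] := chord_quantitative df df1 cf2 f2_pos f2_neg f1_ninfty m0 mM d0.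
have [km [km0 rkm]] := tangent_exists df df1 f2_pos f2_neg f1_ninfty m0.
have cf1 : continuous f1 by move=> x; exact: is_derive_continuous (df1 x).
have [L [L0 LP]] := continuous_bounded M cf1.
have [E2 [E20 E2P]] := continuous_bounded M ce2.
have [h [h0 hP]] : exists h : R, 0 < h /\ forall x : R, - M <= x <= km -> h <= - f2 x.
  apply: continuous_pos_lower_bound => [x|x xP].
    by apply: continuousN; exact: cf2.
  by have := f2_neg (x := x); lra.
have y10 : 0 < 4 * (d * c) by rewrite !mulr_gt0.
have y20 : 0 < 4 * (h / 2) by lra.
have [Z [Z0 ZP]] := common_quadratic_bound (2 * L / d) (4 * L / m) y10 y20.
have M0 : 0 < M by exact: lt_le_trans mM.
exists (E2 * Z * (2 * M)); split.
  by apply: mulr_ge0; [apply: mulr_ge0 => //; exact: ltW|lra].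
move=> q dq a k b s um up aM k0 rk kb Mb ba umM uma upP upum RH kruz.
have [Z1 Z2] := ZP `|um - a|; clear y10 y20 ZP.
set rho := `|um - a| in Z1 Z2 *.
have -> : E2 * Z * (2 * M) * rho ^+ 2 = E2 * (Z * rho ^+ 2) * (2 * M) by ring.
have g0 : 0 <= Z * rho ^+ 2 by rewrite mulr_ge0 ?sqr_ge0.
delay Z1; delay Z2; delay g0; delay rkm; delay uma.
have /andP[ma aM2] := aM; have /andP[Mup upad] := upP.
have a0 : 0 < a by exact: lt_le_trans ma.
pose C := f um - s * um.
have Gum : f um - C - s * um = 0 by rewrite /C; ring.
have Gup : f up - C - s * up = 0 by rewrite /C; lra.
have {}kruz : up < k -> f k - C - s * k <= 0 := kruz.
clearbody C; delay Gum; delay Gup.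
have upM : - M <= up <= M by rewrite Mup/=; apply: le_trans upad _; lra.
have bM : - M <= b <= M by rewrite Mb/=; apply: le_trans ba _; lra.
have aM' : - M <= a <= M by rewrite aM2 andbT; lra.
have e2M x : - M <= x <= M -> 0 <= e2 x <= E2.
  by move=> xM; rewrite (ltW (e2_pos x)) (le_trans (ler_norm _) (E2P x xM)).
have upa : up < a by lra.
have dup : d <= `|a - up| by rewrite ger0_norm; lra.
have close := shock_slope_close LP umM aM' upM d0 (negbT (gt_eqF upum)) dup RH.
have [cP1 _] := cP a k aM k0 rk.
delay RH; delay close; delay rk.
apply: (relQ_ge_defect df de de1 dq (reveal g0) bM upM e2M (reveal Gup)) => w /andP[wP1 wP2].
  have daw : d <= a - w by lra.
  rewrite lerNl; apply: le_trans (reveal Z1); rewrite -lerNl.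
  apply: (defect_ge_left c0 d0 daw wP2 upa _ (reveal close) (reveal Gup)).
  by apply: cP1 => //; [exact: le_trans wP1|exact: le_trans wP1].
have [kup|upk] := leP k up.
  have daw : d <= a - w by lra.
  apply: le_trans (reveal Z1).
  apply: (defect_le_right c0 d0 daw wP1 _ (reveal close) (reveal Gup)).
  by apply: cP1 => //; lra.
have Gk := Delay (kruz upk).
have um3 : a - m / 2 <= um by move: (reveal uma); rewrite ler_distl => /andP[].
have um2 : m / 2 <= um by lra.
have um0 : 0 < um by lra.
have [kw|wk] := leP k w.
  apply: le_trans (reveal g0).
  apply: (defect_le0_beyond k0 upk um0 (reveal Gum) (reveal Gup) (reveal Gk)).
  by rewrite kw/=; lra.
have kkm : k <= km.
  by apply: (tangent_nincr df df1 f2_pos f2_neg m0 _ km0 (reveal rkm) k0 (reveal rk)).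
have kM : - M <= k <= M by lra.
apply: le_trans (reveal Z2).
have fL := derive_bounded_lipschitz df LP umM aM'.
apply: (defect_le_beyond m0 h0 (ltW L0) k0 (reveal rk) um2 (reveal Gum) (reveal Gk) fL (LP k kM)).
  exact: ltW.
move=> z /andP[wz zk]; rewrite -lerN2 opprK; apply: hP.
by rewrite (le_trans Mup (le_trans wP1 wz)) (le_trans zk).
Qed.

End ShockEstimates.

(** * The velocity field as a function of the state *)

Section Velocity.
Context {R : realType}.
Implicit Types (L c r v x y : R).

(** Equal to [c] within [r] of [v], to [- (L + 1)] beyond [2 * r], affine in [|x - v|] in between.
    With [L] a bound of [|f1|] on the state space, [- (L + 1)] lies below all characteristic
    speeds. *)
Definition velocity L c r v x : R :=
  Num.max (- (L + 1)) (Num.min c (c - (c + L + 1) / r * (`|x - v| - r))).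

Lemma velocity_bounds L c r v x : - (L + 1) <= c ->
  - (L + 1) <= velocity L c r v x <= c.
Proof. by move=> Lc; rewrite /velocity le_max lexx ge_max Lc ge_min lexx. Qed.

Lemma velocity_near L c r v x : 0 < r -> - (L + 1) <= c -> `|x - v| <= r ->
  velocity L c r v x = c.
Proof.
move=> r0 Lc xr; rewrite /velocity min_l; first by rewrite max_r.
rewrite lerBrDr gerDl; apply: mulr_ge0_le0; last by rewrite subr_le0.
by apply: divr_ge0; lra.
Qed.

Lemma velocity_far L c r v x : 0 < r -> - (L + 1) <= c -> 2 * r <= `|x - v| ->
  velocity L c r v x = - (L + 1).
Proof.
move=> r0 Lc xr; rewrite /velocity max_l// ge_min; apply/orP; right.
have -> : - (L + 1) = c - (c + L + 1) / r * r by rewrite divfK ?gt_eqF//; ring.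
rewrite lerD2l lerN2; apply: ler_wpM2l; last lra.
by apply: divr_ge0; lra.
Qed.

Lemma maxr_lipschitz c x y : `|Num.max c x - Num.max c y| <= `|x - y|.
Proof.
wlog xy : x y / x <= y.
  by move=> H; have [xy|/ltW yx] := leP x y; [exact: H|rewrite distrC (distrC x); exact: H].
rewrite distrC (distrC x) !ger0_norm ?subr_ge0//; last by rewrite ge_max !le_max lexx xy orbT.
by have [cx|xc] := leP c x; have [cy|yc] := leP c y; lra.
Qed.

Lemma minr_lipschitz c x y : `|Num.min c x - Num.min c y| <= `|x - y|.
Proof.
rewrite -(opprK (Num.min c x)) -(opprK (Num.min c y)) !oppr_min -opprD normrN.
by apply: le_trans (maxr_lipschitz _ _ _) _; rewrite -opprD normrN.
Qed.

Lemma velocity_lipschitz L c r v x y : 0 < r -> - (L + 1) <= c ->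
  `|velocity L c r v x - velocity L c r v y| <= (c + L + 1) / r * `|x - y|.
Proof.
move=> r0 Lc; apply: (le_trans (maxr_lipschitz _ _ _)).
apply: (le_trans (minr_lipschitz _ _ _)).
have k0 : 0 <= (c + L + 1) / r by apply: divr_ge0; lra.
set k := _ / r in k0 *.
have -> : c - k * (`|x - v| - r) - (c - k * (`|y - v| - r)) = k * (`|y - v| - `|x - v|) by ring.
rewrite normrM ger0_norm//; apply: ler_wpM2l => //.
by apply: (le_trans (ler_dist_dist _ _)); rewrite opprB addrA subrK distrC.
Qed.

End Velocity.

(** * Left flux across shocks, and points without a jump *)

Section PointwiseContraction.
Context {R : realType} (f f1 f2 eta e1 e2 : R -> R).
Context (df : forall x : R, is_derive x (1 : R) f (f1 x)).
Context (df1 : forall x : R, is_derive x (1 : R) f1 (f2 x)).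
Context (cf2 : continuous f2).
Context (f2_pos : forall x : R, 0 < x -> 0 < f2 x).
Context (f2_neg : forall x : R, x < 0 -> f2 x < 0).
Context (f1_ninfty : forall A : R, exists x : R, x < 0 /\ A < f1 x).
Context (de : forall x : R, is_derive x (1 : R) eta (e1 x)).
Context (de1 : forall x : R, is_derive x (1 : R) e1 (e2 x)).
Context (ce2 : continuous e2).
Context (e2_pos : forall x : R, 0 < e2 x).
Implicit Types (q : R -> R) (a b c d k m r v w x y z s um up uL uR B C D L E M : R).

Local Notation "'entropy_flux_for' q" :=
  (forall x : R, is_derive x (1 : R) q (e1 x * f1 x)) (at level 10).
Local Notation relQ := (relQ f eta e1).

(** By an exact identity, the relative flux at [um] is the entropy balance of the shock plus terms
    comparing [up] with [a], which are of order [|up - a|]. *)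
Lemma relQ_shift q s a um up E L rho :
  q up - q um - s * (eta up - eta um) <= 0 -> s * (up - um) = f up - f um ->
  0 <= E -> `|s| <= L -> `|e1 a| <= E -> `|up - a| <= rho ->
  `|eta up - eta a| <= E * rho -> `|q up - q a| <= E * L * rho ->
  `|f up - f a| <= L * rho -> relQ q s a um <= 4 * E * L * rho.
Proof.
move=> ent RH E0 sL eE uar etaL qL fL.
have r0 : 0 <= rho by exact: le_trans uar.
have L0 : 0 <= L by exact: le_trans sL.
have -> : relQ q s a um = (q up - q um - s * (eta up - eta um)) + s * (eta up - eta a)
    - (q up - q a) - e1 a * (s * (up - a) - (f up - f a)).
  have -> : s * (up - a) = (f up - f um) + s * (um - a) by rewrite -RH; ring.
  by rewrite /relQ /releta; ring.
have t1 : s * (eta up - eta a) <= L * (E * rho).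
  by apply: (le_trans (ler_norm _)); rewrite normrM; apply: ler_pM.
have t2 : - (q up - q a) <= E * L * rho.
  by apply: (le_trans (ler_norm _)); rewrite normrN.
have t3 : - (e1 a * (s * (up - a) - (f up - f a))) <= E * (L * rho + L * rho).
  apply: (le_trans (ler_norm _)); rewrite normrN normrM; apply: ler_pM => //.
  by apply: (le_trans (ler_normB _ _)); rewrite lerD// normrM ler_pM.
by lra.
Qed.

(** [relQ q s a um] is within O([|up - a|]) of the dissipation from [a] to [um], since [s] is close
    to the slope of that chord. Of the two cases of the dichotomy, the positive one contradicts the
    entropy inequality, which bounds [relQ] above by O([|up - a|]). *)
Lemma shock_left_estimate m M d : 0 < m -> m <= M -> m <= 1 -> 0 < d ->
  exists c r : R, [/\ 0 < c, 0 < r & forall q, entropy_flux_for q ->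
  forall a s um up, m <= a <= M -> - M <= um <= M -> - M <= up <= M -> um != up ->
  d <= `|um - a| -> `|up - a| <= r -> m <= `|um - phi_flat0 f eta q a| ->
  s * (up - um) = f up - f um -> q up - q um - s * (eta up - eta um) <= 0 ->
  relQ q s a um <= - c].
Proof.
move=> m0 mM m1 d0.
have [c [c0 cP]] := dissip_dichotomy df df1 cf2 f2_pos f2_neg f1_ninfty de de1 ce2 e2_pos m0 mM m1 d0.
have cf1 : continuous f1 by move=> x; exact: is_derive_continuous (df1 x).
have ce1 : continuous e1 by move=> x; exact: is_derive_continuous (de1 x).
have [L [L0 LP]] := continuous_bounded M cf1.
have [E [E0 EP]] := continuous_bounded M ce1.
have M0 : 0 < M by exact: lt_le_trans mM.
pose K := 4 * E * L + 2 * L / d * (4 * E * M).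
have K0 : 0 < K.
  apply: addr_gt0; first by rewrite !mulr_gt0.
  by apply: mulr_gt0; [apply: divr_gt0 => //; lra|rewrite !mulr_gt0].
(* [K] adds the factors of both errors, so each of them is at most [c / 4] when
   [|up - a| <= c / (4 * K)]. *)
exists (c / 2), (c / (4 * K)); split; [lra|by rewrite divr_gt0//; lra|].
move=> q dq a s um up aM umM upM umup duma upr umphi RH ent.
have aM' : - M <= a <= M by lra.
have upr' : K * `|up - a| <= c / 4.
  move: upr; rewrite ler_pdivlMr; last lra.
  lra.
set rho := `|up - a| in upr upr'.
have rho0 : 0 <= rho by exact: normr_ge0.
have [z [zP sz]] := rankine_hugoniot_mean df umup RH.
have sL : `|s| <= L by rewrite sz; apply: LP; lra.
have qLP x : - M <= x <= M -> `|e1 x * f1 x| <= E * L.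
  by move=> xM; rewrite normrM; apply: ler_pM => //; [exact: EP|exact: LP].
have umaE : um != a by apply: contraTneq duma => ->; rewrite subrr normr0 -ltNge.
have T1 : relQ q s a um <= 4 * E * L * rho.
  apply: (relQ_shift ent RH (ltW E0) sL (EP a aM') (lexx _)).
  - exact: derive_bounded_lipschitz de EP _ _ upM aM'.
  - exact: derive_bounded_lipschitz dq qLP _ _ upM aM'.
  - exact: derive_bounded_lipschitz df LP _ _ upM aM'.
(* The shock is read from [up] to [um], as [up] is the end close to [a]. *)
have RH' : s * (um - up) = f um - f up by lra.
have daum : d <= `|a - um| by rewrite distrC.
have ss := shock_slope_close df LP upM aM' umM d0 _ daum RH'.
have := ss; rewrite eq_sym => /(_ umup) {}ss; rewrite -/rho in ss.
have T2 : `|relQ q s a um - dissip f eta q a um| <= 2 * L / d * (4 * E * M) * rho.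
  rewrite (@dissip_relQ _ f eta e1)//; set sig := chord f a um.
  have -> : s = sig + (s - sig) by ring.
  rewrite relQD addrAC subrr add0r normrM mulrAC.
  apply: ler_pM => //.
  have := derive_bounded_lipschitz de EP umM aM' => eL.
  have uaM : `|um - a| <= 2 * M by rewrite ler_norml; lra.
  apply: (le_trans (ler_normB _ _)); rewrite normrM.
  have h1 : `|e1 a| * `|um - a| <= E * (2 * M) by apply: ler_pM => //; exact: EP.
  have h2 : E * `|um - a| <= E * (2 * M) by rewrite ler_pM2l.
  by lra.
have b1 : 4 * E * L * rho <= c / 4.
  apply: le_trans upr'; apply: ler_wpM2r => //; rewrite lerDl.
  by rewrite !mulr_ge0 ?invr_ge0 ?ltW.
have b2 : 2 * L / d * (4 * E * M) * rho <= c / 4.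
  apply: le_trans upr'; apply: ler_wpM2r => //; rewrite lerDr.
  by rewrite !mulr_ge0 ?ltW.
move: T2; rewrite ler_norml => /andP[T2 T3].
by have [X|X] := cP q dq a um aM umM duma umphi; lra.
Qed.

(** Common ending of all cases: [al] is the gain on the left, [be] the possible loss on the
    right. *)
Lemma weighted_difference_le0 (A al be a1 a2 T1 T2 : R) : 0 < a1 -> 0 < a2 ->
  a2 / a1 <= A -> 0 <= be -> A * be <= al -> T1 <= - al -> - be <= T2 ->
  a1 * T1 - a2 * T2 <= 0.
Proof.
move=> a10 a20; rewrite ler_pdivrMr// => aA be0 Abe T1al T2be.
have h1 : a1 * T1 <= a1 * - al by rewrite ler_pM2l.
have h2 : a2 * - be <= a2 * T2 by rewrite ler_pM2l.
have h3 : a2 * be <= A * a1 * be by apply: ler_wpM2r.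
have h4 : a1 * (A * be) <= a1 * al by rewrite ler_pM2l.
by lra.
Qed.

(** Given the Rankine-Hugoniot relation, the Kruzkov inequality for a level [k] between the two
    states is twice this conclusion: at [k], the graph of [f] is not above the shock line. *)
Lemma defect_kruzkov k s um up : up < k -> k < um -> s * (up - um) = f up - f um ->
  kruzkov_flux f k up - kruzkov_flux f k um
    - s * (kruzkov_entropy k up - kruzkov_entropy k um) <= 0 ->
  f k - (f um - s * um) - s * k <= 0.
Proof.
move=> upk kum RH; rewrite /kruzkov_flux /kruzkov_entropy.
rewrite ltr0_sg ?subr_lt0// gtr0_sg ?subr_gt0//.
by rewrite ltr0_norm ?subr_lt0// gtr0_norm ?subr_gt0//; lra.
Qed.

Lemma ler_dist_lipschitz_itv M L a r w : (forall x, - M <= x <= M -> `|f2 x| <= L) ->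
  0 <= L -> - M <= a <= M -> - M <= w <= M -> `|w - a| <= r -> f1 a - L * r <= f1 w.
Proof.
move=> LP L0 aM wM war; have := derive_bounded_lipschitz df1 LP wM aM.
rewrite ler_distl => /andP[+ _]; apply: le_trans.
by rewrite lerD2l lerN2; apply: ler_wpM2l.
Qed.

(** The speed is [f1 z] for some [z] between the states, and [f1] needs a distance [de' / L] to drop
    by [de']; one of the two states is at least as far from [a] as [z]. *)
Lemma slow_shock_far M L a s um up de' : (forall x, - M <= x <= M -> `|f2 x| <= L) ->
  0 < L -> - M <= a <= M -> - M <= um <= M -> - M <= up <= M -> um != up ->
  s * (up - um) = f up - f um -> s <= f1 a - de' ->
  de' / L <= `|um - a| \/ de' / L <= `|up - a|.
Proof.
move=> LP L0 aM umM upM umup RH sd.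
have [z [zP sz]] := rankine_hugoniot_mean df umup RH.
have zM : - M <= z <= M by lra.
have := derive_bounded_lipschitz df1 LP zM aM; rewrite ler_distl => /andP[H _].
have dz : de' / L <= `|z - a| by rewrite ler_pdivrMr// mulrC; lra.
have : `|z - a| <= `|um - a| \/ `|z - a| <= `|up - a|.
  have [za|az] := leP z a.
    rewrite ler0_norm ?subr_le0//; have := ler_norm (a - um); have := ler_norm (a - up).
    by rewrite !(distrC a) => ? ?; case: zP => ?; [left|right]; lra.
  rewrite gtr0_norm ?subr_gt0//; have := ler_norm (um - a); have := ler_norm (up - a).
  by move=> ? ?; case: zP => ?; [right|left]; lra.
by case=> ?; [left|right]; lra.
Qed.

Lemma relQ_near_left q M L kap de' a s u r : entropy_flux_for q ->
  (forall x, - M <= x <= M -> `|f2 x| <= L) -> 0 <= L ->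
  (forall x, - M <= x <= M -> kap <= e2 x) -> 0 <= de' -> L * r <= de' / 2 ->
  - M <= a <= M -> - M <= u <= M -> `|u - a| <= r -> s <= f1 a - de' ->
  relQ q s a u <= - (de' / 2 * (kap / 2 * (u - a) ^+ 2)).
Proof.
move=> dq LP L0 kapP d0 Lr aM uM uar sa.
apply: (relQ_le_sqr df de de1 dq e2_pos _ kapP aM uM); first lra.
move=> w wP; have wM : - M <= w <= M by case: wP; lra.
have war : `|w - a| <= r.
  apply: le_trans uar; case: wP => wP; first by rewrite !ger0_norm; lra.
  by rewrite !ler0_norm; lra.
by have := ler_dist_lipschitz_itv LP L0 aM wM war; lra.
Qed.

(** Half of [c] pays for moving the state from [a] to [u], the other half for lowering the speed by
    [de']. *)
Lemma relQ_near_right q M L E c a b u r de' : entropy_flux_for q ->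
  (forall x, - M <= x <= M -> `|e1 x| <= E) -> (forall x, - M <= x <= M -> `|f1 x| <= L) ->
  - M <= a <= M -> - M <= b <= M -> - M <= u <= M -> `|u - a| <= r -> 0 <= de' ->
  c <= relQ q (f1 a) b a -> 2 * E * (2 * L + 1) * r <= c / 2 -> de' * (4 * E * M) <= c / 2 ->
  0 <= relQ q (f1 a - de') b u.
Proof.
move=> dq EP LP aM bM uM uar d0 cQ cr cd.
have E0 : 0 <= E by apply: le_trans (EP a aM).
have L0 : 0 <= L by apply: le_trans (LP a aM).
have fa : `|f1 a| <= L + 1 by have := LP a aM; lra.
have := relQ_lipschitz df de dq bM uM aM EP LP fa; rewrite ler_distl => /andP[H _].
have H2 : 2 * E * (2 * L + 1) * `|u - a| <= 2 * E * (2 * L + 1) * r.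
  by apply: ler_wpM2l => //; rewrite !mulr_ge0//; lra.
rewrite relQD mulNr subr_ge0.
have rb : releta eta e1 b u <= 4 * E * M.
  have := derive_bounded_lipschitz de EP uM bM => eL.
  have ubM : `|u - b| <= 2 * M by rewrite ler_norml; lra.
  have h1 : `|e1 b * (u - b)| <= E * (2 * M) by rewrite normrM; apply: ler_pM => //; exact: EP.
  have h2 : E * `|u - b| <= E * (2 * M) by apply: ler_wpM2l.
  have := le_trans (ler_norm _) eL; have := ler_norm (- (e1 b * (u - b))).
  by rewrite /releta normrN; lra.
have := ler_wpM2l d0 rb; lra.
Qed.

(** Within [r] of [a] both fluxes have the right sign. Farther away the right one is merely bounded,
    but the left one is at most [- (de' / 2 * (kap / 2 * r ^+ 2))], and the bound on [A] compares
    the two. *)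
Lemma no_jump_contraction q M L L2 E kap c r de' A a b a1 a2 u : entropy_flux_for q ->
  (forall x, - M <= x <= M -> `|e1 x| <= E) -> (forall x, - M <= x <= M -> `|f1 x| <= L) ->
  (forall x, - M <= x <= M -> `|f2 x| <= L2) -> (forall x, - M <= x <= M -> kap <= e2 x) ->
  0 <= L2 -> 0 < kap -> 0 < r -> 0 <= de' -> de' <= 1 -> L2 * (2 * r) <= de' / 2 ->
  - M <= a <= M -> - M <= b <= M -> - M <= u <= M ->
  c <= relQ q (f1 a) b a -> 2 * E * (2 * L + 1) * r <= c / 2 -> de' * (4 * E * M) <= c / 2 ->
  A * (2 * E * (2 * L + 1) * (2 * M)) <= de' / 2 * (kap / 2 * r ^+ 2) ->
  0 < a1 -> 0 < a2 -> a2 / a1 <= A ->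
  forall s, s = velocity L (f1 a - de') r a u -> a1 * relQ q s a u - a2 * relQ q s b u <= 0.
Proof.
move=> dq EP LP L2P kapP L20 kap0 r0 d0 d1 L2r aM bM uM cQ cr cd AQ a10 a20 aA.
have fa := LP a aM.
delay L2r; delay cQ; delay cr; delay cd; delay AQ; delay aA.
have Lc : - (L + 1) <= f1 a - de' by move: fa; rewrite ler_norml; lra.
move=> s sV; have /andP[sL sc] : - (L + 1) <= s <= f1 a - de'.
  by rewrite sV; exact: velocity_bounds.
have sL1 : `|s| <= L + 1 by move: fa; rewrite !ler_norml; lra.
have [ur|ru] := leP `|u - a| r.
  have sE : s = f1 a - de' by rewrite sV velocity_near.
  apply: (weighted_difference_le0 a10 a20 (reveal aA) (lexx 0) (al := 0)); rewrite ?mulr0// ?oppr0.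
    have u2r : `|u - a| <= 2 * r by lra.
    apply: le_trans (relQ_near_left dq L2P L20 kapP d0 (reveal L2r) aM uM u2r sc) _.
    rewrite oppr_le0 mulr_ge0//; first lra.
    by rewrite mulr_ge0 ?sqr_ge0//; lra.
  by rewrite sE; exact: (relQ_near_right dq EP LP aM bM uM ur d0 (reveal cQ) (reveal cr) (reveal cd)).
have E0 : 0 <= E by apply: le_trans (EP a aM).
have L0 : 0 <= L by apply: le_trans fa.
apply: (weighted_difference_le0 a10 a20 (reveal aA) _ (reveal AQ)).
- by rewrite !mulr_ge0//; lra.
- have sqr : r ^+ 2 <= (u - a) ^+ 2 by rewrite -[(u - a) ^+ 2]real_normK ?num_real// ler_sqr ?nnegrE//; lra.
  have k0 : 0 <= kap / 2 * r ^+ 2 by rewrite mulr_ge0 ?sqr_ge0//; lra.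
  have ksqr : kap / 2 * r ^+ 2 <= kap / 2 * (u - a) ^+ 2 by apply: ler_wpM2l => //; lra.
  have [u2r|ru2] := leP `|u - a| (2 * r).
    apply: le_trans (relQ_near_left dq L2P L20 kapP d0 (reveal L2r) aM uM u2r sc) _.
    by rewrite lerN2; apply: ler_wpM2l => //; lra.
  have sE : s = - (L + 1) by rewrite sV velocity_far// ltW.
  apply: (@le_trans _ _ (- (1 * (kap / 2 * (u - a) ^+ 2)))).
    apply: (relQ_le_sqr df de de1 dq e2_pos ler01 kapP aM uM) => w wP.
    have /LP : - M <= w <= M by case: wP; lra.
    by rewrite sE ler_norml; lra.
  by rewrite lerN2; apply: ler_pM => //; lra.
- have := relQ_bounded df de dq bM uM EP LP sL1.
  by rewrite ler_norml => /andP[].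
Qed.

End PointwiseContraction.

(** * Order of the choices of constants *)

Section Constants.
Context {R : realType}.
Implicit Types (m c d r A C E L M kap : R).

(** [de'] is the slowing down below [f1 uL], small against the speed gap [c]. With [L] a bound of
    [|f2|], [d <= de' / L] is a distance that one side of so slow a shock must keep from [uL]. *)
Lemma contraction_constants1 m c E M L : 0 < m -> 0 < c -> 0 < E -> 0 < M -> 0 < L ->
  exists de' d : R, [/\ 0 < de', de' <= 1, de' * (4 * E * M) <= c / 2 &
    [/\ 0 < d, d <= m / 2, d <= m & d <= de' / L]].
Proof.
move=> m0 c0 E0 M0 L0.
have EM0 : 0 < 8 * E * M by rewrite !mulr_gt0.
have [de' [d0 d1 dc]] := min_spec ltr01 (divr_gt0 c0 EM0).
have m20 : 0 < m / 2 by lra.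
have [d [dd0 dL dm2]] := min_spec (divr_gt0 d0 L0) m20.
exists de', d; split => //.
  by move: dc; rewrite ler_pdivlMr//; lra.
by split => //; lra.
Qed.

(** The ratio [A] is chosen after the radius [r], so that it can be compared with a gain of order
    [r ^+ 2]. Its three bounds serve, in this order, points without a jump, jumps with [u_+] near
    [uL], and jumps with [u_-] near [uL]. *)
Lemma contraction_constants2 c c' d de' kap r' C E L L' M :
  0 < c -> 0 < c' -> 0 < d -> 0 < de' -> 0 < kap -> 0 < r' -> 0 <= C -> 0 < E -> 0 < L ->
  0 < L' -> 0 < M -> d <= de' / L' ->
  exists r A : R, [/\ 0 < r, 0 < A, [/\ 2 * r < d, 2 * r <= r' & L' * (2 * r) <= de' / 2],
    2 * E * (2 * L + 1) * r <= c / 2 &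
    [/\ A * (2 * E * (2 * L + 1) * (2 * M)) <= de' / 2 * (kap / 2 * r ^+ 2),
       A * (2 * E * (2 * L + 1) * (2 * M)) <= c' & A * C <= de' / 2 * (kap / 2)]].
Proof.
move=> c0 c'0 d0 de'0 kap0 r'0 C0 E0 L0 L'0 M0 dL.
have cl0 : 0 < 2 * E * (2 * L + 1) by rewrite !mulr_gt0//; lra.
set K := 2 * E * (2 * L + 1) in cl0 *.
have K20 : 0 < 2 * K by lra.
have r'20 : 0 < r' / 2 by lra.
have d40 : 0 < d / 4 by lra.
have [x [x0 xc xr]] := min_spec (divr_gt0 c0 K20) r'20.
have [r [r0 rd rx]] := min_spec d40 x0.
have CQ0 : 0 < K * (2 * M) by rewrite mulr_gt0// mulr_gt0.
have c60 : 0 < de' / 2 * (kap / 2 * r ^+ 2).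
  by rewrite !mulr_gt0 ?exprn_gt0// invr_gt0.
have c70 : 0 < de' / 2 * (kap / 2) by rewrite !mulr_gt0// invr_gt0.
have C10 : 0 < C + 1 by lra.
have [A1 [A10 A1a A1b]] := min_spec (divr_gt0 c60 CQ0) (divr_gt0 c'0 CQ0).
have [A [A0 AA1 A7]] := min_spec A10 (divr_gt0 c70 C10).
exists r, A; split => //.
- split; [lra|lra|].
  move: dL; rewrite ler_pdivlMr// => dL.
  by have := ler_wpM2l (ltW L'0) rd; lra.
- by move: (le_trans rx xc); rewrite ler_pdivlMr//; lra.
split.
- by rewrite -ler_pdivlMr//; exact: le_trans A1a.
- by rewrite -ler_pdivlMr//; exact: le_trans A1b.
- by move: A7; rewrite ler_pdivlMr// mulrDr mulr1; lra.
Qed.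

End Constants.

(** * The contraction inequality at one time *)

Section Contraction.
Context {R : realType} (f f1 f2 eta e1 e2 : R -> R).
Context (df : forall x : R, is_derive x (1 : R) f (f1 x)).
Context (df1 : forall x : R, is_derive x (1 : R) f1 (f2 x)).
Context (cf2 : continuous f2).
Context (f2_pos : forall x : R, 0 < x -> 0 < f2 x).
Context (f2_neg : forall x : R, x < 0 -> f2 x < 0).
Context (f1_ninfty : forall A : R, exists x : R, x < 0 /\ A < f1 x).
Context (de : forall x : R, is_derive x (1 : R) eta (e1 x)).
Context (de1 : forall x : R, is_derive x (1 : R) e1 (e2 x)).
Context (ce2 : continuous e2).
Context (e2_pos : forall x : R, 0 < e2 x).
Implicit Types (q : R -> R) (a b c d k m r v w x y z s um up uL uR B C D L E M : R).

Local Notation "'entropy_flux_for' q" :=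
  (forall x : R, is_derive x (1 : R) q (e1 x * f1 x)) (at level 10).
Local Notation relQ := (relQ f eta e1).

Lemma rankine_hugoniot_speed_le M L s um up : (forall x, - M <= x <= M -> `|f1 x| <= L) ->
  - M <= um <= M -> - M <= up <= M -> um != up -> s * (up - um) = f up - f um -> `|s| <= L.
Proof.
move=> LP umM upM umup RH; have [z [zP ->]] := rankine_hugoniot_mean df umup RH.
by apply: LP; lra.
Qed.

Lemma lower_speed L a x : `|x| <= L -> a <= 1 -> - (L + 1) <= x - a.
Proof. by rewrite ler_norml; lra. Qed.

Lemma velocity_norm_le L a x y : `|x| <= L -> 0 <= a -> - (L + 1) <= y <= x - a ->
  `|y| <= L + 1.
Proof. by rewrite !ler_norml; lra. Qed.

(** Were [up > um], the speed would be [f1 z] with [z > um >= 0], hence above [f1 um], which is at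
    least [f1 a - de' / 2]. *)
Lemma slow_shock_left L d r a s um up de' : um != up -> s * (up - um) = f up - f um ->
  2 * r < d -> 2 * r <= a -> `|um - a| < 2 * r -> d <= `|um - a| \/ d <= `|up - a| ->
  0 < de' -> L * (2 * r) <= de' / 2 -> f1 a - L * (2 * r) <= f1 um -> s <= f1 a - de' ->
  [/\ up < um, up <= a - d & 0 <= um].
Proof.
move=> umup RH rd ra umr far d0 Lr fum sa.
have dup : d <= `|up - a| by case: far => //; lra.
move: umr; rewrite ltr_distl => umr.
have um0 : 0 <= um by lra.
have upum : up < um.
  rewrite ltNge; apply/negP => umup'.
  have [z [zP sz]] := rankine_hugoniot_mean df umup RH.
  have zum : um < z by case: zP; lra.
  by have := f1_increasing df1 f2_pos um0 zum; lra.
split => //.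
have [H|H] := leP a up; first by move: dup; rewrite ger0_norm ?subr_ge0//; lra.
by move: dup; rewrite ltr0_norm ?subr_lt0//; lra.
Qed.

(** The hypotheses on [um], [up] and [s] are what the trajectory provides at almost every time. All
    constants are fixed before [q] and the states, hence depend only on the system and on [m]. *)
Lemma pointwise_contraction m M : 0 < m -> m <= M -> m <= 1 ->
  exists A : R, 0 < A /\ forall q, entropy_flux_for q ->
  forall eps uL uR, m <= eps -> m <= uL <= M -> - M <= uR -> uR <= uL - m ->
  oleinik f uL uR -> exists (V : R -> R) (K B : R),
  [/\ forall x y, `|V x - V y| <= K * `|x - y|, forall x, `|V x| <= B &
    forall um up s, - M <= um <= M -> - M <= up <= M ->
    Num.min (V um) (V up) <= s <= Num.max (V um) (V up) ->
    s * (up - um) = f up - f um -> q up - q um - s * (eta up - eta um) <= 0 ->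
    (let k := phi_natural f uL in
     kruzkov_flux f k up - kruzkov_flux f k um
       - s * (kruzkov_entropy k up - kruzkov_entropy k um) <= 0) ->
    ~ (ball (phi_flat0 f eta q uL) eps um /\ ball uL eps up) ->
    forall a1 a2, 0 < a1 -> 0 < a2 -> a2 / a1 <= A ->
    a1 * relQ q s uL um - a2 * relQ q s uR up <= 0].
Proof.
move=> m0 mM m1; have M0 : 0 < M by exact: lt_le_trans mM.
have cf1 : continuous f1 by move=> x; exact: is_derive_continuous (df1 x).
have ce1 : continuous e1 by move=> x; exact: is_derive_continuous (de1 x).
have [L [L0 LP]] := continuous_bounded M cf1.
have [L2 [L20 L2P]] := continuous_bounded M cf2.
have [E [E0 EP]] := continuous_bounded M ce1.
have [kap [kap0 kapP]] := e2_lower_bound ce2 e2_pos M.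
have [c [c0 cP]] := speed_gap df df1 cf2 f2_pos f2_neg de de1 ce2 e2_pos m0 mM.
have [de' [d [d0 d1 cd [dd0 dm2 dm dL]]]] := contraction_constants1 m0 c0 E0 M0 L20.
have [c5 [r5 [c50 r50 shockL]]] := shock_left_estimate df df1 cf2 f2_pos f2_neg f1_ninfty
  de de1 ce2 e2_pos m0 mM m1 dd0.
have [C9 [C90 shockR]] := shock_right_estimate df df1 cf2 f2_pos f2_neg f1_ninfty
  de de1 ce2 e2_pos m0 mM dd0 dm.
have [r [A [r0 A0 [r2d r25 L2r] cr [A6 A5 A9]]]] :=
  contraction_constants2 c0 c50 dd0 d0 kap0 r50 C90 E0 L0 L20 M0 dL.
have E2L : 0 <= 2 * E * (2 * L + 1) * (2 * M).
  by rewrite !mulr_ge0 ?ltW// addr_gt0// mulr_gt0.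
delay A5; delay A6; delay A9; delay cr; delay cd; delay L2r; delay E2L; delay dL.
exists A; split=> // q dq eps uL uR meps uLM MuR uRm ol.
have /andP[muL uLM2] := uLM.
have uL0 : 0 < uL by exact: lt_le_trans muL.
have uLM' : - M <= uL <= M by rewrite uLM2 andbT (le_trans _ (ltW uL0))// oppr_le0 ltW.
have uRM : - M <= uR <= M.
  by rewrite MuR (le_trans uRm)// (le_trans _ uLM2)// gerDl oppr_le0 ltW.
have [k [k0 rk]] := tangent_exists df df1 f2_pos f2_neg f1_ninfty uL0.
have /andP[kuR uRuL] := oleinik_bounds df df1 f2_pos f2_neg uL0 k0 rk ol.
have kE := phi_naturalE df df1 f2_pos f2_neg uL0 k0 rk.
have cQ := cP q dq uL k uR uLM k0 rk kuR MuR uRm.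
have fa := LP uL uLM'.
have Lc : - (L + 1) <= f1 uL - de' by exact: lower_speed.
pose V := velocity L (f1 uL - de') r uL.
exists V, ((f1 uL - de' + L + 1) / r), (L + 1); split.
- by move=> x y; exact: velocity_lipschitz.
- by move=> x; apply: (velocity_norm_le fa (ltW d0) (velocity_bounds r uL x Lc)).
move=> um up s umM upM sV RH ent kru nball a1 a2 a10 a20 aA.
delay cQ; delay aA; delay ent; delay RH.
have [umup|umup] := eqVneq um up.
  have sE : s = V up.
    by apply/eqP; rewrite eq_le; move: sV; rewrite umup minxx maxxx andbC.
  rewrite umup; exact: (no_jump_contraction df df1 de de1 e2_pos dq EP LP L2P kapP (ltW L20) kap0 r0 (ltW d0) d1
    (reveal L2r) uLM' uRM upM (reveal cQ) (reveal cr) (reveal cd) (reveal A6) a10 a20 (reveal aA) sE).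
have sc : s <= f1 uL - de'.
  have /andP[_ s2] := sV; apply: (le_trans s2).
  have /andP[_ v1] := velocity_bounds r uL um Lc.
  have /andP[_ v2] := velocity_bounds r uL up Lc.
  by rewrite ge_max v1 v2.
have sL := rankine_hugoniot_speed_le LP umM upM umup (reveal RH).
have sL1 : `|s| <= L + 1 by rewrite (le_trans sL)// lerDl.
have far : d <= `|um - uL| \/ d <= `|up - uL|.
  have := slow_shock_far df df1 L2P L20 uLM' umM upM umup (reveal RH) sc.
  by case=> H; [left|right]; exact: le_trans (reveal dL) H.
have [umr|rum] := ltP `|um - uL| (2 * r).
  have umr' := ltW umr.
  have fum := ler_dist_lipschitz_itv df1 L2P (ltW L20) uLM' umM umr'.
  have mr : 2 * r <= m by exact: le_trans (ltW r2d) dm.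
  have [upum upd um0] := slow_shock_left umup (reveal RH) r2d
    (le_trans mr muL) umr far d0 (reveal L2r) fum sc.
  apply: (weighted_difference_le0 a10 a20 (reveal aA) (be := C9 * `|um - uL| ^+ 2)
    (al := de' / 2 * (kap / 2 * (um - uL) ^+ 2))).
  - by rewrite mulr_ge0 ?sqr_ge0.
  - rewrite real_normK ?num_real//.
    by move: (ler_wpM2r (sqr_ge0 (um - uL)) (reveal A9)); rewrite -!mulrA.
  - exact: (relQ_near_left df df1 de de1 e2_pos dq L2P (ltW L20) kapP (ltW d0) (reveal L2r) uLM' umM umr' sc).
  - have /andP[Mup _] := upM.
    apply: (shockR q dq uL k uR s um up uLM k0 rk kuR MuR uRm umM _ _ upum (reveal RH)).
    + by rewrite (le_trans umr')// (le_trans (ltW r2d)).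
    + by rewrite Mup.
    + move=> upk; have kum : k < um by exact: lt_le_trans um0.
      by apply: (defect_kruzkov upk kum (reveal RH)); move: kru; rewrite kE.
(* Otherwise [V] equals [- (L + 1)] at both states, a speed that no shock can have. *)
have upr : `|up - uL| < 2 * r.
  rewrite ltNge; apply/negP => rup.
  have := sV; rewrite /V !velocity_far// maxxx => /andP[_].
  move/(le_lt_trans)/(_ (_ : - (L + 1) < - L)); rewrite ltrN2 ltrDl ltr01 => /(_ isT).
  by rewrite ltNge; move: sL; rewrite ler_norml => /andP[->].
have dum : d <= `|um - uL|.
  by case: far => // /(lt_le_trans (lt_trans upr r2d)); rewrite ltxx.
have umphi : m <= `|um - phi_flat0 f eta q uL|.
  rewrite leNgt; apply/negP => H; apply: nball; split.
    by rewrite /ball/= distrC (lt_le_trans H).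
  by rewrite /ball/= distrC (lt_le_trans upr)// (le_trans (ltW r2d))// (le_trans dm).
apply: (weighted_difference_le0 a10 a20 (reveal aA) (reveal E2L) (reveal A5)).
  apply: (shockL q dq uL s um up uLM umM upM umup dum _ umphi (reveal RH) (reveal ent)).
  by apply/ltW/(lt_le_trans upr).
have := relQ_bounded df de dq uRM upM EP LP sL1.
by rewrite ler_norml => /andP[].
Qed.

End Contraction.

(** * Smooth test functions *)

Section FlatFunctions.
Context {R : realType}.
Implicit Types (k n : nat) (x y a b c : R).

(** Indexing by [k] makes the family closed under differentiation up to linear combinations, so that
    smoothness follows by induction on the order. *)
Definition flat k x : R := if 0 < x then x ^- k * expR (- x^-1) else 0.

Lemma flat_ge0 k x : 0 <= flat k x.
Proof.
rewrite /flat; case: ifPn => // x0.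
by rewrite mulr_ge0 ?expR_ge0// invr_ge0 exprn_ge0// ltW.
Qed.

Lemma flat_gt0 k x : 0 < x -> 0 < flat k x.
Proof. by move=> x0; rewrite /flat x0 mulr_gt0 ?expR_gt0// invr_gt0 exprn_gt0. Qed.

Lemma flat_le0 k x : x <= 0 -> flat k x = 0.
Proof. by rewrite /flat leNgt => /negbTE ->. Qed.

(** From [y ^+ (k + 2) / (k + 2)! <= exp y] at [y = 1 / x]. This makes the difference quotient at 0
    tend to 0. *)
Lemma flat_quadratic k x : flat k x <= (k.+2)`!%:R * x ^+ 2.
Proof.
have [x0|x0] := leP x 0.
  by rewrite flat_le0// mulr_ge0// sqr_ge0.
rewrite /flat x0 expRN.
have xk : 0 < x^-1 by rewrite invr_gt0.
have := @expR_ge1Dxn R x^-1 k.+1 (ltW xk) => H.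
have H2 : x^-1 ^+ k.+2 / (k.+2)`!%:R <= expR x^-1 by apply: le_trans H; rewrite lerDr.
have f0 : 0 < ((k.+2)`!%:R : R) by rewrite ltr0n fact_gt0.
have p0 : 0 < x^-1 ^+ k.+2 / (k.+2)`!%:R by rewrite divr_gt0// exprn_gt0.
have H3 : (expR x^-1)^-1 <= (x^-1 ^+ k.+2 / (k.+2)`!%:R)^-1.
  by rewrite lef_pV2 ?posrE// expR_gt0.
apply: (@le_trans _ _ (x ^- k * (x^-1 ^+ k.+2 / (k.+2)`!%:R)^-1)).
  by apply: ler_wpM2l => //; rewrite invr_ge0 exprn_ge0// ltW.
have xk0 : x ^+ k.+2 != 0 by rewrite expf_neq0// gt_eqF.
have -> : (x^-1 ^+ k.+2 / (k.+2)`!%:R)^-1 = x ^+ k.+2 * (k.+2)`!%:R.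
  by rewrite exprVn invf_div invrK mulrC.
have -> : x ^+ k.+2 = x ^+ k * x ^+ 2 by rewrite -exprD addn2.
rewrite mulrA (mulrA _ (x ^+ k)) mulVf ?mul1r 1?mulrC//.
by rewrite expf_neq0// gt_eqF.
Qed.

Lemma is_derive_expn k x : is_derive x (1 : R) (fun y => y ^+ k) (k%:R * x ^+ k.-1).
Proof.
elim: k => [|k IH] /=; first by rewrite mul0r; exact: is_derive_cst.
rewrite (_ : (fun y => _) = fun y => y * y ^+ k); last by apply/funext => y; rewrite exprS.
derive_eq; case: k IH => [|k] _ /=; first by rewrite !expr0; ring.
by rewrite exprS -!natr1; ring.
Qed.

Lemma is_derive_flat k x :
  is_derive x (1 : R) (flat k) (flat k.+2 x - k%:R * flat k.+1 x).
Proof.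
have [x0|x0|->] := ltgtP x 0.
- rewrite !(flat_le0 _ (ltW x0)) mulr0 subr0.
  apply: (@near_eq_is_derive _ _ _ (cst 0)).
  by near=> y; rewrite /= flat_le0//; apply/ltW; near: y; exact: lt_nbhsl.
- apply: (@near_eq_is_derive _ _ _ (fun y => y ^- k * expR (- y^-1))).
    by near=> y; rewrite /flat ifT//; near: y; exact: lt_nbhsr.
  have xn0 : x != 0 by rewrite gt_eqF.
  have xk0 : x ^+ k != 0 by rewrite expf_neq0.
  have d1 : is_derive x (1 : R) (fun y => y ^+ k) (k%:R * x ^+ k.-1).
    exact: is_derive_expn.
  have d2 : is_derive x (1 : R) (fun y => expR (- y^-1)) (expR (- x^-1) * x ^- 2).
    apply: (@is_derive_compf _ expR (fun y => - y^-1)).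
    by derive_eq => //; ring.
  derive_eq => //.
  rewrite /flat x0; case: k xk0 d1 => [|k] xk0 d1 /=; first by field.
  by rewrite !exprS; field; rewrite xn0 expf_neq0.
- rewrite !flat_le0// mulr0 subr0.
  suff H : h^-1 *: ((flat k \o shift 0) (h *: (1 : R)) - flat k 0) @[h --> (0 : R)^'] --> (0 : R).
    by split; [apply/cvg_ex; exists 0|exact: cvg_lim H].
  apply/cvgr0Pnorm_le => e e0.
  have f0 : 0 < ((k.+2)`!%:R : R) by rewrite ltr0n fact_gt0.
  near=> h.
  have hn0 : h != 0 by near: h; exact: nbhs_dnbhs_neq.
  rewrite /= /GRing.scale/= mulr1 addr0 (flat_le0 _ (lexx 0)) subr0 normrM normfV.
  rewrite ler_pdivrMl ?normr_gt0// (ger0_norm (flat_ge0 _ _)).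
  apply: (le_trans (flat_quadratic _ _)).
  rewrite -real_normK ?num_real// expr2 mulrA [leRHS]mulrC ler_wpM2r//.
  rewrite -ler_pdivlMl//; near: h; apply: dnbhs0_le.
  by rewrite mulr_gt0// invr_gt0.
Unshelve. all: by end_near. Qed.

End FlatFunctions.

(** * Smoothness in two variables *)

Section SmoothFunctionsOfThePlane.
Context {R : realType}.
Implicit Types (phi psi : R * R -> R) (k n : nat) (z v : R * R) (a b c : R).

Lemma is_derive_line phi z v d :
  is_derive (0 : R) (1 : R) (fun h => phi (h *: v + z)) d -> is_derive z v phi d.
Proof.
move=> [+ <-]; rewrite /derivable /derive.
have -> : (fun h : R => h^-1 *: (((fun h : R => phi (h *: v + z)) \o shift 0) (h *: (1 : R)) -
    phi (0 *: v + z))) = (fun h => h^-1 *: ((phi \o shift z) (h *: v) - phi z)).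
  apply/funext => h; congr (_ *: (_ - phi _)); last by rewrite scale0r add0r.
  have hE : h *: (1 : R) + 0 = h by rewrite addr0 /GRing.scale/= mulr1.
  by rewrite /comp /shift hE.
by move=> H; split.
Qed.

Lemma of_class_C2d_cst n c : of_class_C2d n (fun _ : R * R => c).
Proof.
elim: n c => [|n IH] c /=; first by move=> z; exact: cst_continuous.
have D v : (fun z : R * R => 'D_v (fun _ : R * R => c) z) = (fun _ => 0).
  by apply/funext => z; exact: derive_cst.
split; [by move=> z; exact: cst_continuous| | | |].
- by move=> z; exact: derivable_cst.
- by move=> z; exact: derivable_cst.
- by rewrite /partial_t D.
- by rewrite /partial_x D.
Qed.

Lemma of_class_C2d_add n phi psi : of_class_C2d n phi -> of_class_C2d n psi ->
  of_class_C2d n (fun z => phi z + psi z).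
Proof.
elim: n phi psi => [|n IH] phi psi /=.
  by move=> cphi cpsi z; apply: cvgD; [exact: cphi|exact: cpsi].
move=> [c1 t1 x1 ct1 cx1] [c2 t2 x2 ct2 cx2]; split.
- by move=> z; apply: cvgD; [exact: c1|exact: c2].
- by move=> z; exact: derivableD.
- by move=> z; exact: derivableD.
- rewrite (_ : partial_t _ = fun z => partial_t phi z + partial_t psi z); first exact: IH.
  by apply/funext => z; rewrite /partial_t; exact: deriveD.
- rewrite (_ : partial_x _ = fun z => partial_x phi z + partial_x psi z); first exact: IH.
  by apply/funext => z; rewrite /partial_x; exact: deriveD.
Qed.

Lemma of_class_C2dS n phi : of_class_C2d n.+1 phi -> of_class_C2d n phi.
Proof.
elim: n phi => [|n IH] phi [c dt dx ct cx] //.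
by split => //; [exact: IH ct|exact: IH cx].
Qed.

Lemma of_class_C2d_mul n phi psi : of_class_C2d n phi -> of_class_C2d n psi ->
  of_class_C2d n (fun z => phi z * psi z).
Proof.
elim: n phi psi => [|n IH] phi psi.
  by move=> cphi cpsi z; apply: cvgM; [exact: cphi|exact: cpsi].
move=> C1 C2; have C1' := of_class_C2dS C1; have C2' := of_class_C2dS C2.
move: C1 C2 => [c1 t1 x1 ct1 cx1] [c2 t2 x2 ct2 cx2]; split.
- by move=> z; apply: cvgM; [exact: c1|exact: c2].
- by move=> z; exact: derivableM.
- by move=> z; exact: derivableM.
- rewrite (_ : partial_t _ = fun z => phi z * partial_t psi z + psi z * partial_t phi z).
    by apply: of_class_C2d_add; exact: IH.
  by apply/funext => z; rewrite /partial_t; exact: deriveM.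
- rewrite (_ : partial_x _ = fun z => phi z * partial_x psi z + psi z * partial_x phi z).
    by apply: of_class_C2d_add; exact: IH.
  by apply/funext => z; rewrite /partial_x; exact: deriveM.
Qed.

Definition affine2 a b c z : R := a * z.1 + b * z.2 + c.

Lemma is_derive_affine2 (g dg : R -> R) a b c z v :
  (forall x, is_derive x (1 : R) g (dg x)) ->
  is_derive z v (fun z => g (affine2 a b c z)) ((a * v.1 + b * v.2) * dg (affine2 a b c z)).
Proof.
move=> dgE; apply: is_derive_line.
have -> : (fun h : R => g (affine2 a b c (h *: v + z))) =
    (fun h => g (h * (a * v.1 + b * v.2) + affine2 a b c z)).
  by apply/funext => h; congr g; rewrite /affine2/= /GRing.scale/=; ring.
have -> : (a * v.1 + b * v.2) * dg (affine2 a b c z) =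
    dg (0 * (a * v.1 + b * v.2) + affine2 a b c z) * (a * v.1 + b * v.2).
  by rewrite mul0r add0r mulrC.
apply: (@is_derive_compf _ g (fun h => h * (a * v.1 + b * v.2) + affine2 a b c z)).
by derive_eq; ring.
Qed.

Lemma continuous_affine2 a b c : continuous (affine2 a b c).
Proof.
move=> z; rewrite /affine2; apply: cvgD; last exact: cvg_cst.
by apply: cvgD; apply: cvgM; [exact: cvg_cst|exact: cvg_fst|exact: cvg_cst|exact: cvg_snd].
Qed.

(** Induction on [n] for all [k] together: a partial derivative combines the members [k + 1] and
    [k + 2] of the family. *)
Lemma of_class_C2d_flat n k a b c : of_class_C2d n (fun z => flat k (affine2 a b c z)).
Proof.
have cont j : continuous (fun z => flat j (affine2 a b c z)).
  move=> z; apply: (@continuous_comp _ _ _ (affine2 a b c) (flat j)).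
    exact: continuous_affine2.
  exact: is_derive_continuous (is_derive_flat j _).
elim: n k => [|n IH] k; first exact: cont.
have D v z := is_derive_affine2 a b c z v (is_derive_flat k).
have smooth e : of_class_C2d n (fun z => e * (flat k.+2 (affine2 a b c z) +
    - k%:R * flat k.+1 (affine2 a b c z))).
  apply: of_class_C2d_mul; first exact: of_class_C2d_cst.
  apply: of_class_C2d_add; first exact: IH.
  by apply: of_class_C2d_mul; [exact: of_class_C2d_cst|exact: IH].
split; [exact: cont| | | |].
- by move=> z; have ? := D (1, 0) z; exact: ex_derive.
- by move=> z; have ? := D (0, 1) z; exact: ex_derive.
- have -> : partial_t (fun z => flat k (affine2 a b c z)) = fun z => (a * 1 + b * 0) *
      (flat k.+2 (affine2 a b c z) + - k%:R * flat k.+1 (affine2 a b c z)).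
    by apply/funext => z; have ? := D (1, 0) z; rewrite /partial_t derive_val/= mulNr.
  exact: smooth.
- have -> : partial_x (fun z => flat k (affine2 a b c z)) = fun z => (a * 0 + b * 1) *
      (flat k.+2 (affine2 a b c z) + - k%:R * flat k.+1 (affine2 a b c z)).
    by apply/funext => z; have ? := D (0, 1) z; rewrite /partial_x derive_val/= mulNr.
  exact: smooth.
Qed.

End SmoothFunctionsOfThePlane.

(** * Moving humps *)

Section Hump.
Context {R : realType}.
Implicit Types (r s t w x : R) (z : R * R).

Definition hump x : R := flat 0 (x + 1) * flat 0 (1 - x).

Definition dhump x : R := flat 2 (x + 1) * flat 0 (1 - x) - flat 0 (x + 1) * flat 2 (1 - x).

Lemma is_derive_hump x : is_derive x (1 : R) hump (dhump x).
Proof.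
have p1 : is_derive x (1 : R) (fun y : R => y + 1) 1 by derive_eq; ring.
have p2 : is_derive x (1 : R) (fun y : R => 1 - y) (- 1) by derive_eq; ring.
have d1 := is_derive_compf (f := flat 0) (g := fun y : R => y + 1) (is_derive_flat 0 _) p1.
have d2 := is_derive_compf (f := flat 0) (g := fun y : R => 1 - y) (is_derive_flat 0 _) p2.
by apply: (is_derive_eq (is_derive_mulf d1 d2)); rewrite /dhump; ring.
Qed.

Lemma hump_ge0 x : 0 <= hump x.
Proof. by rewrite mulr_ge0 ?flat_ge0. Qed.

Lemma hump_gt0 x : -1 < x < 1 -> 0 < hump x.
Proof. by move=> xI; rewrite mulr_gt0// flat_gt0; lra. Qed.

Lemma hump_out x : 1 <= `|x| -> hump x = 0.
Proof.
rewrite ler_normr => /orP[x1|x1]; rewrite /hump.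
  by rewrite (flat_le0 _ (_ : 1 - x <= 0)) ?mulr0// subr_le0.
by rewrite (flat_le0 _ (_ : x + 1 <= 0)) ?mul0r//; lra.
Qed.

Lemma dhump_out x : 1 <= `|x| -> dhump x = 0.
Proof.
rewrite ler_normr => /orP[x1|x1]; rewrite /dhump.
  have x0 : 1 - x <= 0 by lra.
  by rewrite !(flat_le0 _ x0) !mulr0 subrr.
have x0 : x + 1 <= 0 by lra.
by rewrite !(flat_le0 _ x0) !mul0r subrr.
Qed.

Lemma humpN x : hump (- x) = hump x.
Proof. by rewrite /hump opprK mulrC (addrC 1) (addrC (- x)). Qed.

Lemma continuous_flat k : continuous (@flat R k).
Proof. by move=> x; exact: is_derive_continuous (is_derive_flat k x). Qed.

Lemma continuous_hump : continuous hump.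
Proof. by move=> x; exact: is_derive_continuous (is_derive_hump x). Qed.

Lemma continuous_dhump : continuous dhump.
Proof.
have c1 k : continuous (fun x : R => flat k (x + 1)).
  move=> x; apply: (@continuous_comp _ _ _ (fun x => x + 1) (flat k)); last exact: continuous_flat.
  by apply: cvgD; [exact: cvg_id|exact: cvg_cst].
have c2 k : continuous (fun x : R => flat k (1 - x)).
  move=> x; apply: (@continuous_comp _ _ _ (fun x => 1 - x) (flat k)); last exact: continuous_flat.
  by apply: cvgB; [exact: cvg_cst|exact: cvg_id].
by move=> x; apply: cvgB; apply: cvgM; [exact: c1|exact: c2|exact: c1|exact: c2].
Qed.

Lemma hump_bounds : exists K b : R, [/\ 0 < K, 0 < b,
  forall x, `|hump x| <= K, forall x, `|dhump x| <= K &
  forall x, - (1 / 2) <= x <= 1 / 2 -> b <= hump x].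
Proof.
have [K1 [K10 K1P]] := continuous_bounded 1 continuous_hump.
have [K2 [K20 K2P]] := continuous_bounded 1 continuous_dhump.
have [b [b0 bP]] : exists b : R, 0 < b /\ forall x, - (1 / 2) <= x <= 1 / 2 -> b <= hump x.
  by apply: continuous_pos_lower_bound continuous_hump _ => x xI; apply: hump_gt0; lra.
have K0 : 0 <= K1 + K2 by lra.
exists (K1 + K2), b; split => // [|x|x]; first by lra.
- have [x1|x1] := leP 1 `|x|; first by rewrite hump_out// normr0.
  by apply: le_trans (K1P x _) _; [rewrite -ler_norml ltW|lra].
- have [x1|x1] := leP 1 `|x|; first by rewrite dhump_out// normr0.
  by apply: le_trans (K2P x _) _; [rewrite -ler_norml ltW|lra].
Qed.

Lemma of_class_C2d_hump n (a b c : R) : of_class_C2d n (fun z => hump (affine2 a b c z)).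
Proof.
rewrite (_ : (fun z => _) = fun z => flat 0 (affine2 a b (c + 1) z) *
    flat 0 (affine2 (- a) (- b) (1 - c) z)).
  by apply: of_class_C2d_mul; exact: of_class_C2d_flat.
by apply/funext => z; rewrite /hump /affine2; congr (flat 0 _ * flat 0 _); ring.
Qed.

Lemma is_derive_hump_affine2 (a b c : R) z v : is_derive z v (fun z => hump (affine2 a b c z))
  ((a * v.1 + b * v.2) * dhump (affine2 a b c z)).
Proof. exact: is_derive_affine2 is_derive_hump. Qed.

(* A hump of duration [2 r] and width [2 w], moving at speed [s] and centered at
   [(t, x)]. *)
Definition moving_hump t x s r w z : R := hump (affine2 r^-1 0 (- t / r) z) *
  hump (affine2 (- s / w) w^-1 ((s * t - x) / w) z).

Section MovingHump.
Variables (t x s r w : R).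
Hypotheses (r0 : 0 < r) (w0 : 0 < w).

Let tau z := (z.1 - t) / r.
Let xi z := (z.2 - (x + s * (z.1 - t))) / w.

Lemma moving_hump_timeE z : affine2 r^-1 0 (- t / r) z = (z.1 - t) / r.
Proof. by rewrite /affine2; ring. Qed.

Lemma moving_hump_spaceE z :
  affine2 (- s / w) w^-1 ((s * t - x) / w) z = (z.2 - (x + s * (z.1 - t))) / w.
Proof. by rewrite /affine2; ring. Qed.

Lemma moving_hump_ge0 z : 0 <= moving_hump t x s r w z.
Proof. by rewrite mulr_ge0 ?hump_ge0. Qed.

Lemma is_derive_moving_hump z v : is_derive z v (moving_hump t x s r w)
  (hump (tau z) * ((v.2 - s * v.1) / w * dhump (xi z)) +
   hump (xi z) * (v.1 / r * dhump (tau z))).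
Proof.
have d1 := is_derive_hump_affine2 r^-1 0 (- t / r) z v.
have d2 := is_derive_hump_affine2 (- s / w) w^-1 ((s * t - x) / w) z v.
apply: (is_derive_eq (is_deriveM d1 d2)).
rewrite /GRing.scale/= !moving_hump_timeE !moving_hump_spaceE -/(tau z) -/(xi z); congr (_ * _ + _ * _).
  by congr (_ * _); ring.
by congr (_ * _); ring.
Qed.

Lemma partial_t_moving_hump z : partial_t (moving_hump t x s r w) z =
  - s / w * hump (tau z) * dhump (xi z) + r^-1 * dhump (tau z) * hump (xi z).
Proof. by have ? := is_derive_moving_hump z (1, 0); rewrite /partial_t derive_val/=; ring. Qed.

Lemma partial_x_moving_hump z : partial_x (moving_hump t x s r w) z =
  w^-1 * hump (tau z) * dhump (xi z).
Proof. by have ? := is_derive_moving_hump z (0, 1); rewrite /partial_x derive_val/=; ring. Qed.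

Lemma ler_norm_div (y c : R) : 0 < c -> (1 <= `|y / c|) = (c <= `|y|).
Proof. by move=> c0; rewrite normrM normfV (gtr0_norm c0) ler_pdivlMr// mul1r. Qed.

Lemma moving_hump_out z : (r <= `|z.1 - t|) || (w <= `|z.2 - (x + s * (z.1 - t))|) ->
  [/\ moving_hump t x s r w z = 0, partial_t (moving_hump t x s r w) z = 0 &
      partial_x (moving_hump t x s r w) z = 0].
Proof.
rewrite partial_t_moving_hump partial_x_moving_hump /moving_hump moving_hump_timeE moving_hump_spaceE.
rewrite -(ler_norm_div _ r0) -(ler_norm_div _ w0) -/(tau z) -/(xi z) => /orP[H|H];
  by rewrite (hump_out H) (dhump_out H) !(mulr0, mul0r, addr0).
Qed.

Lemma test_function_moving_hump : r < t -> test_function (moving_hump t x s r w).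
Proof.
move=> rt; set phi := moving_hump t x s r w.
(* Half-width of the region swept in space: the width of the hump plus its displacement at speed [s]
   during the time [r]. *)
pose c : R := w + `|s| * r.
pose D : set (R * R) := `[t - r, t + r]%classic `*` `[x - c, x + c]%classic.
have cD : compact D by apply: compact_setX; exact: segment_compact.
have sD : closure [set z | phi z != 0] `<=` D.
  rewrite [D](closure_id D).1; last exact: compact_closed.
  apply: closureS => z /= phiz; apply: contrapT => nDz.
  case/eqP: phiz; suff /moving_hump_out[+ _ _] : (r <= `|z.1 - t|) || (w <= `|z.2 - (x + s * (z.1 - t))|).
    exact.
  have [//|zt] := leP r `|z.1 - t|; have [//|zx] := leP w `|z.2 - (x + s * (z.1 - t))|.
  exfalso; apply: nDz.
  have H : `|s * (z.1 - t)| <= `|s| * r by rewrite normrM ler_wpM2l// ltW.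
  move: zt zx H; rewrite ltr_distl ltr_distl ler_norml => /andP[? ?] /andP[? ?] /andP[? ?].
  by split; rewrite /= in_itv/= /c; apply/andP; split; lra.
split.
- by move=> n; apply: of_class_C2d_mul; exact: of_class_C2d_hump.
- by apply: subclosed_compact sD => //; exact: closed_closure.
- by apply: (subset_trans sD) => z [/=]; rewrite in_itv/= /half_plane/= => /andP[? _] _; lra.
Qed.

End MovingHump.
End Hump.

(** * Strong traces at Lebesgue points *)

Section LowerIntegral.
Import HBNNSimple.
Local Open Scope ereal_scope.
Context d (T : measurableType d) (R : realType) (mu : {measure set T -> \bar R}).
Implicit Types (f g m : T -> \bar R).

(* No measurability is needed: the integral of a nonnegative function is
   defined as its lower integral. *)
Lemma le_lower_integral f g : (forall x, 0 <= f x) -> (forall x, f x <= g x) ->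
  \int[mu]_x f x <= \int[mu]_x g x.
Proof.
move=> f0 fg; have g0 x : 0 <= g x by exact: le_trans (fg x).
rewrite !ge0_integralTE//; apply: ereal_sup_le => _ [h hf <-] /=.
by exists h => // x; exact: le_trans (fg x).
Qed.

(* The suprema in the definition of the strong traces need not be measurable;
   they are replaced by a largest measurable minorant. *)
Lemma measurable_envelope f : (forall x, 0 <= f x) -> \int[mu]_x f x < +oo ->
  exists g, [/\ measurable_fun setT g, forall x, 0 <= g x <= f x,
    \int[mu]_x g x <= \int[mu]_x f x &
    forall m, measurable_fun setT m -> (forall x, 0 <= m x <= f x) ->
      {ae mu, forall x, m x <= g x}].
Proof.
move=> f0 foo; set I := \int[mu]_x f x.
have I0 : 0 <= I by exact: integral_ge0.
have Ifin : I \is a fin_num by rewrite ge0_fin_numE.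
pose S := [set sintegral mu h | h in
    [set h : {nnsfun T >-> R} | forall x, (h x)%:E <= f x]].
have IE : I = ereal_sup S by rewrite /I ge0_integralTE.
have hP (n : nat) : exists h : {nnsfun T >-> R},
    (forall x, (h x)%:E <= f x) /\ I - (n.+1%:R^-1)%:E < sintegral mu h.
  have n0 : (0 < n.+1%:R^-1 :> R)%R by rewrite invr_gt0.
  have Sfin : ereal_sup S \is a fin_num by rewrite -IE.
  have [_ [h hf <-] Ih] := ub_ereal_sup_adherent n0 Sfin.
  by exists h; rewrite IE.
have [h {}hP] := choice hP.
(* A supremum of simple functions below [f] whose integrals approach that of [f]: it is measurable
   and loses nothing of the integral. *)
pose g x := ereal_sup (range (fun n => (h n x)%:E)).
have mg : measurable_fun setT g.
  have := @measurable_fun_esups _ T R setT (fun n x => (h n x)%:E) _ 0%N.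
  rewrite (_ : (fun x => _) = g).
    by apply=> n; exact/measurable_EFinP.
  apply/funext => x; rewrite /g /esups /sdrop; congr ereal_sup.
  by apply/seteqP; split => _ [n /= _ <-]; exists n.
have hg n x : (h n x)%:E <= g x by apply: ereal_sup_ubound; exists n.
have gf x : 0 <= g x <= f x.
  apply/andP; split; first by apply: le_trans (hg 0%N x); rewrite lee_fin.
  by apply: ge_ereal_sup => _ [n _ <-]; exact: (hP n).1.
have gI : \int[mu]_x g x <= I.
  by apply: le_lower_integral => x; have /andP[] := gf x.
exists g; split => // m mm mf.
(* [M] is a measurable minorant of [f] above [g]; having the same finite integral as [g], it equals
   [g] almost everywhere. *)
pose M x := maxe (m x) (g x).
have mM : measurable_fun setT M by exact: measurable_maxe.
have Mf x : 0 <= M x <= f x.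
  rewrite /M le_max ge_max; have /andP[-> ->] := mf x.
  by have /andP[_ ->] := gf x.
have MI : \int[mu]_x M x <= I.
  by apply: le_lower_integral => x; have /andP[] := Mf x.
have Ig : I <= \int[mu]_x g x.
  apply/lee_addgt0Pr => e e0.
  have [n ne] : exists n : nat, (n.+1%:R^-1 < e)%R.
    have [n _ /(_ n (leqnn n))] := near_infty_natSinv_lt (PosNum e0).
    by exists n.
  have := (hP n).2; rewrite lteBlDr// => /ltW/le_trans; apply.
  apply: leeD; last by rewrite lee_fin ltW.
  rewrite -integralT_nnsfun; apply: ge0_le_integral => //.
  - by move=> x _; rewrite lee_fin.
  - exact/measurable_EFinP.
have gfin : mu.-integrable setT g.
  apply/integrableP; split => //.
  rewrite (eq_integral g); last by move=> x _; rewrite gee0_abs//; have /andP[] := gf x.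
  exact: le_lt_trans gI _.
have Mfin : mu.-integrable setT M.
  apply/integrableP; split => //.
  rewrite (eq_integral M); last by move=> x _; rewrite gee0_abs//; have /andP[] := Mf x.
  exact: le_lt_trans MI _.
have gM x : g x <= M x by rewrite /M le_max lexx orbT.
have : {ae mu, forall x, M x = g x}.
  have D0 : \int[mu]_x (M x - g x) = 0.
    rewrite integralB//; apply/eqP; rewrite eq_le; apply/andP; split.
      rewrite leeBlDr; last exact: integrable_fin_num.
      by rewrite add0e; exact: le_trans Ig.
    rewrite sube_ge0; last by apply/orP; left; exact: integrable_fin_num.
    by apply: le_lower_integral => // x; have /andP[] := gf x.
  have gfinx := integrable_ae measurableT gfin.
  have mD : measurable_fun setT (fun x => M x - g x) by exact: emeasurable_funB.
  have D0' : \int[mu]_x `|M x - g x| = 0.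
    rewrite -[RHS]D0; apply: ae_eq_integral => //.
      exact: measurableT_comp.
    apply: filterS gfinx => x /(_ Logic.I) gx _.
    by rewrite gee0_abs// sube_ge0// gx.
  have /(ae_eq_integral_abs mu measurableT mD) := D0'.
  apply: filterS2 gfinx => x /(_ Logic.I) gx /(_ Logic.I) /= Dx.
  by rewrite -(subeK (M x) gx) Dx add0e.
by apply: filterS => x <-; rewrite /M le_max lexx.
Qed.

End LowerIntegral.

(** * Sections of null sets *)

Section PlaneSections.
Context {R : realType}.
Local Notation mu := (@lebesgue_measure R).
Implicit Types (A : set (R * R)) (P : R * R -> Prop).

Lemma measurable_lt_set d (X : measurableType d) (f g : X -> R) :
  measurable_fun setT f -> measurable_fun setT g -> measurable [set x | f x < g x].
Proof.
move=> mf mg; have := measurable_fun_ltr mf mg => /(_ measurableT [set true]).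
by rewrite setTI; apply.
Qed.

Lemma ae_eq0_integral (f : R -> \bar R) : measurable_fun setT f -> (forall t, 0 <= f t)%E ->
  (\int[mu]_t f t = 0)%E -> {ae mu, forall t, f t = 0%E}.
Proof.
move=> mf f0 If; have If' : (\int[mu]_t `|f t| = 0)%E.
  by rewrite -[RHS]If; apply: eq_integral => t _; rewrite gee0_abs.
have /(ae_eq_integral_abs mu measurableT mf) := If'.
by apply: filterS => t /(_ I).
Qed.

(** Tonelli in both orders: the sections in one direction show that [A] is null, hence almost all
    sections in the other direction are null. *)
Lemma ae_null_xsection A : measurable A -> (forall x, mu (ysection A x) = 0%E) ->
  {ae mu, forall t, mu (xsection A t) = 0%E}.
Proof.
move=> mA A0; apply: ae_eq0_integral => //; first exact: measurable_fun_xsection.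
have := @indic_fubini_tonelli _ _ _ _ R mu mu _ mA.
rewrite indic_fubini_tonelli_FE// indic_fubini_tonelli_GE// => ->.
by rewrite integral0_eq// => x _; exact: A0.
Qed.

Lemma ae_plane_sections P : {ae plane_measure, forall z : R * R, P z} ->
  {ae mu, forall t, {ae mu, forall x, P (t, x)}}.
Proof.
move=> [A [mA A0 PA]].
have : {ae mu, forall t, mu (xsection A t) = 0%E}.
  by apply: ae_eq0_integral => //; exact: measurable_fun_xsection.
apply: filterS => t At; exists (xsection A t); split => //.
  exact: measurable_xsection.
by move=> x /= nP; apply/mem_set/PA.
Qed.

End PlaneSections.

(** * From strong traces to almost everywhere bounds *)

Section EssentialTrace.
Context {R : realType}.
Local Notation mu := (@lebesgue_measure R).
Implicit Types (u : R * R -> R) (h v g : R -> R) (T e kappa delta : R).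

(* [kappa = 1] for the traces from the right, [kappa = - 1] from the left. *)
Definition side (kappa : R) (n : nat) : set R := [set y | 0 < kappa * y < n.+1%:R^-1].

Lemma right_side : (fun n => `]0, n.+1%:R^-1[%classic) = side 1.
Proof.
by apply/funext => n; apply/seteqP; split => y; rewrite /side/= in_itv/= mul1r.
Qed.

Lemma left_side : (fun n => `](- n.+1%:R^-1), 0[%classic) = side (- 1).
Proof.
apply/funext => n; apply/seteqP; split => y; rewrite /side/= in_itv/= mulN1r.
  by rewrite oppr_gt0 ltrNl andbC.
by rewrite oppr_gt0 ltrNl andbC.
Qed.

Lemma measurable_half_plane : measurable (@half_plane R).
Proof.
by apply: measurable_lt_set; [exact: measurable_cst|exact: measurable_fst].
Qed.

(** [n] makes the integral of the supremum over the strip smaller than [e], and [g] is a largest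
    measurable minorant of that supremum. For each fixed [x], [|u (t, x) - v t|] on the strip is a
    measurable minorant too, hence at most [g t] for almost every [t]. The exceptional set depends
    on [x]; Tonelli exchanges the two variables. *)
Lemma essential_trace kappa u h v T e : measurable_fun half_plane u -> continuous h ->
  kappa != 0 -> one_sided_trace (side kappa) 0 u h v -> 0 < T -> 0 < e ->
  exists delta g, [/\ 0 < delta, measurable_fun setT g, forall t, 0 <= g t,
    (\int[mu]_t (g t)%:E <= e%:E)%E &
    {ae mu, forall t, 0 < t < T ->
      {ae mu, forall x, 0 < kappa * (x - h t) < delta -> `|u (t, x) - v t| <= g t}}].
Proof.
move=> mu_ ch k0 [mv _ trv] T0 e0.
pose D : set R := `]0, T[%classic.
have mD : measurable D by exact: measurable_itv.
pose S n t : \bar R := ereal_sup [set `|u (t, h t + y)%R - v t|%:E | y in side kappa n].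
have [n Sn] : exists n, (\int[mu]_(t in D) S n t < e%:E)%E.
  have /fine_cvgP[Sfin Scvg] := trv T T0.
  have /cvgr0Pnorm_lt/(_ _ e0) H := Scvg.
  near \oo => n; exists n.
  have Snfin : (\int[mu]_(t in D) S n t)%E \is a fin_num by near: n.
  rewrite -(fineK Snfin) lte_fin; apply: le_lt_trans (ler_norm _) _.
  by near: n.
have d0 : 0 < n.+1%:R^-1 :> R by rewrite invr_gt0.
set delta : R := n.+1%:R^-1 in d0.
have S0 t : (0 <= S n t)%E.
  have yk : side kappa n (delta / 2 / kappa).
    by rewrite /side/= mulrC divfK//; apply/andP; split; rewrite -/delta; lra.
  apply: le_trans (ereal_sup_ubound _); last by exists (delta / 2 / kappa).
  by rewrite lee_fin.
pose f := S n \_ D.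
have f0 t : (0 <= f t)%E by rewrite /f patchE; case: ifP.
have If : (\int[mu]_t f t < e%:E)%E by rewrite /f -integral_mkcond.
have Ioo : (\int[mu]_t f t < +oo)%E by exact: lt_trans If (ltry _).
have [gE [mgE gf Ig gmax]] := measurable_envelope (mu := mu) f0 Ioo.
have gE0 t : (0 <= gE t)%E by have /andP[] := gf t.
pose g t := fine (gE t).
have mg : measurable_fun setT g by exact: measurableT_comp.
have gfin : {ae mu, forall t, gE t \is a fin_num}.
  have : mu.-integrable setT gE.
    apply/integrableP; split => //.
    rewrite (eq_integral gE); last by move=> t _; rewrite gee0_abs.
    exact: le_lt_trans Ig Ioo.
  by move/(integrable_ae measurableT); apply: filterS => t /(_ I).
pose u0 := u \_ half_plane.
have mu0 := (measurable_restrictT u measurable_half_plane).1 mu_.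
pose v0 := v \_ `]0, +oo[%classic.
have mv0 : measurable_fun setT v0.
  by apply/(measurable_restrictT _ _).1 => //; exact: measurable_itv.
have mh : measurable_fun setT h by exact: continuous_measurable_fun.
pose N : set (R * R) := ((fst @^-1` D) `&` [set z | 0 < kappa * (z.2 - h z.1)]) `&`
  [set z | kappa * (z.2 - h z.1) < delta] `&` [set z | g z.1 < `|u0 z - v0 z.1| ].
have mk : measurable_fun setT (fun z : R * R => kappa * (z.2 - h z.1)).
  apply: measurable_funM; first exact: measurable_cst.
  by apply: measurable_funB; [exact: measurable_snd|exact: measurableT_comp].
have mN : measurable N.
  apply: measurableI; first apply: measurableI; first apply: measurableI.
  - by rewrite -[X in measurable X]setTI; exact: measurable_fst.
  - by apply: measurable_lt_set => //; exact: measurable_cst.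
  - by apply: measurable_lt_set => //; exact: measurable_cst.
  - apply: measurable_lt_set; first exact: measurableT_comp.
    apply: measurableT_comp => //; apply: measurable_funB => //.
    exact: measurableT_comp.
have Ny x : mu (ysection N x) = 0%E.
  pose E : set R := D `&` [set t | 0 < kappa * (x - h t)] `&`
    [set t | kappa * (x - h t) < delta].
  have mkx : measurable_fun setT (fun t : R => kappa * (x - h t)).
    by apply: measurable_funM; [exact: measurable_cst|exact: measurable_funB].
  have mE : measurable E.
    apply: measurableI; first apply: measurableI => //.
    - by apply: measurable_lt_set => //; exact: measurable_cst.
    - by apply: measurable_lt_set => //; exact: measurable_cst.
  pose m : R -> \bar R := (fun t => `|u0 (t, x) - v0 t|%:E) \_ E.
  have mm' : measurable_fun E (fun t => `|u0 (t, x) - v0 t|%:E).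
    apply: measurable_funTS; apply/measurable_EFinP.
    apply: measurableT_comp => //; apply: measurable_funB => //.
    exact: measurable_fun_pair1.
  have mm : measurable_fun setT m := (measurable_restrictT _ mE).1 mm'.
  have mf t : (0 <= m t <= f t)%E.
    rewrite /m patchE; case: ifPn => [|_]; last by rewrite lexx f0.
    rewrite inE => -[[Dt k1] k2]; rewrite lee_fin normr_ge0/=.
    rewrite /f patchE mem_set//; apply: ereal_sup_ubound.
    exists (x - h t); first by rewrite /side/= k1.
    have t0 : 0 < t by move: Dt; rewrite /D/= in_itv/= => /andP[].
    rewrite subrKC /u0 /v0 !patchE !mem_set//=.
    by rewrite in_itv/= t0.
  have Hae := gmax m mm mf.
  have NE : {ae mu, forall t, ~ ysection N x t}.
    apply: filterS2 gfin Hae => t gt mgt.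
    rewrite /ysection/= inE => -[[[Dt k1] k2]] /=; apply/negP; rewrite -leNgt.
    rewrite -lee_fin /g fineK//; apply: le_trans mgt.
    by rewrite /m patchE mem_set.
  apply/negligibleP; first exact: measurable_ysection.
  by apply: negligibleS NE => t /= Nt; apply.
exists delta, g; split => //.
- by move=> t; rewrite fine_ge0.
- apply: le_trans (ltW If); apply: le_trans Ig; apply: le_lower_integral => t.
    by rewrite lee_fin fine_ge0.
  by rewrite /g; case: (gE t) (gE0 t) => //=; rewrite leey.
have Nae : {ae mu, forall t, mu (xsection N t) = 0%E} by exact: ae_null_xsection.
apply: (@filterS _ _ (ae_filter_ringOfSetsType mu)) Nae => t Nt tT.
exists (xsection N t); split => //; first exact: measurable_xsection.
move=> x /= /not_implyP[/andP[k1 k2]] /negP.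
rewrite -ltNge => gt; apply/mem_set; have t0 : 0 < t by case/andP: tT.
have gt' : g t < `|u0 (t, x) - v0 t|.
  by rewrite /u0 /v0 !patchE !mem_set//= in_itv/= t0.
by split; [split; [split; [rewrite /D/= in_itv|]|]|].
Unshelve. all: by end_near. Qed.

End EssentialTrace.

(** * Almost everywhere differentiability of Lipschitz functions *)

Section LipschitzDerivable.
Context {R : realType}.
Local Notation mu := (@lebesgue_measure R).
Implicit Types (h F : R -> R) (K : R).

Definition lipschitzT K h := forall x y, `|h x - h y| <= K * `|x - y|.

Lemma lipschitzT_continuous K h : lipschitzT K h -> continuous h.
Proof.
move=> hK x; apply/cvgrPdist_le => e e0; near=> y.
apply: (le_trans (hK x y)).
have K1 : 0 < `|K| + 1 by have := normr_ge0 K; lra.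
apply: (@le_trans _ _ ((`|K| + 1) * `|x - y|)).
  by apply: ler_wpM2r => //; have := ler_norm K; lra.
rewrite -ler_pdivlMl//; near: y; apply: cvgr_dist_le; first exact: cvg_id.
by rewrite mulr_gt0// invr_gt0.
Unshelve. all: by end_near. Qed.

(* The Stieltjes measures of [(id + h / K) / 2] and [(id - h / K) / 2] add up
   to the Lebesgue measure, so both are absolutely continuous. *)
Lemma lipschitz_stieltjes_integral K h (N : R) : 0 < K -> lipschitzT K h -> 0 < N ->
  exists f : R -> R, mu.-integrable setT (EFin \o f) /\
    forall x, - N < x < N ->
      (x + h x / K) / 2 - (- N + h (- N) / K) / 2 = \int[mu]_(t in `]- N, x]) f t.
Proof.
move=> K0 hK N0; have ch := lipschitzT_continuous hK.
pose F x : R := (x + h x / K) / 2; pose G x : R := (x - h x / K) / 2.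
have hd x y : x <= y -> `|(h y - h x) / K| <= y - x.
  move=> xy; rewrite normrM normfV (gtr0_norm K0) ler_pdivrMr// mulrC.
  by apply: le_trans (hK y x) _; rewrite ger0_norm// subr_ge0.
have ndF : {homo F : x y / x <= y}.
  by move=> x y /hd; rewrite ler_norml /F => /andP[]; lra.
have ndG : {homo G : x y / x <= y}.
  by move=> x y /hd; rewrite ler_norml /G => /andP[]; lra.
have cF : continuous F.
  move=> x; apply: cvgM; last exact: cvg_cst.
  apply: cvgD; first exact: cvg_id.
  by apply: cvgM; [exact: ch|exact: cvg_cst].
have cG : continuous G.
  move=> x; apply: cvgM; last exact: cvg_cst.
  apply: cvgB; first exact: cvg_id.
  by apply: cvgM; [exact: ch|exact: cvg_cst].
pose Fc : cumulative R R := HB.pack F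
  (isCumulative.Build R _ R F ndF (right_continuousW cF)).
pose Gc : cumulative R R := HB.pack G
  (isCumulative.Build R _ R G ndG (right_continuousW cG)).
pose mF := lebesgue_stieltjes_measure Fc.
pose mG := lebesgue_stieltjes_measure Gc.
have ext (g : cumulative R R) a b : a <= b ->
    lebesgue_stieltjes_measure g `]a, b]%classic = (g b - g a)%:E.
  move=> ab; rewrite /lebesgue_stieltjes_measure /measure_extension/=.
  by rewrite measurable_mu_extE/= ?wlength_itv_bnd//; exact: is_ocitv.
have muFG A : measurable A -> mu A = measure_add mF mG A.
  apply: lebesgue_measure_unique => X [[a b] _ <-].
  rewrite [RHS]measure_addE/=.
  have [ba|ab] := leP b a; first by rewrite set_itv_ge ?bnd_simp -?leNgt// !measure0 adde0.
  rewrite /mF /mG !ext ?ltW// lebesgue_measure_itv/= lte_fin ab -EFinD; congr EFin.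
  by rewrite /= /F /G; field; rewrite gt_eqF.
(* Restriction to a bounded interval gives a finite measure, to which the Radon-Nikodym theorem is
   applied. *)
pose D : set R := `]- N, N[%classic.
have mD : @measurable _ (measurableTypeR R) D by exact: measurable_itv.
have mFle A : measurable A -> (mF A <= mu A)%E.
  by move=> mA; rewrite muFG// measure_addE leeDl.
have DN : (mF D < +oo)%E.
  apply: le_lt_trans (mFle _ mD) _; rewrite lebesgue_measure_itv/=.
  by case: ifP => _; rewrite ltry.
pose nu : {finite_measure set (measurableTypeR R) -> \bar R} := mfrestr mD DN.
have numu : nu `<< mu.
  apply/null_content_dominatesP => A mA A0; apply/eqP; rewrite eq_le measure_ge0 andbT.
  rewrite -A0 /nu /mfrestr /mrestr; apply: le_trans (mFle _ _) _.
    exact: measurableI.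
  by apply: le_measure; rewrite ?inE//; exact: measurableI.
have [f [f0 ffin If fE]] :=
  @radon_nikodym_sigma_finite _ _ R mu nu numu.
exists (fine \o f); split.
  by apply: eq_integrable If => // x _; rewrite /= fineK.
move=> x xN; have Nx : - N <= x by lra.
rewrite /Rintegral (_ : (\int[mu]_(t in _) _)%E = nu `]- N, x]%classic); last first.
  rewrite fE//; apply: eq_integral => t _; by rewrite /= fineK.
have -> : nu `]- N, x]%classic = mF `]- N, x]%classic.
  rewrite /nu/= /mfrestr /mrestr/=; congr (lebesgue_stieltjes_measure _ _).
  apply/seteqP; split => t /=; rewrite /D/= !in_itv/=; first by case.
  by move=> /andP[t1 t2]; rewrite t1 t2; split => //; apply: le_lt_trans t2 _; lra.
by rewrite /mF ext.
Qed.

(** On each bounded interval [h] combines the identity, a constant and an indefinite integral, which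
    is differentiable almost everywhere. *)
Lemma lipschitz_ae_derivable K h : lipschitzT K h -> {ae mu, forall x, derivable h x 1}.
Proof.
move=> hK0; have [K' [K0 hK]] : exists K' : R, 0 < K' /\ lipschitzT K' h.
  exists (`|K| + 1); split; first by have := normr_ge0 K; lra.
  move=> x y; apply: le_trans (hK0 x y) _; apply: ler_wpM2r => //.
  by have := ler_norm K; lra.
have H (n : nat) : {ae mu, forall x, - n.+1%:R < x < n.+1%:R -> derivable h x 1}.
  have n0 : 0 < n.+1%:R :> R by [].
  have [f [If fE]] := lipschitz_stieltjes_integral K0 hK n0.
  have lf : locally_integrable setT f.
    split; [|exact: openT|].
      by apply/measurable_EFinP; exact: measurable_int If.
    move=> A _ cA; have mA : measurable A.
      by apply: closed_measurable; exact: compact_closed.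
    have IA : mu.-integrable A (EFin \o f) by apply: integrableS If.
    by case/integrableP : IA.
  have If' y : mu.-integrable [set` Interval (BRight (- n.+1%:R)) (BRight y)] (EFin \o f).
    by apply: integrableS If => //; exact: measurable_itv.
  apply: ae_imp (FTC1 If' lf) _ => x /= dx xn.
  have [|{}dx _] := dx; first by rewrite lte_fin; case/andP: xn.
  pose c : R := (- n.+1%:R + h (- n.+1%:R) / K') / 2.
  pose Phi (y : R) := \int[mu]_(t in [set` Interval (BRight (- n.+1%:R)) (BRight y)]) f t.
  have dPhi : is_derive x (1 : R) Phi (derive1 Phi x) by split; rewrite ?derive1E.
  have dg : is_derive x (1 : R) (fun y => K' * (2 * (Phi y + c) - y))
     (K' * (2 * derive1 Phi x - 1)) by derive_eq; ring.
  have : derivable (fun y => K' * (2 * (Phi y + c) - y)) x 1 by exact: ex_derive.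
  apply: near_eq_derivable; near=> y.
  have yn : - n.+1%:R < y < n.+1%:R.
    by apply/andP; split; near: y; [apply: lt_nbhsr|apply: lt_nbhsl]; case/andP: xn.
  by rewrite /Phi -fE// /c; field; rewrite gt_eqF.
apply: ae_imp (ae_foralln H) _ => x /(_ (Num.truncn `|x|)); apply.
rewrite -ltr_norml; exact: truncnS_gt.
Unshelve. all: by end_near. Qed.

End LipschitzDerivable.

(** * Traces as averaged limits at almost every time *)

Section LebesguePoints.
Context {R : realType}.
Local Notation mu := (@lebesgue_measure R).
Implicit Types (f g h v psi : R -> R) (u : R * R -> R) (t x y e r c d B T kappa delta : R).

Lemma lebesgue_pt_integral f x e : lebesgue_pt f x -> 0 < e ->
  exists d, 0 < d /\ forall r, 0 < r -> r < d ->
    (\int[mu]_(t in `](x - r)%R, (x + r)%R[) `|f t - f x|%:E <= (e * r)%:E)%E.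
Proof.
move=> fx e0; have /fine_cvgP[ffin fcvg] := fx.
have e20 : 0 < e / 2 by lra.
have /cvgr0Pnorm_lt/(_ _ e20) near1 := fcvg.
have [d /= d0 dP] : \forall r \near 0^'+, davg f x r \is a fin_num /\ `|fine (davg f x r)| < e / 2.
  by near do split.
exists d; split => // r r0 rd.
have rb : ball 0 d r by rewrite /ball/= sub0r normrN gtr0_norm.
have [afin aE] := dP r rb r0.
have : (davg f x r <= (e / 2)%:E)%E.
  by rewrite -(fineK afin) lee_fin; apply/ltW/(le_lt_trans (ler_norm _)).
have r20 : 0 < r *+ 2 by rewrite mulrn_wgt0.
have -> : davg f x r = ((r *+ 2)^-1%:E * \int[mu]_(t in `](x - r)%R, (x + r)%R[) `|f t - f x|%:E)%E.
  rewrite /davg /iavg lebesgue_measure_ball ?ltW// inver (gt_eqF r20); congr (_ * _)%E.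
  rewrite -ball_itv; apply: eq_integral => t _.
  by [].
rewrite lee_pdivrMl// -EFinM.
by congr (_ <= _)%E; congr EFin; rewrite -mulr_natl; field.
Unshelve. all: by end_near. Qed.

Lemma ge0_locally_integrable g : measurable_fun setT g -> (forall t, 0 <= g t) ->
  (\int[mu]_t (g t)%:E < +oo)%E -> locally_integrable setT g.
Proof.
move=> mg g0 Ig; split => //; first exact: openT.
move=> A _ cA; have mA : measurable A.
  by apply: closed_measurable; exact: compact_closed.
apply: le_lt_trans Ig; rewrite integral_mkcond; apply: le_lower_integral => x.
  by rewrite patchE; case: ifP => //; rewrite lee_fin.
by rewrite patchE; case: ifP => _; rewrite ?lee_fin ?ger0_norm.
Qed.

Lemma bounded_locally_integrable f B : measurable_fun setT f -> (forall x, `|f x| <= B) ->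
  locally_integrable setT f.
Proof.
move=> mf fB; split => //; first exact: openT.
move=> A _ cA; have mA : measurable A.
  by apply: closed_measurable; exact: compact_closed.
have IA : mu.-integrable A (EFin \o f).
  apply: measurable_bounded_integrable => //; first exact: compact_finite_measure.
    exact: measurable_funTS.
  exists B; split; first exact: num_real.
  by move=> y By x _; apply: le_trans (fB x) (ltW By).
by case/integrableP : IA.
Qed.

(** The infimum over [n] has integral at most [1 / (n + 1)] for every [n], so it vanishes almost
    everywhere. *)
Lemma ae_exists_small (g : nat -> R -> R) : (forall n, measurable_fun setT (g n)) ->
  (forall n t, 0 <= g n t) -> (forall n, (\int[mu]_t (g n t)%:E <= (n.+1%:R^-1)%:E)%E) ->
  {ae mu, forall t, forall e, 0 < e -> exists n, g n t < e}.
Proof.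
move=> mg g0 Ig; pose G t := einfs (fun n => (g n t)%:E) 0.
have mG : measurable_fun setT G.
  by apply: measurable_fun_einfs => n; exact/measurable_EFinP.
have Gg n t : (G t <= (g n t)%:E)%E by apply: ereal_inf_lbound; exists n.
have G0 t : (0 <= G t)%E by apply: le_ereal_inf_tmp => _ [n _ <-]; rewrite lee_fin.
have IG : (\int[mu]_t G t = 0)%E.
  apply/eqP; rewrite eq_le integral_ge0// andbT; apply/lee_addgt0Pr => e e0.
  have [n _ /(_ n (leqnn n)) ne] := near_infty_natSinv_lt (PosNum e0).
  rewrite add0e; apply: (@le_trans _ _ (n.+1%:R^-1%:E)); last by rewrite lee_fin ltW.
  apply: le_trans (Ig n); apply: ge0_le_integral => //.
  by have /measurable_EFinP := mg n.
apply: ae_imp (ae_eq0_integral mG G0 IG) _ => t Gt e e0.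
have : (G t < e%:E)%E by rewrite Gt lte_fin.
by move=> /ereal_inf_lt[_ [n _ <-]]; rewrite lte_fin; exists n.
Qed.

(* [c] is the limit of [u] at [(t, h t)], in an averaged sense, from the side
   of [h] given by [kappa]. *)
Definition trace_point u h kappa t c := forall e, 0 < e ->
  exists delta psi, [/\ 0 < delta, measurable_fun setT psi, forall s, 0 <= psi s,
    {ae mu, forall s, `|s - t| < delta ->
       {ae mu, forall x, 0 < kappa * (x - h s) < delta -> `|u (s, x) - c| <= psi s}} &
    forall r, 0 < r -> r < delta -> (\int[mu]_(s in `](t - r)%R, (t + r)%R[) (psi s)%:E <= (e * r)%:E)%E].

Lemma ae_imp3 (P1 P2 P3 Q : R -> Prop) : {ae mu, forall x, P1 x} -> {ae mu, forall x, P2 x} ->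
  {ae mu, forall x, P3 x} -> (forall x, P1 x -> P2 x -> P3 x -> Q x) -> {ae mu, forall x, Q x}.
Proof.
move=> H1 H2 H3 HQ; apply: ae_imp2 H1 (ae_imp2 H2 H3 (fun _ a b => conj a b)) _.
by move=> x p1 [p2 p3]; exact: HQ.
Qed.

(** The error at time [s] splits into the distance [g s] from [u] to its trace and the oscillation
    [|v0 s - v0 t|] of the trace. At a common Lebesgue point of [g] and [v0] where [g] is small,
    both are small in the mean. *)
Lemma trace_point_from_lebesgue_pt u h kappa t v0 g delta e T : 0 < e -> 0 < delta ->
  0 < t < T -> measurable_fun setT v0 -> measurable_fun setT g -> (forall s, 0 <= g s) ->
  lebesgue_pt v0 t -> lebesgue_pt g t -> g t < e / 4 ->
  {ae mu, forall s, 0 < s < T -> {ae mu, forall x, 0 < kappa * (x - h s) < delta ->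
     `|u (s, x) - v0 s| <= g s}} ->
  exists delta psi, [/\ 0 < delta, measurable_fun setT psi, forall s, 0 <= psi s,
    {ae mu, forall s, `|s - t| < delta ->
       {ae mu, forall x, 0 < kappa * (x - h s) < delta -> `|u (s, x) - v0 t| <= psi s}} &
    forall r, 0 < r -> r < delta -> (\int[mu]_(s in `](t - r)%R, (t + r)%R[) (psi s)%:E <= (e * r)%:E)%E].
Proof.
move=> e0 d0 tT mv0 mg g0 lv lg gt ugP.
have e40 : 0 < e / 4 by lra.
have [d1 [d10 d1P]] := lebesgue_pt_integral lv e40.
have [d2 [d20 d2P]] := lebesgue_pt_integral lg e40.
have [d3 [d30 d31 d32]] := min_spec d10 d20.
have t0 : 0 < t by lra.
have tT0 : 0 < T - t by lra.
have [d4 [d40 d41 d42]] := min_spec t0 tT0.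
have [d5 [d50 d53 d54]] := min_spec d30 d40.
have [d [d00 dd d5d]] := min_spec d0 d50.
pose psi s := g s + `|v0 s - v0 t|.
have mdv : measurable_fun setT (fun s => `|v0 s - v0 t|).
  by apply: measurableT_comp => //; apply: measurable_funB.
have mpsi : measurable_fun setT psi by exact: measurable_funD.
exists d, psi; split => //.
- by move=> s; rewrite addr_ge0.
- apply: ae_imp ugP _ => s us sd.
  have sT : 0 < s < T by move: sd; rewrite ltr_distl; lra.
  apply: ae_imp (us sT) _ => x ux xd.
  have -> : u (s, x) - v0 t = (u (s, x) - v0 s) + (v0 s - v0 t) by ring.
  apply: (le_trans (ler_normD _ _)); rewrite lerD2r; apply: ux.
  by case/andP: xd => -> /lt_le_trans; apply.
move=> r r0 rd; have mI : measurable (`](t - r)%R, (t + r)%R[%classic : set R) by exact: measurable_itv.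
rewrite /psi; under eq_integral do rewrite EFinD.
rewrite ge0_integralD//; last 2 first.
- by apply: measurable_funTS; exact/measurable_EFinP.
- by apply: measurable_funTS; exact/measurable_EFinP.
(* The shares of the oscillation of [g], of the value [g t] over a length [2 * r], and of the
   oscillation of [v0]. *)
have -> : (e * r = (e / 4 * r + e / 4 * (r * 2)) + e / 4 * r) by field.
rewrite EFinD; apply: leeD; last by apply: d1P => //; lra.
apply: (@le_trans _ _ (\int[mu]_(s in `](t - r)%R, (t + r)%R[) (`|g s - g t|%:E + (e / 4)%:E))%E).
  apply: ge0_le_integral => //.
  - by move=> s _; rewrite lee_fin.
  - by apply: measurable_funTS; exact/measurable_EFinP.
  - apply: measurable_funTS; apply: emeasurable_funD => //; apply/measurable_EFinP.
    by apply: measurableT_comp => //; exact: measurable_funB.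
  move=> s _; rewrite -EFinD lee_fin; have := ler_norm (g s - g t); lra.
rewrite ge0_integralD//; last 2 first.
- apply: measurable_funTS; apply/measurable_EFinP.
  by apply: measurableT_comp => //; exact: measurable_funB.
- by move=> s _; rewrite lee_fin ltW.
rewrite EFinD; apply: leeD; first by apply: d2P => //; lra.
have muI : mu `](t - r)%R, (t + r)%R[%classic = (r * 2)%:E.
  by rewrite lebesgue_measure_itv/= lte_fin ifT -?EFinD; [congr EFin; ring|lra].
rewrite integral_cst// [X in (_ * X <= _)%E](_ : _ = (r * 2)%:E); last exact: muI.
  by rewrite -EFinM lee_fin.
by move=> s _; rewrite lee_fin.
Qed.

(** The bounds with [e = 1 / (n + 1)] are used for all [n] together: outside one null set, [t] is a
    Lebesgue point of every [g n], and some [g n t] is as small as desired. *)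
Lemma ae_trace_point_lt kappa u h v T : measurable_fun half_plane u -> continuous h ->
  kappa != 0 -> one_sided_trace (side kappa) 0 u h v -> 0 < T ->
  {ae mu, forall t, 0 < t < T -> trace_point u h kappa t (v t)}.
Proof.
move=> mu_ ch k0 tr T0.
have E (n : nat) : 0 < n.+1%:R^-1 :> R by rewrite invr_gt0.
have dgP n := essential_trace mu_ ch k0 tr T0 (E n).
have [delta {}dgP] := choice dgP; have [g {}dgP] := choice dgP.
have mg n : measurable_fun setT (g n) by case: (dgP n).
have g0 n t : 0 <= g n t by case: (dgP n).
have Ig n : (\int[mu]_t (g n t)%:E <= (n.+1%:R^-1)%:E)%E by case: (dgP n).
have [mv [B [_ vB]] _] := tr.
pose v0 := v \_ `]0, +oo[%classic.
have mitv : measurable (`]0, +oo[%classic : set R) by exact: measurable_itv.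
have mv0 : measurable_fun setT v0 := (measurable_restrictT _ mitv).1 mv.
have v0E t : 0 < t -> v0 t = v t.
  by move=> t0; rewrite /v0 patchE mem_set//= in_itv/= t0.
have v0B t : `|v0 t| <= `|B| + 1.
  rewrite /v0 patchE; case: ifPn => [|_]; last by rewrite normr0 addr_ge0.
  rewrite inE => t0; apply: (vB (`|B| + 1)) => //.
  by have := ler_norm B; lra.
have lv := lebesgue_differentiation (bounded_locally_integrable mv0 v0B).
have lg : {ae mu, forall t, forall n, lebesgue_pt (g n) t}.
  apply: ae_foralln => n; apply: lebesgue_differentiation.
  exact: ge0_locally_integrable (mg n) (g0 n) (le_lt_trans (Ig n) (ltry _)).
apply: ae_imp3 (ae_exists_small mg g0 Ig) lg lv _ => t small {}lg {}lv tT e e0.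
have e40 : 0 < e / 4 by lra.
have [n gn] := small _ e40.
have [dn _ _ _ uP] := dgP n.
have t0 : 0 < t by lra.
rewrite -(v0E _ t0).
apply: (trace_point_from_lebesgue_pt e0 dn tT mv0 (mg n) (g0 n) lv (lg n) gn).
by apply: ae_imp uP _ => s us sT; have s0 : 0 < s by [lra]; rewrite v0E//; exact: us.
Qed.

Lemma ae_trace_point kappa u h v : measurable_fun half_plane u -> continuous h ->
  kappa != 0 -> one_sided_trace (side kappa) 0 u h v ->
  {ae mu, forall t, 0 < t -> trace_point u h kappa t (v t)}.
Proof.
move=> mu_ ch k0 tr.
have H (n : nat) : {ae mu, forall t, 0 < t < n.+1%:R -> trace_point u h kappa t (v t)}.
  exact: ae_trace_point_lt.
apply: ae_imp (ae_foralln H) _ => t /(_ (Num.truncn t)) tP t0; apply: tP.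
by rewrite t0 truncnS_gt.
Qed.

End LebesguePoints.

(** * Filippov trajectories *)

Section Averages.
Context {R : realType}.
Local Notation mu := (@lebesgue_measure R).
Implicit Types (f g h m : R -> R) (W : R * R -> R) (a b c e t x y B L tau sigma delta : R).

Lemma lebesgue_measure_ocitv a b : a <= b -> (mu `]a, b]%classic = (b - a)%:E)%E.
Proof.
rewrite le_eqVlt => /predU1P[->|ab]; first by rewrite set_itvxx measure0 subrr.
by rewrite lebesgue_measure_itv/= lte_fin ab EFinD.
Qed.

Lemma bounded_integrable_ocitv f B a b : measurable_fun setT f -> (forall x, `|f x| <= B) ->
  mu.-integrable `]a, b]%classic (EFin \o f).
Proof.
move=> mf fB; have mI : measurable (`]a, b]%classic : set R) by exact: measurable_itv.
apply: measurable_bounded_integrable => //.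
- have [ab|ba] := leP a b; first by rewrite [X in (X < _)%E](lebesgue_measure_ocitv ab) ltry.
  by rewrite set_itv_ge ?measure0 ?ltry// bnd_simp -leNgt ltW.
- exact: measurable_funTS.
by exists B; split; [exact: num_real|move=> y By x _; exact: le_trans (fB x) (ltW By)].
Qed.

(** The integral of [m] may be infinite, so the bound lives in the extended reals; [f - c] is
    replaced by its positive part, which is at most [m] almost everywhere on the interval. *)
Lemma ae_le_Rintegral_ocitv f m B c a b : measurable_fun setT f -> (forall x, `|f x| <= B) ->
  measurable_fun setT m -> (forall x, 0 <= m x) -> a <= b ->
  {ae mu, forall x, a < x <= b -> f x <= c + m x} ->
  ((\int[mu]_(x in `]a, b]) f x - c * (b - a))%:E <= \int[mu]_(x in `]a, b]) (m x)%:E)%E.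
Proof.
move=> mf fB mm m0 ab fm.
have mI : measurable (`]a, b]%classic : set R) by exact: measurable_itv.
have If : mu.-integrable `]a, b]%classic (EFin \o f) := bounded_integrable_ocitv _ _ mf fB.
have Ic : mu.-integrable `]a, b]%classic (EFin \o (fun=> c)).
  by apply: (@bounded_integrable_ocitv _ `|c|) => //; exact: measurable_cst.
have -> : \int[mu]_(x in `]a, b]) f x - c * (b - a) = \int[mu]_(x in `]a, b]) (f x - c).
  rewrite RintegralB// Rintegral_cst//; congr (_ - _ * _).
  by rewrite [X in fine X](lebesgue_measure_ocitv ab).
have mfc : measurable_fun setT (fun x => f x - c) by exact: measurable_funB.
have fcB x : `|f x - c| <= B + `|c|.
  by apply: le_trans (ler_normB _ _) _; rewrite lerD2r.
have Ifc := bounded_integrable_ocitv a b mfc fcB.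
pose p x := Num.max (f x - c) 0.
have mp : measurable_fun setT p by apply: measurable_maxr => //; exact: measurable_cst.
have pB x : `|p x| <= B + `|c|.
  rewrite /p ger0_norm; last by rewrite le_max lexx orbT.
  by rewrite ge_max (le_trans (ler_norm _) (fcB x))//= (le_trans (normr_ge0 _) (fcB x)).
have Ip := bounded_integrable_ocitv a b mp pB.
rewrite /Rintegral fineK; last exact: integrable_fin_num.
apply: (@le_trans _ _ (\int[mu]_(x in `]a, b]) (p x)%:E)%E).
  by apply: le_integral => // x _; rewrite lee_fin /p le_max lexx.
apply: ae_ge0_le_integral => //.
- by move=> x _; rewrite lee_fin /p le_max lexx orbT.
- by apply: measurable_funTS; have /measurable_EFinP := mp.
- by move=> x _; rewrite lee_fin.
- by apply: measurable_funTS; have /measurable_EFinP := mm.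
apply: ae_imp fm _ => x fx; rewrite /= in_itv/= => xI.
by rewrite lee_fin /p ge_max m0 andbT lerBlDl fx.
Qed.

(* Velocity of [W] averaged over the square [(t, t + tau] x (x, x + tau]],
   times [tau]; the shift by [L] makes the inner integrand nonnegative. *)
Definition average_step W L tau t x : R :=
  tau^-1 * \int[mu]_(s in `]t, t + tau]) (\int[mu]_(y in `]x, x + tau]) (W (s, y) + L)) - L * tau.

(** A one-sided essential bound on [W], with an error depending on time only, survives averaging in
    space and then in time. The sign [sigma] covers upper and lower bounds in one statement. *)
Lemma average_stepP W L tau t x sigma c m : measurable_fun setT W -> (forall z, `|W z| <= L) ->
  0 < tau -> `|sigma| = 1 -> measurable_fun setT m -> (forall s, 0 <= m s) ->
  {ae mu, forall s, t < s <= t + tau ->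
    {ae mu, forall y, x < y <= x + tau -> sigma * W (s, y) <= c + m s}} ->
  ((sigma * average_step W L tau t x - c * tau)%:E <= \int[mu]_(s in `]t, (t + tau)%R]) (m s)%:E)%E.
Proof.
move=> mW WL tau0 s1 mm m0 Hae.
have taux : x <= x + tau by rewrite lerDl ltW.
have taut : t <= t + tau by rewrite lerDl ltW.
have L0 : 0 <= L by apply: le_trans (WL (0, 0)).
have WL0 z : 0 <= W z + L by have := WL z; rewrite ler_norml; lra.
have WL2 z : `|W z + L| <= 2 * L by rewrite ger0_norm//; have := WL z; rewrite ler_norml; lra.
have mWs s : measurable_fun setT (fun y => W (s, y)) by exact: measurable_fun_pair2.
have mWL s : measurable_fun setT (fun y => W (s, y) + L) by exact: measurable_funD.
have mJ : measurable (`]x, x + tau]%classic : set R) by exact: measurable_itv.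
pose H s := \int[mu]_(y in `]x, x + tau]) (W (s, y) + L).
have mH : measurable_fun setT H.
  pose J2 : set (R * R) := snd @^-1` `]x, x + tau]%classic.
  have mJ2 : measurable J2 by rewrite -[J2]setTI; exact: measurable_snd.
  pose F : R * R -> \bar R := (fun z => (W z + L)%:E) \_ J2.
  have mF : measurable_fun setT F.
    have mWL' : measurable_fun J2 (fun z => (W z + L)%:E).
      by apply: measurable_funTS; apply/measurable_EFinP; exact: measurable_funD.
    exact: (measurable_restrictT _ mJ2).1 mWL'.
  have F0 z : (0 <= F z)%E by rewrite /F patchE; case: ifP => // _; rewrite lee_fin.
  have := @measurable_fun_fubini_tonelli_F _ _ _ _ R mu _ mF F0.
  move=> mG; have mfG : measurable_fun setT (fine \o fubini_F mu F).
    by exact: measurableT_comp mG.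
  rewrite (_ : H = fine \o fubini_F mu F)//.
  apply/funext => s; rewrite /H/= /fubini_F /Rintegral integral_mkcond.
  have -> : (fun y => F (s, y)) = (fun y => (W (s, y) + L)%:E) \_ `]x, (x + tau)%R]%classic.
    by apply/funext => y; rewrite /F !patchE.
  by [].
have H0 s : 0 <= H s by apply: Rintegral_ge0.
have sW s y : `|sigma * (W (s, y) + L)| <= 2 * L by rewrite normrM s1 mul1r.
have inner s c' : {ae mu, forall y, x < y <= x + tau -> sigma * (W (s, y) + L) <= c'} ->
    sigma * H s <= c' * tau.
  move=> Hc; have msW : measurable_fun setT (fun y => sigma * (W (s, y) + L)).
    by apply: measurable_funM => //; exact: measurable_cst.
  have IW := bounded_integrable_ocitv x (x + tau) (mWL s) (fun y => WL2 (s, y)).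
  have := @ae_le_Rintegral_ocitv _ (fun=> 0) (2 * L) c' x (x + tau) msW (sW s) _ _ taux _.
  rewrite integral0 RintegralZl// -/(H s) lee_fin addrAC subrr add0r subr_le0; apply.
  - exact: measurable_cst.
  - by [].
  - by apply: ae_imp Hc _ => y Hy xy; rewrite addr0; exact: Hy.
have HB s : `|H s| <= 2 * L * tau.
  rewrite ger0_norm//.
  have IW := bounded_integrable_ocitv x (x + tau) (mWL s) (fun y => WL2 (s, y)).
  have := @ae_le_Rintegral_ocitv _ (fun=> 0) (2 * L) (2 * L) x (x + tau) (mWL s)
    (fun y => WL2 (s, y)) _ _ taux _.
  rewrite integral0 -/(H s) lee_fin addrAC subrr add0r subr_le0; apply.
  - exact: measurable_cst.
  - by [].
  - by apply: aeW => y _; rewrite addr0; exact: le_trans (ler_norm _) (WL2 _).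
pose K s := tau^-1 * sigma * H s.
have mK : measurable_fun setT K by apply: measurable_funM => //; exact: measurable_cst.
have KB s : `|K s| <= 2 * L.
  rewrite /K !normrM s1 mulr1 normfV (gtr0_norm tau0) mulrC ler_pdivrMr//.
have Km : {ae mu, forall s, t < s <= t + tau -> K s <= (c + sigma * L) + m s}.
  apply: ae_imp Hae _ => s Hs ts; rewrite /K -mulrA ler_pdivrMl// [leRHS]mulrC.
  apply: inner; apply: ae_imp (Hs ts) _ => y Hy xy.
  by have := Hy xy; lra.
have := ae_le_Rintegral_ocitv mK KB mm m0 taut Km.
have -> : \int[mu]_(s in `]t, t + tau]) K s = tau^-1 * sigma * \int[mu]_(s in `]t, t + tau]) H s.
  rewrite /K RintegralZl//; exact: bounded_integrable_ocitv mH HB.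
congr (_ <= _)%E; congr EFin; rewrite /average_step; ring.
Qed.

Lemma average_step_bound W L tau t x : measurable_fun setT W -> (forall z, `|W z| <= L) ->
  0 < tau -> `|average_step W L tau t x| <= L * tau.
Proof.
move=> mW WL tau0.
have bound sigma : `|sigma| = 1 -> sigma * average_step W L tau t x <= L * tau.
  move=> s1; have := @average_stepP W L tau t x sigma L (fun=> 0) mW WL tau0 s1 _ _ _.
  rewrite integral0 lee_fin subr_le0; apply => //; apply: aeW => s _; apply: aeW => y _.
  by rewrite addr0; apply: le_trans (ler_norm _) _; rewrite normrM s1 mul1r.
rewrite ler_norml; have := bound 1 (normr1 _); have := bound (-1).
by rewrite normrN1 => /(_ erefl); rewrite mulN1r mul1r => ? ?; apply/andP; split; lra.
Qed.

End Averages.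

(** * Convergence of the Euler scheme *)

Section Trajectories.
Context {R : realType}.
Local Notation mu := (@lebesgue_measure R).
Implicit Types (h m : R -> R) (P : nat -> R -> R) (W : R * R -> R)
  (a b c e s t x y L tau sigma delta tbar : R).

(** Limits along an ultrafilter finer than [\oo] exist at all times simultaneously, because the
    values at a given time stay in a compact interval; this replaces the extraction of a
    subsequence. Closeness at two given times with a small mesh is all that is used of the
    convergence. *)
Lemma equilipschitz_limit P L tbar x0 : 0 <= L -> (forall n t, t <= tbar -> P n t = x0) ->
  (forall n s t, `|P n s - P n t| <= L * (`|s - t| + n.+1%:R^-1)) ->
  exists h, [/\ lipschitzT L h, forall t, t <= tbar -> h t = x0 &
    forall s t e, 0 < e -> exists n, [/\ n.+1%:R^-1 < e, `|P n s - h s| < e & `|P n t - h t| < e]].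
Proof.
move=> L0 P0 PL.
have [U [UU sU]] := ultraFilterLemma (F := \oo) _.
have FU : ProperFilter U by exact: ultra_proper.
have lim t : exists y, P n t @[n --> U] --> y.
  pose B := L * (`|t - tbar| + 1).
  have UP : UltraFilter (P n t @[n --> U]).
    split; first exact: fmap_proper_filter.
    move=> G GF sG; apply/seteqP; split=> // A GA.
    have [//|UnA] := in_ultra_setVsetC (P^~ t @^-1` A) UU.
    have /sG GnA : (P n t @[n --> U]) (~` A) by [].
    by have [y []] := filter_ex (filterI GA GnA).
  have cB : compact `[x0 - B, x0 + B]%classic by exact: segment_compact.
  rewrite compact_ultra in cB; have [|y [_ yP]] := cB (P n t @[n --> U]) _; last by exists y.
  rewrite /fmap/= /nbhs/=; apply: (filterS _ (filterT (F := U))) => n _ /=; rewrite in_itv/=.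
  have := PL n t tbar; rewrite (P0 n tbar)// ler_distl => H.
  have n1 : n.+1%:R^-1 <= 1 :> R by rewrite invf_le1 ?ler1n.
  have : L * (`|t - tbar| + n.+1%:R^-1) <= B by rewrite ler_wpM2l// lerD2l.
  move: H; set d := L * (_ + _); clearbody d B => /andP[H1 H2] H3.
  by apply/andP; split; lra.
have [h hP] := choice lim.
have close t e : 0 < e -> \forall n \near U, `|P n t - h t| < e.
  by move=> e0; have /cvgrPdist_lt/(_ _ e0) := hP t; apply: filterS => n; rewrite distrC.
have small e : 0 < e -> \forall n \near U, n.+1%:R^-1 < e.
  by move=> e0; apply: sU; exact: near_infty_natSinv_lt (PosNum e0).
have approx s t e : 0 < e ->
    exists n, [/\ n.+1%:R^-1 < e, `|P n s - h s| < e & `|P n t - h t| < e].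
  move=> e0; have H : \forall n \near U, [/\ n.+1%:R^-1 < e, `|P n s - h s| < e & `|P n t - h t| < e].
    by apply: filterS3 (small _ e0) (close s e e0) (close t e e0) => n; split.
  exact: filter_ex H.
exists h; split => //.
- move=> s t; apply/ler_addgt0Pr => e e0.
  have L2 : 0 < 2 + L by lra.
  have e20 : 0 < e / (2 + L) by rewrite divr_gt0.
  have [n [n1 n2 n3]] := approx s t _ e20.
  have -> : h s - h t = - (P n s - h s) + (P n s - P n t) + (P n t - h t) by ring.
  apply: le_trans (ler_normD _ _) _; apply: (le_trans (lerD (ler_normD _ _) (lexx _))).
  have le3 : L * (`|s - t| + n.+1%:R^-1) <= L * (`|s - t| + e / (2 + L)).
    by rewrite ler_wpM2l// lerD2l ltW.
  have -> : L * `|s - t| + e =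
      e / (2 + L) + L * (`|s - t| + e / (2 + L)) + e / (2 + L) by field; rewrite gt_eqF.
  by rewrite normrN !lerD ?(ltW n2) ?(ltW n3)// (le_trans (PL n s t)).
- move=> t tt; apply/eqP; rewrite -subr_eq0 -normr_eq0 eq_le normr_ge0 andbT.
  apply/ler_addgt0Pr => e e0; rewrite add0r.
  by have [n [_ + _]] := approx t t e e0; rewrite P0// distrC => /ltW.
Qed.

(* Integrated form of the condition that the velocity of [h] lies in the interval
   of the essential values of [W] near the graph of [h]. *)
Definition filippov W L tbar h :=
  forall a b delta sigma c m, tbar <= a -> a < b -> 4 * (L + 1) * (b - a) < delta -> `|sigma| = 1 ->
    measurable_fun setT m -> (forall s, 0 <= m s) ->
    {ae mu, forall s, a < s <= b -> {ae mu, forall y, `|y - h s| < delta -> sigma * W (s, y) <= c + m s}} ->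
    ((sigma * (h b - h a) - c * (b - a))%:E <= \int[mu]_(s in `]a, b]) (m s)%:E)%E.

Section Euler.
Variables (W : R * R -> R) (L tbar x0 : R).
Hypotheses (mW : measurable_fun setT W) (WL : forall z, `|W z| <= L).

Fixpoint euler tau k : R :=
  if k is j.+1 then euler tau j + average_step W L tau (tbar + j%:R * tau) (euler tau j) else x0.

(** Truncation sends negative numbers to 0, so the scheme stays at [x0] before [tbar]. *)
Definition euler_index tau t : nat := Num.truncn ((t - tbar) / tau).

Let L_ge0 : 0 <= L. Proof. by apply: le_trans (WL (0, 0)). Qed.

Lemma euler_dist tau i n : 0 < tau -> `|euler tau (i + n) - euler tau i| <= L * (n%:R * tau).
Proof.
move=> tau0; elim: n => [|n IH]; first by rewrite addn0 subrr normr0 mul0r mulr0.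
rewrite addnS /= addrAC; apply: le_trans (ler_normD _ _) _.
have := average_step_bound (tbar + (i + n)%:R * tau) (euler tau (i + n)) mW WL tau0.
have -> : L * (n.+1%:R * tau) = L * (n%:R * tau) + L * tau by rewrite -natr1; ring.
by move=> ?; exact: lerD.
Qed.

Lemma euler_index_le tau t : 0 < tau -> tbar <= t -> (euler_index tau t)%:R * tau <= t - tbar.
Proof.
move=> tau0 tt; rewrite -ler_pdivlMr// /euler_index truncn_le//.
by rewrite divr_ge0 ?subr_ge0// ltW.
Qed.

Lemma euler_index_gt tau t : 0 < tau -> t - tbar < (euler_index tau t).+1%:R * tau.
Proof. by move=> tau0; rewrite -ltr_pdivrMr//; exact: truncnS_gt. Qed.

Lemma euler_index0 tau t : 0 < tau -> t <= tbar -> euler_index tau t = 0%N.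
Proof.
move=> tau0 tt; have : (t - tbar) / tau <= 0 by rewrite ler_pdivrMr// mul0r subr_le0.
by move=> H; apply/truncn0Pn; rewrite -ltNge (le_lt_trans H).
Qed.

Lemma euler_index_mono tau s t : 0 < tau -> s <= t -> (euler_index tau s <= euler_index tau t)%N.
Proof. by move=> tau0 st; apply: le_truncn; rewrite ler_pM2r ?invr_gt0// lerD2r. Qed.

Lemma euler_polygon_dist tau s t : 0 < tau ->
  `|euler tau (euler_index tau s) - euler tau (euler_index tau t)| <= L * (`|s - t| + tau).
Proof.
move=> tau0; wlog st : s t / s <= t.
  by move=> H; have [/H//|/ltW/H] := leP s t; rewrite distrC (distrC t).
rewrite distrC (distrC s) (ger0_norm (_ : 0 <= t - s)) ?subr_ge0//.
have [tt|tt] := leP t tbar.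
  rewrite !euler_index0// ?(le_trans st)// subrr normr0 mulr_ge0// addr_ge0 ?subr_ge0// ltW//.
have ij := euler_index_mono tau0 st.
rewrite -(subnKC ij); apply: le_trans (euler_dist _ _ tau0) _.
rewrite ler_wpM2l// natrB// mulrBl.
have := euler_index_le tau0 (ltW tt); have := euler_index_gt s tau0; rewrite -natr1; lra.
Qed.

Lemma euler_sum tau sigma c m i n : 0 < tau -> `|sigma| = 1 ->
  measurable_fun setT m -> (forall s, 0 <= m s) ->
  (forall k, (k < n)%N ->
    {ae mu, forall s, tbar + (i + k)%:R * tau < s <= tbar + (i + k)%:R * tau + tau ->
    {ae mu, forall y, euler tau (i + k) < y <= euler tau (i + k) + tau -> sigma * W (s, y) <= c + m s}}) ->
  ((sigma * (euler tau (i + n) - euler tau i) - c * (n%:R * tau))%:E <=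
   \int[mu]_(s in `](tbar + i%:R * tau)%R, (tbar + (i + n)%:R * tau)%R]) (m s)%:E)%E.
Proof.
move=> tau0 s1 mm m0; elim: n => [|n IH] H.
  rewrite addn0 subrr mulr0 mul0r mulr0 subrr integral_ge0// => s _; by rewrite lee_fin.
have {}IH := IH (fun k kn => H k (ltnW kn)).
have step := average_stepP mW WL tau0 s1 mm m0 (H n (ltnSn n)).
have E : tbar + (i + n)%:R * tau + tau = tbar + (i + n.+1)%:R * tau by rewrite addnS -natr1; ring.
have le1 : tbar + i%:R * tau <= tbar + (i + n)%:R * tau by rewrite lerD2l ler_pM2r// ler_nat leq_addr.
have le2 : tbar + (i + n)%:R * tau <= tbar + (i + n.+1)%:R * tau by rewrite -E lerDl ltW.
rewrite (@itv_bndbnd_setU _ _ _ (BRight (tbar + (i + n)%:R * tau)))//.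
rewrite ge0_integral_setU//; last 3 first.
- by apply: measurable_funTS; have /measurable_EFinP := mm.
- by move=> s _; rewrite lee_fin.
- apply/disj_setPS => s []/=; rewrite !in_itv/= => /andP[_ s2] /andP[/lt_le_trans/(_ s2)].
  by rewrite ltxx.
have := leeD IH step; rewrite E -EFinD; apply: le_trans; rewrite lee_fin le_eqVlt; apply/orP; left; apply/eqP.
by rewrite addnS /= -natr1; ring.
Qed.

Let telescope4 (y1 y2 y3 y4 y5 : R) : y1 - y5 = (y1 - y2) + (y2 - y3) + (y3 - y4) + (y4 - y5).
Proof. by ring. Qed.

Let euler_distance_lt (K T d B D l1 l2 l3 l4 : R) : l1 <= T -> l2 <= K * B -> l3 <= K * T + d ->
  l4 <= K * B -> K * T <= K * B -> T <= B / 2 -> d <= B / 2 -> 0 <= K * B -> 0 < B / 2 -> 4 * (K + 1) * B < D ->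
  l1 + l2 + l3 + l4 < D.
Proof. by rewrite mulrDr mulr1 mulrDl -mulrA; lra. Qed.

Let euler_increment_close (K s d T e x y A X Y p q : R) : `|s| = 1 -> T <= d -> 0 <= T ->
  `|X - x| <= K * T + d -> `|Y - y| <= d -> p - 2 * T <= q -> q <= p + 2 * T ->
  d <= e / (2 + K + 2 * `|A|) -> 0 < 2 + K + 2 * `|A| -> 0 <= K ->
  s * (y - x) - A * p - (s * (Y - X) - A * q) <= e.
Proof.
move=> s1 Td T0 Xx Yy pq1 pq2 + E0 K0; rewrite ler_pdivlMr// => de.
have sle z : `|s * z| = `|z| by rewrite normrM s1 mul1r.
have := ler_norm (s * (y - Y)); rewrite sle distrC => H1.
have := ler_norm (s * (X - x)); rewrite sle => H2.
have := ler_norm (- A * (p - q)); rewrite normrM normrN => H3.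
have H4 : `|p - q| <= 2 * T by rewrite ler_norml; apply/andP; split; lra.
have H5 : `|A| * `|p - q| <= `|A| * (2 * T) by rewrite ler_wpM2l.
have H7 : T * (2 * `|A| + K) <= d * (2 * `|A| + K) by rewrite ler_wpM2r//; have := normr_ge0 A; lra.
have -> : s * (y - x) - A * p - (s * (Y - X) - A * q) =
  s * (y - Y) + s * (X - x) + - A * (p - q) by ring.
have H8 : d * (2 + K + 2 * `|A|) = d * 2 + d * (2 * `|A| + K) by ring.
have H9 : T * (2 * `|A| + K) = `|A| * (2 * T) + K * T by ring.
lra.
Qed.

(** Between the times [a] and [b], the scheme and its limit [h] each move by at most [L * (b - a)],
    up to the mesh, so the averaging squares stay within [delta] of [h] when
    [4 * (L + 1) * (b - a) < delta]. The bounds on the steps are then summed and passed to the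
    limit. *)
Lemma filippov_exists : exists h,
  [/\ lipschitzT L h, forall t, t <= tbar -> h t = x0 & filippov W L tbar h].
Proof.
pose tau (n : nat) : R := n.+1%:R^-1.
have tau0 n : 0 < tau n by rewrite invr_gt0.
pose P n t := euler (tau n) (euler_index (tau n) t).
have P0 n t : t <= tbar -> P n t = x0 by move=> tt; rewrite /P euler_index0.
have PL n s t : `|P n s - P n t| <= L * (`|s - t| + tau n) by exact: euler_polygon_dist.
have [h [hL hx0 approx]] := equilipschitz_limit L_ge0 P0 PL.
exists h; split => // a b delta sigma c m ta ab small s1 mm m0 Hae.
apply/lee_addgt0Pr => e e0.
(* Total weight of the discretization errors: two errors of the limit at the endpoints, one step of
   the scheme, and a mismatch of two meshes weighted by [|c|]. *)
pose E : R := 2 + L + 2 * `|c|.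
have E0 : 0 < E by rewrite /E; have := normr_ge0 c; have := L_ge0; lra.
have ba0 : 0 < (b - a) / 2 by lra.
have eE0 : 0 < e / E by rewrite divr_gt0.
have [d [d0 dba deE]] := min_spec ba0 eE0.
have [n [n1 na nb]] := approx a b d d0.
pose T : R := tau n; have T0 : 0 < T by exact: tau0.
have {}n1 : T < d by exact: n1.
have Tba : T <= (b - a) / 2 by exact: le_trans (ltW n1) dba.
have LB : 0 <= L * (b - a) by rewrite mulr_ge0// subr_ge0 ltW.
have LT : L * T <= L * (b - a) by rewrite ler_wpM2l//; lra.
(* The first grid index after [a] and the last one up to [b]: the steps from [i] to [j] use times in
   []a, b]] only. *)
pose i := (euler_index T a).+1; pose j := euler_index T b.
have ia := euler_index_gt a T0; rewrite -/i in ia.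
have ia' := euler_index_le T0 ta.
have jb := euler_index_le T0 (le_trans ta (ltW ab)); rewrite -/j in jb.
have jb' := euler_index_gt b T0; rewrite -/j in jb'.
have iT : i%:R * T = (euler_index T a)%:R * T + T by rewrite /i -natr1; ring.
have jT : j.+1%:R * T = j%:R * T + T by rewrite -natr1; ring.
rewrite jT in jb'.
have ia3 : i%:R * T <= a - tbar + T by rewrite iT lerD2r.
have ia2 : a < tbar + i%:R * T by rewrite -ltrBlDl.
have jb2 : tbar + j%:R * T <= b by rewrite -lerBrDl.
have ij : (i <= j)%N.
  rewrite -(ler_nat R) -(ler_pM2r T0) iT; lra.
have Pa : `|euler T i - h a| <= L * T + d.
  have -> : euler T i - h a = (euler T i - P n a) + (P n a - h a) by ring.
  apply: le_trans (ler_normD _ _) _; apply: lerD; last exact: ltW.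
  by have := euler_dist (euler_index T a) 1 T0; rewrite addn1 mul1r.
have := @euler_sum T sigma c m i (j - i) T0 s1 mm m0.
rewrite subnKC// => /(_ _)/wrap[k kn|H].
  have ijk : ((i + k).+1 <= j)%N by rewrite -ltn_subRL.
  have ijkR : (i + k)%:R * T + T <= j%:R * T.
    have -> : (i + k)%:R * T + T = (i + k).+1%:R * T by rewrite -natr1; ring.
    by rewrite ler_pM2r// ler_nat.
  have iikR : i%:R * T <= (i + k)%:R * T by rewrite ler_pM2r// ler_nat leq_addr.
  apply: ae_imp Hae _ => s Hs /andP[s1' s2']; have sI : a < s <= b by apply/andP; split; lra.
  apply: ae_imp (Hs sI) _ => y Hy yI; apply: Hy.
  have X1 : `|euler T (i + k) - euler T i| <= L * (b - a).
    apply: le_trans (euler_dist _ _ T0) _; rewrite ler_wpM2l ?L_ge0//.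
    by move: iikR ijkR; rewrite natrD mulrDl; lra.
  have X2 : `|h a - h s| <= L * (b - a).
    have /andP[sa sb] := sI; apply: le_trans (hL a s) _.
    by rewrite ler_wpM2l// distrC ger0_norm ?lerD2r// subr_ge0 ltW.
  rewrite (telescope4 y (euler T (i + k)) (euler T i) (h a)).
  have X3 : `|y - euler T (i + k)| <= T by rewrite ger0_norm; case/andP: yI; rewrite ?subr_ge0 ?lerBlDl// => /ltW.
  apply: le_lt_trans (ler_normD _ _) _.
  apply: le_lt_trans (lerD (ler_normD _ _) (lexx _)) _.
  apply: le_lt_trans (lerD (lerD (ler_normD _ _) (lexx _)) (lexx _)) _.
  exact: euler_distance_lt X3 X1 Pa X2 LT Tba dba LB ba0 small.
have {H} : ((sigma * (euler T j - euler T i) - c * (j%:R * T - i%:R * T))%:E <=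
    \int[mu]_(s in `]a, b]) (m s)%:E)%E.
  rewrite -mulrBl -natrB//; apply: le_trans H _.
  apply: ge0_subset_integral => //.
  - by apply: measurable_funTS; have /measurable_EFinP := mm.
  - by move=> s _; rewrite lee_fin.
  - move=> s; rewrite /= !in_itv/= => /andP[/(lt_trans ia2) -> /le_trans]; exact.
move=> H; apply: le_trans (leeD H (lexx _)); rewrite -EFinD lee_fin.
rewrite -lerBlDl; apply: (euler_increment_close s1 (ltW n1) (ltW T0) Pa (ltW nb) _ _ deE E0 L_ge0).
- by move: ia3 jb'; rewrite -/T; move: (i%:R * T) (j%:R * T) => u v; lra.
- by move: ia2 jb2 T0; rewrite -/T; move: (i%:R * T) (j%:R * T) => u v; lra.
Qed.

End Euler.
End Trajectories.

(** * Speed of the path at trace points *)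

Section VelocityAtTracePoints.
Context {R : realType}.
Local Notation mu := (@lebesgue_measure R).
Implicit Types (h v V psi : R -> R) (u : R * R -> R) (a b c d e r s t x y K B sigma delta tbar : R).

Lemma derive_right_le h t d c r0 : is_derive t (1 : R) h d -> 0 < r0 ->
  (forall r, 0 < r -> r < r0 -> h (t + r) - h t <= c * r) -> d <= c.
Proof.
move=> dh r00 H; apply/ler_addgt0Pr => e e0.
have cvgh : r^-1 *: ((h \o shift t) (r *: (1 : R)) - h t) @[r --> 0^'] --> d.
  by have := @ex_derive _ _ _ _ _ _ _ dh; rewrite -(@derive_val _ _ _ _ _ _ _ dh).
have /cvgrPdist_lt/(_ _ e0)[/= r1 r10 r1P] := cvgh.
have [r2 [r20 r21 r22]] := min_spec r00 r10.
have := r1P (r2 / 2); rewrite /ball_/= sub0r normrN.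
have -> : `|r2 / 2| = r2 / 2 by rewrite ger0_norm; lra.
have r2n : r2 / 2 != 0 by rewrite gt_eqF; lra.
have r3 : r2 / 2 < r1 by lra.
move=> /(_ r3 r2n); rewrite /GRing.scale/= mulr1 (addrC _ t) ltr_distl => /andP[H1 H2].
have r4 : 0 < r2 / 2 by lra.
have r5 : r2 / 2 < r0 by lra.
have := H _ r4 r5; rewrite -ler_pdivrMr// mulrC => H3; lra.
Qed.

Lemma ae_neq x : {ae mu, forall y, y != x}.
Proof.
exists [set x]; split; [exact: measurable_set1|exact: lebesgue_measure_set1|].
by move=> y /= /negP; rewrite negbK => /eqP.
Qed.

Lemma le_integral_ocitv_add (p1 p2 : R -> R) K a b c d E : 0 <= K ->
  measurable_fun setT p1 -> measurable_fun setT p2 -> (forall s, 0 <= p1 s) -> (forall s, 0 <= p2 s) ->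
  (\int[mu]_(s in `]c, d[) (p1 s)%:E <= E%:E)%E -> (\int[mu]_(s in `]c, d[) (p2 s)%:E <= E%:E)%E ->
  c <= a -> b < d ->
  (\int[mu]_(s in `]a, b]) (K * (p1 s + p2 s))%:E <= (2 * K * E)%:E)%E.
Proof.
move=> K0 mp1 mp2 p10 p20 I1 I2 ca bd.
have sub (p : R -> R) : measurable_fun setT p -> (forall s, 0 <= p s) ->
    (\int[mu]_(s in `]c, d[) (p s)%:E <= E%:E)%E -> (\int[mu]_(s in `]a, b]) (p s)%:E <= E%:E)%E.
  move=> mp p0; apply: le_trans; apply: ge0_subset_integral => //.
  - by apply: measurable_funTS; have /measurable_EFinP := mp.
  - by move=> s _; rewrite lee_fin.
  - by move=> s; rewrite /= !in_itv/= => /andP[/(le_lt_trans ca) -> /le_lt_trans]; exact.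
under eq_integral do rewrite EFinM EFinD.
rewrite ge0_integralZl//; last 2 first.
- apply: measurable_funTS; apply: emeasurable_funD.
    by have /measurable_EFinP := mp1.
  by have /measurable_EFinP := mp2.
- by move=> s _; rewrite adde_ge0// lee_fin.
rewrite ge0_integralD//; last 4 first.
- by move=> s _; rewrite lee_fin.
- by apply: measurable_funTS; have /measurable_EFinP := mp1.
- by move=> s _; rewrite lee_fin.
- by apply: measurable_funTS; have /measurable_EFinP := mp2.
have -> : 2 * K * E = K * (E + E) by ring.
by rewrite EFinM EFinD; apply: lee_wpmul2l; rewrite ?lee_fin//; apply: leeD; exact: sub.
Qed.

(** Near the path, and off the null set of its own points, the field is within [K * p1] of [V um] on
    the left and within [K * p2] of [V up] on the right. The integrated condition with
    [m = K * (p1 + p2)] bounds the increments of the path after [t]. *)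
Lemma filippov_velocity_le u V K B h tbar t sigma um up d : 0 <= tbar -> tbar <= t -> 0 < K ->
  0 <= B -> `|sigma| = 1 -> (forall x y, `|V x - V y| <= K * `|x - y|) ->
  filippov (fun z => V ((u \_ half_plane) z)) B tbar h -> is_derive t (1 : R) h d ->
  trace_point u h (- 1) t um -> trace_point u h 1 t up ->
  sigma * d <= Num.max (sigma * V um) (sigma * V up).
Proof.
move=> tb0 tt K0 B0 s1 VK hW dh tm tp; set c := Num.max _ _.
have sV x y : sigma * V x <= sigma * V y + K * `|x - y|.
  rewrite -lerBlDl -mulrBr; apply: le_trans (ler_norm _) _.
  by rewrite normrM s1 mul1r.
apply/ler_addgt0Pr => e e0.
(* Two errors multiplied by [K] and integrated with radius [2 * r] then add up to [e * r]. *)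
have e40 : 0 < e / (4 * K) by rewrite divr_gt0// mulr_gt0.
have [d1 [p1 [d10 mp1 p10 up1 Ip1]]] := tm _ e40.
have [d2 [p2 [d20 mp2 p20 up2 Ip2]]] := tp _ e40.
have [d3 [d30 d31 d32]] := min_spec d10 d20.
pose C : R := 4 * (B + 1).
have C0 : 0 < C by rewrite /C; lra.
have d4 : 0 < d3 / (2 * (C + 1)) by rewrite divr_gt0//; lra.
have dsh : is_derive t (1 : R) (fun x => sigma * h x) (sigma * d).
  by derive_eq; ring.
apply: (derive_right_le dsh d4) => r r0 rd.
have {rd} [rC r2d] : C * r < d3 /\ 2 * r < d3.
  have : r * (2 * (C + 1)) < d3 by rewrite -ltr_pdivlMr//; lra.
  have : 0 < C * r by rewrite mulr_gt0.
  lra.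
pose m s := K * (p1 s + p2 s).
have mm : measurable_fun setT m.
  by apply: measurable_funM; [exact: measurable_cst|exact: measurable_funD].
have m0 s : 0 <= m s by rewrite /m mulr_ge0 ?addr_ge0// ltW.
have trt : t < t + r by rewrite ltrDl.
have small : 4 * (B + 1) * (t + r - t) < d3 by rewrite (addrC t) addrK.
have := hW t (t + r) d3 sigma c m tt trt small s1 mm m0.
move=> /(_ _)/wrap[|H].
  apply: ae_imp2 up1 up2 _ => s us1 us2 /andP[s1' s2].
  have sd1 : `|s - t| < d1 by rewrite gtr0_norm ?subr_gt0//; lra.
  have sd2 : `|s - t| < d2 by rewrite gtr0_norm ?subr_gt0//; lra.
  apply: ae_imp3 (us1 sd1) (us2 sd2) (ae_neq (h s)) _ => y uy1 uy2 yh yd.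
  rewrite patchE mem_set; last by rewrite /half_plane/=; lra.
  have [yh'|yh'|yE] := ltgtP y (h s); last by rewrite yE eqxx in yh.
  - have y1 : 0 < -1 * (y - h s) < d1.
      by rewrite mulN1r oppr_gt0 subr_lt0 yh' (le_lt_trans (ler_norm _))// normrN (lt_le_trans yd).
    apply: le_trans (sV _ um) _; rewrite /m mulrDr addrA; apply: (@le_trans _ _ (c + K * p1 s)).
      by rewrite lerD//; [rewrite /c le_max lexx|rewrite ler_wpM2l ?uy1// ltW].
    by rewrite lerDl mulr_ge0// ltW.
  - have y2 : 0 < 1 * (y - h s) < d2.
      by rewrite mul1r subr_gt0 yh' (le_lt_trans (ler_norm _))// (lt_le_trans yd).
    apply: le_trans (sV _ up) _; rewrite /m mulrDr [X in _ <= _ + X]addrC addrA.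
    apply: (@le_trans _ _ (c + K * p2 s)).
      by rewrite lerD//; [rewrite /c le_max lexx orbT|rewrite ler_wpM2l ?uy2// ltW].
    by rewrite lerDl mulr_ge0// ltW.
have r20 : 0 < 2 * r by lra.
have r2d1 : 2 * r < d1 by lra.
have r2d2 : 2 * r < d2 by lra.
have Im := le_integral_ocitv_add (ltW K0) mp1 mp2 p10 p20 (Ip1 _ r20 r2d1) (Ip2 _ r20 r2d2)
  (_ : t - 2 * r <= t) (_ : t + r < t + 2 * r).
have {}Im : (\int[mu]_(s in `]t, (t + r)%R]) (m s)%:E <= (e * r)%:E)%E.
  have -> : e * r = 2 * K * (e / (4 * K) * (2 * r)) by field; rewrite gt_eqF.
  by apply: Im; [rewrite gerBl ltW|rewrite ltrD2l ltr_pMl// ltr1n].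
have := le_trans H Im; rewrite lee_fin (addrC t r) addrK; lra.
Qed.

Lemma filippov_velocity u V K B h tbar t um up d : 0 <= tbar -> tbar <= t -> 0 < K ->
  0 <= B -> (forall x y, `|V x - V y| <= K * `|x - y|) ->
  filippov (fun z => V ((u \_ half_plane) z)) B tbar h -> is_derive t (1 : R) h d ->
  trace_point u h (- 1) t um -> trace_point u h 1 t up ->
  Num.min (V um) (V up) <= d <= Num.max (V um) (V up).
Proof.
move=> tb0 tt K0 B0 VK hW dh tm tp; apply/andP; split.
  have := filippov_velocity_le (sigma := -1) tb0 tt K0 B0 (normrN1 _) VK hW dh tm tp.
  by rewrite !mulN1r -oppr_min lerN2.
have := filippov_velocity_le tb0 tt K0 B0 (normr1 _) VK hW dh tm tp.
by rewrite !mul1r.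
Qed.

End VelocityAtTracePoints.

(** * Jump conditions along a Lipschitz path *)

Section BoundedIntegrals.
Context {R : realType}.
Local Notation mu := (@lebesgue_measure R).
Implicit Types (f g : R -> R) (a b c d l w x y B G : R).

Lemma ae_le_Rintegral_ocitvD f g B c a b : measurable_fun setT f -> measurable_fun setT g ->
  (forall x, `|f x| <= B) -> (forall x, `|g x| <= B) -> a <= b ->
  {ae mu, forall x, a < x <= b -> f x <= g x + c} ->
  \int[mu]_(x in `]a, b]) f x <= \int[mu]_(x in `]a, b]) g x + c * (b - a).
Proof.
move=> mf mg fB gB ab fg.
have mfg : measurable_fun setT (fun x => f x - g x) by exact: measurable_funB.
have fgB x : `|f x - g x| <= B + B.
  by apply: le_trans (ler_normB _ _) _; exact: lerD.
have := @ae_le_Rintegral_ocitv _ _ (fun=> 0) (B + B) c a b mfg fgB _ _ ab _.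
rewrite integral0 lee_fin => /(_ _ _ _)/wrap[|//||H].
- exact: measurable_cst.
- by apply: ae_imp fg _ => x fgx xab; have := fgx xab; lra.
have mI : measurable (`]a, b]%classic : set R) by exact: measurable_itv.
have If : mu.-integrable `]a, b]%classic (EFin \o f) := bounded_integrable_ocitv _ _ mf fB.
have Ig : mu.-integrable `]a, b]%classic (EFin \o g) := bounded_integrable_ocitv _ _ mg gB.
by move: H; rewrite RintegralB//; lra.
Qed.

Lemma Rintegral_ocitv_split f B a b c d : measurable_fun setT f -> (forall x, `|f x| <= B) ->
  a <= b -> b <= c -> c <= d ->
  \int[mu]_(x in `]a, d]) f x = \int[mu]_(x in `]a, b]) f x + \int[mu]_(x in `]b, c]) f x +
    \int[mu]_(x in `]c, d]) f x.
Proof.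
move=> mf fB ab bc cd.
have I x y : mu.-integrable `]x, y]%classic (EFin \o f) := bounded_integrable_ocitv _ _ mf fB.
have H x y z : x <= y -> y <= z ->
    \int[mu]_(t in `]x, z]) f t = \int[mu]_(t in `]x, y]) f t + \int[mu]_(t in `]y, z]) f t.
  by move=> xy yz; rewrite -(@Rintegral_itvB _ f (BRight x) (BRight z) y (I _ _)) ?bnd_simp// addrC subrK.
by rewrite (H a c d) ?(le_trans ab)// (H a b c).
Qed.

Lemma Rintegral_support f a b : (forall x, ~ (a < x <= b) -> f x = 0) ->
  \int[mu]_x f x = \int[mu]_(x in `]a, b]) f x.
Proof.
move=> f0; rewrite [RHS]Rintegral_mkcond; congr (Rintegral _ _ _); apply/funext => x.
rewrite patchE; case: ifPn => //; rewrite notin_setE/= in_itv/=; exact: f0.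
Qed.

Lemma hump_Rintegral l w a b : 0 < w -> a < b ->
  \int[mu]_(x in `]a, b]) (w^-1 * dhump ((x - l) / w)) = hump ((b - l) / w) - hump ((a - l) / w).
Proof.
move=> w0 ab; pose F x := hump ((x - l) / w); pose f x := w^-1 * dhump ((x - l) / w).
have cF x : is_derive x (1 : R) F (f x).
  have d1 : is_derive x (1 : R) (fun y : R => (y - l) / w) (w^-1) by derive_eq; ring.
  have := is_derive_compf (f := hump) (g := fun y : R => (y - l) / w) (is_derive_hump _) d1.
  by move=> d2; apply: (is_derive_eq d2); rewrite /f mulrC.
have cf : continuous f.
  move=> x; apply: cvgM; first exact: cvg_cst.
  apply: (@continuous_comp _ _ _ (fun x => (x - l) / w) dhump); last exact: continuous_dhump.
  by apply: cvgM; [apply: cvgB; [exact: cvg_id|exact: cvg_cst]|exact: cvg_cst].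
have cF' : continuous F by move=> x; exact: is_derive_continuous (cF x).
have H := @continuous_FTC2 _ f F a b ab.
rewrite (_ : \int[mu]_(x in `]a, b]) _ = \int[mu]_(x in `[a, b]) f x).
  rewrite /Rintegral H ?EFinB//.
  - exact: continuous_subspaceT.
  - split.
    + by move=> x _; exact: ex_derive.
    + exact: cvg_at_right_filter (cF' a).
    + exact: cvg_at_left_filter (cF' b).
  - by move=> x _; rewrite derive1E derive_val.
rewrite Rintegral_itv_obnd_cbnd//.
have If : mu.-integrable `[a, b]%classic (EFin \o f).
  by apply: continuous_compact_integrable; [exact: segment_compact|exact: continuous_subspaceT].
by apply: integrableS If => // x /=; rewrite !in_itv/= => /andP[/ltW ->].
Qed.

(* Integral over [(l - w, l + w]] of a function that is close to
   [beta D w^-1 dhump ((x - l) / w)] for a jump of [D] at [l], except near [l]. *)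
Lemma slice_le f B l w theta beta Dm Dp c1 c2 : measurable_fun setT f -> (forall x, `|f x| <= B) ->
  0 < w -> 0 < theta < 1 ->
  {ae mu, forall x, l - w < x <= l - theta * w ->
     f x <= beta * Dm * (w^-1 * dhump ((x - l) / w)) + c1} ->
  {ae mu, forall x, l - theta * w < x <= l + theta * w -> f x <= c2} ->
  {ae mu, forall x, l + theta * w < x <= l + w ->
     f x <= beta * Dp * (w^-1 * dhump ((x - l) / w)) + c1} ->
  0 <= c1 -> 
  \int[mu]_(x in `]l - w, l + w]) f x <=
    - (beta * hump theta * (Dp - Dm)) + 2 * w * c1 + 2 * theta * w * c2.
Proof.
move=> mf fB w0 /andP[th0 th1] fl fm fr c10.
have tw : theta * w < w by rewrite gtr_pMl.
have tw0 : 0 < theta * w by rewrite mulr_gt0.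
pose k x := w^-1 * dhump ((x - l) / w).
have mk : measurable_fun setT k.
  apply: measurable_funM; first exact: measurable_cst.
  apply: (@measurableT_comp _ _ _ _ _ _ dhump).
    by apply: continuous_measurable_fun; exact: continuous_dhump.
  by apply: measurable_funM; [apply: measurable_funB|exact: measurable_cst].
have [K [_ [K0 _ _ dK _]]] := @hump_bounds R.
have kB x : `|k x| <= w^-1 * K by rewrite normrM normfV (gtr0_norm w0) ler_wpM2l// invr_ge0 ltW.
have kI c a b : a < b -> \int[mu]_(x in `]a, b]) (c * k x) =
    c * (hump ((b - l) / w) - hump ((a - l) / w)).
  by move=> ab; rewrite RintegralZl//; [rewrite hump_Rintegral|exact: bounded_integrable_ocitv mk kB].
have piece a b c : a < b -> {ae mu, forall x, a < x <= b -> f x <= c * k x + c1} ->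
    \int[mu]_(x in `]a, b]) f x <= c * (hump ((b - l) / w) - hump ((a - l) / w)) + c1 * (b - a).
  move=> ab H; rewrite -(kI c a b ab).
  apply: (@ae_le_Rintegral_ocitvD _ _ (B + `|c| * (w^-1 * K))) => //.
  - by apply: measurable_funM => //; exact: measurable_cst.
  - move=> x; apply: le_trans (fB x) _; rewrite lerDl mulr_ge0// mulr_ge0 ?invr_ge0// ltW//.
  - move=> x; rewrite normrM; apply: le_trans (ler_wpM2l (normr_ge0 c) (kB x)) _.
    by rewrite lerDr; exact: le_trans (fB 0).
  - exact: ltW.
rewrite (@Rintegral_ocitv_split f B (l - w) (l - theta * w) (l + theta * w) (l + w) mf fB); try lra.
have Il := @piece (l - w) (l - theta * w) (beta * Dm) _ fl.
have Ir := @piece (l + theta * w) (l + w) (beta * Dp) _ fr.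
have Im : \int[mu]_(x in `]l - theta * w, l + theta * w]) f x <= c2 * (2 * (theta * w)).
  have := @ae_le_Rintegral_ocitvD f (fun=> 0) B c2 (l - theta * w) (l + theta * w) mf.
  rewrite /= => /(_ _ fB _ _ _)/wrap[||||].
  - exact: measurable_cst.
  - by move=> x; rewrite normr0; exact: le_trans (fB 0).
  - lra.
  - by apply: ae_imp fm _ => x; rewrite add0r.
  move=> H; apply: le_trans H _; rewrite (_ : (fun _ => 0) = cst 0)// Rintegral_cst; last exact: measurable_itv.
  rewrite mul0r add0r le_eqVlt; apply/orP; left; apply/eqP; ring.
have E1 : (l - theta * w - l) / w = - theta by field; rewrite gt_eqF.
have E2 : (l - w - l) / w = - 1 by field; rewrite gt_eqF.
have E3 : (l + theta * w - l) / w = theta by field; rewrite gt_eqF.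
have E4 : (l + w - l) / w = 1 by field; rewrite gt_eqF.
have b1 : hump 1 = 0 :> R by rewrite hump_out// normr1.
have l1 : l - w < l - theta * w by lra.
have l2 : l + theta * w < l + w by lra.
(* The hump is even and vanishes at the ends: up to the factor [beta], the left piece contributes
   [hump theta * Dm] and the right one [- hump theta * Dp]. *)
move: (Il l1) (Ir l2); rewrite E1 E2 E3 E4 !humpN b1 subr0 sub0r => {}Il {}Ir.
apply: le_trans (lerD (lerD Il Im) Ir) _.
have H : 0 <= c1 * (2 * (theta * w)) by rewrite !mulr_ge0// ltW.
rewrite -subr_ge0; apply: le_trans H _; rewrite le_eqVlt; apply/orP; left; apply/eqP; ring.
Qed.

Lemma bounded_support_fubini (g : R * R -> R) G a b c d : measurable_fun setT g ->
  (forall z, `|g z| <= G) -> a <= b -> c <= d ->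
  (forall z, ~ ((a < z.1 <= b) /\ (c < z.2 <= d)) -> g z = 0) ->
  let H t := \int[mu]_x g (t, x) in
  [/\ measurable_fun setT H, forall t, `|H t| <= G * (d - c) &
      \int[plane_measure]_z g z = \int[mu]_(t in `]a, b]) H t].
Proof.
move=> mg gG ab cd g0 H.
have mX : measurable (`]a, b]%classic `*` `]c, d]%classic : set (R * R)).
  by apply: measurableX; exact: measurable_itv.
have IX : (@plane_measure R).-integrable (`]a, b]%classic `*` `]c, d]%classic) (EFin \o g).
  apply: measurable_bounded_integrable => //.
  - apply: le_lt_trans (ltry ((b - a) * (d - c))); rewrite EFinM.
    rewrite -(lebesgue_measure_ocitv ab) -(lebesgue_measure_ocitv cd).
    have := @product_measure1E _ _ _ _ R mu mu `]a, b]%classic `]c, d]%classic.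
    by move=> <- //; exact: measurable_itv.
  - exact: measurable_funTS.
  - by exists G; split; [exact: num_real|move=> y Gy z _; exact: le_trans (gG z) (ltW Gy)].
have Ig : (@plane_measure R).-integrable setT (EFin \o g).
  have -> : EFin \o g = (EFin \o g) \_ (`]a, b]%classic `*` `]c, d]%classic).
    apply/funext => z; rewrite patchE; case: ifPn => //.
    by rewrite notin_setE/= !in_itv/= => /g0 ->.
  by apply: (integrable_mkcond _ _).1 IX; exact: mX.
have mgt t : measurable_fun setT (fun x => g (t, x)) by exact: measurable_fun_pair2.
have HE t : H t = \int[mu]_(x in `]c, d]) g (t, x).
  by apply: Rintegral_support => x nx; apply: g0 => -[].
have G0 : 0 <= G by apply: le_trans (gG (0, 0)).
have Ft t : (\int[mu]_x (g (t, x))%:E)%E = (H t)%:E.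
  rewrite /H /Rintegral fineK// integral_mkcond.
  rewrite (_ : _ \_ _ = (EFin \o (fun x => g (t, x))) \_ `]c, d]%classic).
    rewrite -integral_mkcond; apply: integrable_fin_num; first exact: measurable_itv.
    exact: bounded_integrable_ocitv (mgt t) (fun x => gG (t, x)).
  apply/funext => x; rewrite !patchE mem_setT; case: ifPn => //.
  by rewrite notin_setE/= in_itv/= => xn; rewrite g0//= => -[].
have FE : fubini_F mu (EFin \o g) = EFin \o H by apply/funext => t; exact: Ft.
split.
- have mF : measurable_fun setT (fubini_F mu (EFin \o g)) := measurable_fubini_F Ig.
  by move: mF; rewrite FE => /measurable_EFinP.
- move=> t; rewrite HE ler_norml; apply/andP; split.
    have Igt : mu.-integrable `]c, d]%classic (EFin \o (fun x => g (t, x))).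
      exact: bounded_integrable_ocitv (mgt t) (fun x => gG (t, x)).
    rewrite lerNl -mulN1r -RintegralZl//.
    apply: le_trans (@ae_le_Rintegral_ocitvD (fun x => -1 * g (t, x)) (fun=> 0) G G c d _ _ _ _ cd _) _.
    + by apply: measurable_funM => //; exact: measurable_cst.
    + exact: measurable_cst.
    + by move=> x; rewrite mulN1r normrN.
    + by move=> x; rewrite normr0.
    + by apply: aeW => x _; rewrite add0r mulN1r; apply: le_trans (ler_norm _) _; rewrite normrN.
    + by rewrite Rintegral_cst ?mul0r ?add0r//; exact: measurable_itv.
  apply: le_trans (@ae_le_Rintegral_ocitvD (fun x => g (t, x)) (fun=> 0) G G c d _ _ _ _ cd _) _ => //.
  + by move=> x; rewrite normr0.
  + by apply: aeW => x _; rewrite add0r; exact: le_trans (ler_norm _) (gG _).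
  + by rewrite Rintegral_cst ?mul0r ?add0r//; exact: measurable_itv.
- rewrite -Rintegral_support; last first.
    move=> t nt; rewrite /H (_ : (fun x => g (t, x)) = cst 0) ?Rintegral_cst ?mul0r//.
    by apply/funext => x; apply: g0 => -[].
  by rewrite /Rintegral -(integral12_prod_meas1 Ig) -/(fubini_F mu (EFin \o g)) FE.
Qed.

End BoundedIntegrals.

Lemma derive_close_line (R : realType) (h : R -> R) (t s e : R) : is_derive t (1 : R) h s -> 0 < e ->
  exists d : R, 0 < d /\ forall t', `|t' - t| < d -> `|h t' - (h t + s * (t' - t))| <= e * `|t' - t|.
Proof.
move=> dh e0.
have cvgh : r^-1 *: ((h \o shift t) (r *: (1 : R)) - h t) @[r --> 0^'] --> s.
  by have := @ex_derive _ _ _ _ _ _ _ dh; rewrite -(@derive_val _ _ _ _ _ _ _ dh).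
have /cvgrPdist_le/(_ _ e0)[/= d d0 dP] := cvgh.
exists d; split => // t'; have [->|tt] := eqVneq t' t.
  by rewrite !subrr mulr0 addr0 subrr normr0 mulr0.
move=> td; have r0 : t' - t != 0 by rewrite subr_eq0.
have := dP (t' - t); rewrite /ball_/= sub0r normrN => /(_ td r0).
rewrite /GRing.scale/= mulr1 subrK distrC => H.
have -> : h t' - (h t + s * (t' - t)) = ((t' - t)^-1 * (h t' - h t) - s) * (t' - t) by field.
by rewrite normrM ler_wpM2r.
Qed.

(** * Testing with humps concentrated at a point of the path *)

Section BlowUp.
Context {R : realType}.
Local Notation mu := (@lebesgue_measure R).
Implicit Types (r w t x kappa : R) (z : R * R).
Variables (u : R * R -> R) (A B h : R -> R) (M K b t0 s um up : R).
Hypothesis mu_ : measurable_fun setT u.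
Hypothesis uM : forall z, - M <= u z <= M.
Hypotheses (umM : - M <= um <= M) (upM : - M <= up <= M).
Hypotheses (cA : continuous A) (cB : continuous B).
Let D v := B v - s * A v.
Hypothesis AK : forall v, - M <= v <= M -> `|A v| <= K.
Hypothesis DK : forall v, - M <= v <= M -> `|D v| <= K.
Hypothesis DL : forall v w, - M <= v <= M -> - M <= w <= M -> `|D v - D w| <= K * `|v - w|.
Hypotheses (K_gt0 : 0 < K) (b_gt0 : 0 < b).
Hypothesis humpK : forall x, `|hump x| <= K.
Hypothesis dhumpK : forall x, `|@dhump R x| <= K.
Hypothesis hump_b : forall x, - (1 / 2) <= x <= 1 / 2 -> b <= hump x.
Hypothesis t0_gt0 : 0 < t0.

Let line t := h t0 + s * (t - t0).

Let integrand r w (z : R * R) : R :=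
  D (u z) * (hump ((z.1 - t0) / r) * (w^-1 * dhump ((z.2 - line z.1) / w))) +
  A (u z) * (r^-1 * dhump ((z.1 - t0) / r) * hump ((z.2 - line z.1) / w)).

Let bound r w : R := K ^+ 3 * (w^-1 + r^-1).

Let norm3 (x y z : R) : `|x * y * z| = `|x| * `|y| * `|z|. Proof. by rewrite !normrM. Qed.

Let mul3K (x y z : R) : `|x| <= K -> `|y| <= K -> `|z| <= K -> `|x * y * z| <= K ^+ 3.
Proof.
move=> xK yK zK; rewrite norm3 !exprS expr0 mulr1 mulrA.
by apply: ler_pM; rewrite ?mulr_ge0//; apply: ler_pM.
Qed.

Let mul3Kdiv (x y z w : R) : 0 < w -> `|x| <= K -> `|y| <= K -> `|z| <= K ->
  `|x * (y * (w^-1 * z))| <= K ^+ 3 / w.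
Proof.
move=> w0 xK yK zK; have -> : x * (y * (w^-1 * z)) = (x * y * z) / w by ring.
by rewrite normrM normfV (gtr0_norm w0) ler_pM2r ?invr_gt0// mul3K.
Qed.

Let integrandE r w z : 0 < r -> 0 < w ->
  A (u z) * partial_t (moving_hump t0 (h t0) s r w) z +
  B (u z) * partial_x (moving_hump t0 (h t0) s r w) z = integrand r w z.
Proof.
by move=> r0 w0; rewrite partial_t_moving_hump partial_x_moving_hump /integrand /D /line; ring.
Qed.

Let integrand_bound r w z : 0 < r -> 0 < w -> `|integrand r w z| <= bound r w.
Proof.
move=> r0 w0; apply: le_trans (ler_normD _ _) _; rewrite /bound [leRHS]mulrDr; apply: lerD.
  by apply: mul3Kdiv => //; exact: DK.
have -> : A (u z) * (r^-1 * dhump ((z.1 - t0) / r) * hump ((z.2 - line z.1) / w)) =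
  A (u z) * (dhump ((z.1 - t0) / r) * (r^-1 * hump ((z.2 - line z.1) / w))) by ring.
by apply: mul3Kdiv => //; exact: AK.
Qed.

Let measurable_integrand r w : measurable_fun setT (integrand r w).
Proof.
have mD : measurable_fun setT D.
  apply: continuous_measurable_fun => x; apply: cvgB; first exact: cB.
  by apply: cvgM; [exact: cvg_cst|exact: cA].
have mA : measurable_fun setT A by exact: continuous_measurable_fun.
have mb : measurable_fun setT (@hump R) by apply: continuous_measurable_fun; exact: continuous_hump.
have mdb : measurable_fun setT (@dhump R) by apply: continuous_measurable_fun; exact: continuous_dhump.
have mt : measurable_fun setT (fun z : R * R => (z.1 - t0) / r).
  by apply: measurable_funM; [apply: measurable_funB|]; first exact: measurable_fst; exact: measurable_cst.
have mx : measurable_fun setT (fun z : R * R => (z.2 - line z.1) / w).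
  apply: measurable_funM; last exact: measurable_cst.
  apply: measurable_funB; first exact: measurable_snd.
  apply: measurable_funD; first exact: measurable_cst.
  apply: measurable_funM; first exact: measurable_cst.
  by apply: measurable_funB; [exact: measurable_fst|exact: measurable_cst].
apply: measurable_funD; apply: measurable_funM.
- exact: measurableT_comp mD mu_.
- apply: measurable_funM; first exact: measurableT_comp mb mt.
  by apply: measurable_funM; [exact: measurable_cst|exact: measurableT_comp mdb mx].
- exact: measurableT_comp mA mu_.
- apply: measurable_funM; last exact: measurableT_comp mb mx.
  by apply: measurable_funM; [exact: measurable_cst|exact: measurableT_comp mdb mt].
Qed.

Let integrand_out r w z : 0 < r -> 0 < w -> (r <= `|z.1 - t0|) || (w <= `|z.2 - line z.1|) ->
  integrand r w z = 0.
Proof.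
move=> r0 w0 H; rewrite -integrandE//.
by have [_ -> ->] := moving_hump_out r0 w0 H; rewrite !mulr0 addr0.
Qed.

Let slice r w t := \int[mu]_x integrand r w (t, x).

Let pairing_slice r w : 0 < r -> r < t0 -> 0 < w ->
  [/\ measurable_fun setT (slice r w), exists C : R, forall t, `|slice r w t| <= C &
      weak_pairing A B u (moving_hump t0 (h t0) s r w) = \int[mu]_(t in `]t0 - r, t0 + r]) slice r w t].
Proof.
move=> r0 rt w0; pose c : R := w + `|s| * r.
have c0 : 0 <= c by rewrite addr_ge0 ?mulr_ge0// ltW.
have supp z : ~ ((t0 - r < z.1 <= t0 + r) /\ (h t0 - c < z.2 <= h t0 + c)) -> integrand r w z = 0.
  move=> nz; apply: integrand_out => //.
  have [//|zt] := leP r `|z.1 - t0|; have [//|zx] := leP w `|z.2 - line z.1|.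
  exfalso; apply: nz.
  have H : `|s * (z.1 - t0)| <= `|s| * r by rewrite normrM ler_wpM2l// ltW.
  move: zt zx H; rewrite /line ltr_distl ltr_distl ler_norml => /andP[? ?] /andP[? ?] /andP[? ?].
  by split; rewrite /c; apply/andP; split; lra.
have le1 : t0 - r <= t0 + r by lra.
have le2 : h t0 - c <= h t0 + c by lra.
have [mH HB HE] := bounded_support_fubini (measurable_integrand r w)
  (fun z => integrand_bound z r0 w0) le1 le2 supp.
split => //; first by exists (bound r w * (h t0 + c - (h t0 - c))).
rewrite -HE /weak_pairing Rintegral_mkcond; congr (Rintegral _ _ _); apply/funext => z.
rewrite patchE; case: ifPn => [_|]; first exact: integrandE.
rewrite notin_setE/= /half_plane/= => /negP; rewrite -leNgt => z0; rewrite supp// => -[]; lra.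
Qed.

Let slice_bound r w t : 0 < r -> 0 < w ->
  slice r w t = \int[mu]_(x in `]line t - w, line t + w]) integrand r w (t, x).
Proof.
move=> r0 w0; apply: Rintegral_support => x nx; apply: integrand_out => //=.
apply/orP; right; have [//|] := leP w `|x - line t|.
by rewrite ltr_distl => /andP[? ?]; exfalso; apply: nx; apply/andP; split; lra.
Qed.

(** The width [kappa * r] is much smaller than the duration [r], so the time derivative of the
    cutoff contributes O([kappa]). The path is within [kappa ^+ 2 * r] of the line of slope [s],
    that is, in a fraction [kappa] of the window, which costs O([kappa]) too; elsewhere [u] is close
    to one of its traces. *)
Let slice_le_jump kappa r t delta p1 p2 : 0 < kappa < 1 -> 0 < r -> 2 * r < delta -> 0 <= p1 -> 0 <= p2 ->
  `|h t - line t| <= kappa ^+ 2 * r ->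
  {ae mu, forall x, 0 < -1 * (x - h t) < delta -> `|u (t, x) - um| <= p1} ->
  {ae mu, forall x, 0 < 1 * (x - h t) < delta -> `|u (t, x) - up| <= p2} ->
  slice r (kappa * r) t <= - (hump ((t - t0) / r) * hump kappa * (D up - D um)) +
    2 * K ^+ 3 * (p1 + p2) + 6 * kappa * K ^+ 3.
Proof.
move=> /andP[k0 k1] r0 rd p10 p20 hl u1 u2; set w := kappa * r.
have w0 : 0 < w by rewrite mulr_gt0.
have wr : w < r by rewrite gtr_pMl.
have kw : kappa * w = kappa ^+ 2 * r by rewrite /w expr2 mulrA.
have kww : kappa * w < w by rewrite gtr_pMl.
have K30 : 0 < K ^+ 3 by rewrite exprn_gt0.
have K3w : 0 <= K ^+ 3 / w by apply: divr_ge0; exact: ltW.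
have K3r : 0 <= K ^+ 3 / r by apply: divr_ge0; exact: ltW.
pose f x := integrand r w (t, x).
pose c1 : R := K ^+ 3 / w * (p1 + p2) + K ^+ 3 / r.
have c10 : 0 <= c1 by rewrite addr_ge0// mulr_ge0// addr_ge0.
have mf : measurable_fun setT f by exact: measurable_fun_pair2 (measurable_integrand r w).
have fB x : `|f x| <= bound r w by exact: integrand_bound.
have approx v p x : - M <= v <= M -> `|u (t, x) - v| <= p -> p <= p1 + p2 ->
    f x <= hump ((t - t0) / r) * D v * (w^-1 * dhump ((x - line t) / w)) + c1.
  move=> vM uv pp; rewrite /f /integrand/=; set be := hump _; set dx := dhump _; set X := A _ * _.
  have HX : X <= K ^+ 3 / r.
    have -> : X = A (u (t, x)) * (dhump ((t - t0) / r) * (r^-1 * hump ((x - line t) / w))).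
      by rewrite /X; ring.
    by apply: le_trans (ler_norm _) _; apply: mul3Kdiv => //; exact: AK.
  have -> : D (u (t, x)) * (be * (w^-1 * dx)) =
      be * D v * (w^-1 * dx) + (D (u (t, x)) - D v) * be * dx / w by ring.
  rewrite -addrA lerD2l /c1; apply: lerD => //.
  apply: le_trans (ler_norm _) _; rewrite normrM normfV (gtr0_norm w0) [leRHS]mulrAC ler_pM2r ?invr_gt0//.
  rewrite (_ : K ^+ 3 * (p1 + p2) = K * (p1 + p2) * K * K); last by ring.
  rewrite norm3; apply: ler_pM; rewrite ?mulr_ge0 ?dhumpK//; apply: ler_pM => //; last exact: humpK.
  by apply: le_trans (DL _ vM) _ => //; rewrite ler_pM2l// (le_trans uv).
have kk : 0 < kappa < 1 by rewrite k0.
have := @slice_le R f (bound r w) (line t) w kappa (hump ((t - t0) / r)) (D um) (D up) c1 (bound r w)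
  mf fB w0 kk.
rewrite kw => /(_ _ _ _ c10)/wrap[|||H].
- apply: ae_imp2 u1 (ae_neq (h t)) _ => y ux xh /andP[x1 x2].
  apply: approx umM (ux _) _; last by rewrite lerDl.
  move: hl; rewrite ler_distl => /andP[h1 h2]; rewrite lt_neqAle eq_sym mulN1r oppr_eq0 subr_eq0 xh/=.
  move: kww; rewrite kw => kww; apply/andP; split; lra.
- apply: aeW => x _; exact: le_trans (ler_norm _) (fB x).
- apply: ae_imp u2 _ => y ux /andP[x1 x2].
  apply: approx upM (ux _) _; last by rewrite lerDr.
  move: hl; rewrite ler_distl => /andP[h1 h2]; rewrite mul1r.
  move: kww; rewrite kw => kww; apply/andP; split; lra.
rewrite slice_bound//; apply: le_trans H _; rewrite -[leLHS]addrA -[leRHS]addrA lerD2l /c1 /bound.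
have -> : 2 * w * (K ^+ 3 / w * (p1 + p2) + K ^+ 3 / r) = 2 * K ^+ 3 * (p1 + p2) + 2 * kappa * K ^+ 3.
  by rewrite /w; field; rewrite !gt_eqF.
rewrite -addrA lerD2l.
have -> : 2 * kappa * w * (K ^+ 3 * (w^-1 + r^-1)) = 2 * kappa * K ^+ 3 + 2 * kappa ^+ 2 * K ^+ 3.
  by rewrite /w; field; rewrite !gt_eqF.
have : kappa ^+ 2 * K ^+ 3 <= kappa * K ^+ 3.
  by rewrite ler_pM2r// expr2 ger_pMl// ltW.
lra.
Qed.

Let hump_mass r : 0 < r -> b * r <= \int[mu]_(t in `]t0 - r, t0 + r]) hump ((t - t0) / r).
Proof.
move=> r0; pose P t : R := hump ((t - t0) / r).
have mP : measurable_fun setT P.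
  apply: (@measurableT_comp _ _ _ _ _ _ (@hump R)).
    by apply: continuous_measurable_fun; exact: continuous_hump.
  by apply: measurable_funM; [apply: measurable_funB|exact: measurable_cst].
have PB t : `|P t| <= K + b by apply: le_trans (humpK _) _; rewrite lerDl ltW.
rewrite (@Rintegral_ocitv_split _ P (K + b) (t0 - r) (t0 - r / 2) (t0 + r / 2) (t0 + r) mP PB); try lra.
have mid : b * r <= \int[mu]_(t in `]t0 - r / 2, t0 + r / 2]) P t.
  have := @ae_le_Rintegral_ocitvD R (fun=> b) P (K + b) 0 (t0 - r / 2) (t0 + r / 2).
  move=> /(_ _ mP _ PB _ _)/wrap[||||].
  - exact: measurable_cst.
  - by move=> _; rewrite gtr0_norm// lerDr ltW.
  - lra.
  - apply: aeW => t /andP[t1 t2]; rewrite addr0; apply: hump_b.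
    by rewrite ler_pdivlMr// ler_pdivrMr//; apply/andP; split; lra.
  rewrite (_ : (fun _ => b) = cst b)// Rintegral_cst; last exact: measurable_itv.
  have le1 : t0 - r / 2 <= t0 + r / 2 by lra.
  by rewrite [X in fine X](lebesgue_measure_ocitv le1)/= mul0r addr0; lra.
have P0 a c : 0 <= \int[mu]_(t in `]a, c]) P t by apply: Rintegral_ge0 => t _; exact: hump_ge0.
by rewrite -[b * r]addr0 -[b * r]add0r; apply: lerD => //; exact: lerD.
Qed.

Let interval_bounds (r : R) : 0 < r ->
  [/\ 0 < 2 * r, t0 - 2 * r <= t0 - r, t0 + r < t0 + 2 * r & t0 - r <= t0 + r].
Proof. by split; lra. Qed.

Let quarter_lt (d e : R) : 0 < d -> d <= e -> [/\ 0 < d / 4, 2 * (d / 4) < e & d / 4 < e].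
Proof. by split; lra. Qed.

Let half_itv : 0 < (1 / 2 : R) < 1. Proof. by lra. Qed.

Let add_le (x y a c : R) : x <= - y + a + c -> x + y <= c + a. Proof. by lra. Qed.

Let contradictory_bounds (a1 a2 a3 X Y : R) : 0 < a1 -> 0 <= X -> a2 <= a1 / 2 -> 40 * a1 <= a3 ->
  a3 <= Y -> 8 * a2 < X + Y - 12 * a1.
Proof. by lra. Qed.

(** Integrated in time, a positive jump [J] would make the pairing at most a negative multiple of
    [J * r] plus errors of order [k * r], hence negative for [k] small. *)
Lemma weak_jump_le : is_derive t0 (1 : R) h s -> trace_point u h (- 1) t0 um -> trace_point u h 1 t0 up ->
  (forall r w, 0 < r -> r < t0 -> 0 < w ->
    0 <= weak_pairing A B u (moving_hump t0 (h t0) s r w)) ->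
  B up - B um - s * (A up - A um) <= 0.
Proof.
move=> dh tm tp pos; have -> : B up - B um - s * (A up - A um) = D up - D um by rewrite /D; ring.
rewrite leNgt; apply/negP; set J := D up - D um => J0.
have K30 : 0 < K ^+ 3 by rewrite exprn_gt0.
have /andP[half0 half1] := half_itv.
(* In units of [k * K ^+ 3 * r], the errors amount to 12 from the window and [8 * k <= 4] from the
   traces; 40 exceeds their sum. *)
have kJ0 : 0 < b * b * J / (40 * K ^+ 3) by rewrite divr_gt0 ?mulr_gt0.
have [k [k0 k2 kJ]] := min_spec half0 kJ0.
have k20 : 0 < k ^+ 2 by rewrite exprn_gt0.
have kK : 40 * (k * K ^+ 3) <= b * b * J by move: kJ; rewrite ler_pdivlMr ?mulr_gt0//; lra.
have [d1 [p1 [d10 mp1 p10 u1 I1]]] := tm _ k20.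
have [d2 [p2 [d20 mp2 p20 u2 I2]]] := tp _ k20.
have [d3 [d30 hl]] := derive_close_line dh k20.
have [d4 [d40 d41 d42]] := min_spec d10 d20.
have [d5 [d50 d53 d5t]] := min_spec d30 t0_gt0.
have [d6 [d60 d64 d65]] := min_spec d40 d50.
pose r : R := d6 / 4; have [r0 rd4 rd4'] := quarter_lt d60 d64; rewrite -/r in r0 rd4 rd4'.
have [_ _ rd5] := quarter_lt d60 d65; rewrite -/r in rd5.
have rd1 := lt_le_trans rd4 d41; have rd2 := lt_le_trans rd4 d42.
have rd3 := lt_le_trans rd5 d53; have rt := lt_le_trans rd5 d5t.
have [r20 lo hi le1] := interval_bounds r0.
have kr0 : 0 < k * r by rewrite mulr_gt0.
have [mS [C SC] SE] := pairing_slice r0 rt kr0.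
have Spos : 0 <= \int[mu]_(t in `]t0 - r, t0 + r]) slice r (k * r) t.
  by rewrite -SE; exact: pos.
pose P t : R := hump ((t - t0) / r); pose q : R := hump k * J.
have mP : measurable_fun setT P.
  apply: (@measurableT_comp _ _ _ _ _ _ (@hump R)).
    by apply: continuous_measurable_fun; exact: continuous_hump.
  by apply: measurable_funM; [apply: measurable_funB|exact: measurable_cst].
have bk : b <= hump k by apply: hump_b; rewrite k2 andbT (le_trans _ (ltW k0))// oppr_le0 ltW.
have q0 : b * J <= q by rewrite /q ler_pM2r.
have bJ0 : 0 < b * J by rewrite mulr_gt0.
have q00 := lt_le_trans bJ0 q0.
pose f t := slice r (k * r) t + q * P t.
have mqP : measurable_fun setT (fun t => q * P t) by apply: measurable_funM => //; exact: measurable_cst.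
have mf : measurable_fun setT f by exact: measurable_funD.
have qPB t : `|q * P t| <= q * K by rewrite normrM gtr0_norm// ler_pM2l//; exact: humpK.
have fB t : `|f t| <= C + q * K by apply: le_trans (ler_normD _ _) _; exact: lerD.
pose m t := 2 * K ^+ 3 * (p1 t + p2 t).
have mm : measurable_fun setT m.
  by apply: measurable_funM; [exact: measurable_cst|exact: measurable_funD].
have m0 t : 0 <= m t by rewrite /m mulr_ge0 ?addr_ge0// mulr_ge0// ltW.
have k01 : 0 < k < 1 by rewrite k0 (le_lt_trans k2).
have fm : {ae mu, forall t, t0 - r < t <= t0 + r -> f t <= 6 * k * K ^+ 3 + m t}.
  apply: ae_imp2 u1 u2 _ => t ut1 ut2 /andP[t1 t2].
  have tr : `|t - t0| <= r by rewrite ler_distl (ltW t1).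
  have hlt : `|h t - line t| <= k ^+ 2 * r.
    by apply: le_trans (hl t (le_lt_trans tr rd3)) _; rewrite ler_wpM2l// ltW.
  have td1 := le_lt_trans tr (lt_le_trans rd4' d41).
  have td2 := le_lt_trans tr (lt_le_trans rd4' d42).
  have := slice_le_jump k01 r0 rd4 (p10 t) (p20 t) hlt.
  move=> /(_ _ _)/wrap[||H].
  - by apply: ae_imp (ut1 td1) _ => x ux /andP[x1 x2]; apply: ux; rewrite x1 (lt_le_trans x2).
  - by apply: ae_imp (ut2 td2) _ => x ux /andP[x1 x2]; apply: ux; rewrite x1 (lt_le_trans x2).
  have -> : f t = slice r (k * r) t + P t * hump k * J by rewrite /f /q; ring.
  exact: add_le H.
have := ae_le_Rintegral_ocitv mf fB mm m0 le1 fm.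
have K320 : 0 <= 2 * K ^+ 3 by rewrite mulr_ge0// ltW.
move=> /le_trans/(_ (le_integral_ocitv_add K320 mp1 mp2 p10 p20 (I1 _ r20 rd1) (I2 _ r20 rd2) lo hi)).
have IS : mu.-integrable `](t0 - r)%R, (t0 + r)%R]%classic (EFin \o slice r (k * r)) :=
  bounded_integrable_ocitv _ _ mS SC.
have KP t : `|P t| <= K by exact: humpK.
have IP : mu.-integrable `](t0 - r)%R, (t0 + r)%R]%classic (EFin \o P) :=
  bounded_integrable_ocitv _ _ mP KP.
have IqP : mu.-integrable `](t0 - r)%R, (t0 + r)%R]%classic (EFin \o (fun t => q * P t)) :=
  bounded_integrable_ocitv _ _ mqP qPB.
rewrite lee_fin RintegralD// RintegralZl//.
have mass : b * J * (b * r) <= q * \int[mu]_(t in `]t0 - r, t0 + r]) P t.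
  by apply: ler_pM => //; [exact: ltW|rewrite mulr_ge0// ltW|exact: hump_mass].
have kk : k ^+ 2 * K ^+ 3 <= k * K ^+ 3 / 2.
  have -> : k * K ^+ 3 / 2 = k * (1 / 2) * K ^+ 3 by field.
  by rewrite ler_pM2r// expr2 ler_pM2l.
apply/negP; rewrite -ltNge.
have H1 : k ^+ 2 * K ^+ 3 * r <= k * K ^+ 3 / 2 * r by rewrite ler_pM2r.
have H2 : 40 * (k * K ^+ 3) * r <= b * b * J * r by rewrite ler_pM2r.
have H3 : 0 < k * K ^+ 3 * r by rewrite !mulr_gt0.
move: Spos mass; set X := Rintegral _ _ _; set Y := q * _ => Spos mass.
have E1 : 6 * k * K ^+ 3 * (t0 + r - (t0 - r)) = 12 * (k * K ^+ 3 * r) by ring.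
have E2 : 2 * (2 * K ^+ 3) * (k ^+ 2 * (2 * r)) = 8 * (k ^+ 2 * K ^+ 3 * r) by ring.
rewrite E1 E2.
have E3 : k * K ^+ 3 / 2 * r = (k * K ^+ 3 * r) / 2 by field.
have E4 : b * J * (b * r) = b * b * J * r by ring.
have E5 : 40 * (k * K ^+ 3) * r = 40 * (k * K ^+ 3 * r) by ring.
by apply: contradictory_bounds H3 Spos _ _ mass; rewrite -?E3 ?E4 -?E5.
Qed.

End BlowUp.

(** * Rankine-Hugoniot and entropy inequalities for traces *)

Section JumpConditions.
Context {R : realType}.
Local Notation mu := (@lebesgue_measure R).
Implicit Types (u : R * R -> R) (A B h : R -> R) (M K t s r w c kappa : R).

Definition locally_lipschitz A := forall M, exists K : R, 0 < K /\
  forall x y, - M <= x <= M -> - M <= y <= M -> `|A x - A y| <= K * `|x - y|.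

Lemma locally_lipschitz_continuous A : locally_lipschitz A -> continuous A.
Proof.
move=> LA x; have [K [K0 AK]] := LA (`|x| + 1).
apply/cvgrPdist_le => e e0; near=> y.
have y1 : `|x - y| <= 1 by near: y; apply: cvgr_dist_le; [exact: cvg_id|].
apply: le_trans (AK x y _ _) _.
- by rewrite -ler_norml lerDl.
- rewrite -ler_norml; have -> : y = x - (x - y) by ring.
  by apply: le_trans (ler_normB _ _) _; rewrite lerD2l.
rewrite -ler_pdivlMl//; near: y; apply: cvgr_dist_le; first exact: cvg_id.
by rewrite mulr_gt0// invr_gt0.
Unshelve. all: by end_near. Qed.

Lemma C1_locally_lipschitz A (a : R -> R) : (forall x : R, is_derive x (1 : R) A (a x)) -> continuous a ->
  locally_lipschitz A.
Proof.
move=> dA ca M; have [K [K0 aK]] := continuous_bounded M ca.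
by exists K; split => // x y xM yM; exact: derive_bounded_lipschitz dA aK x y xM yM.
Qed.

Lemma locally_lipschitzN A : locally_lipschitz A -> locally_lipschitz (fun x => - A x).
Proof.
move=> LA M; have [K [K0 AK]] := LA M; exists K; split => // x y xM yM.
by rewrite -opprD normrN; exact: AK.
Qed.

Lemma locally_lipschitz_id : locally_lipschitz id.
Proof. by move=> M; exists 1; split => // x y _ _; rewrite mul1r. Qed.

Lemma locally_lipschitz_kruzkov_entropy c : locally_lipschitz (kruzkov_entropy c).
Proof.
move=> M; exists 1; split => // x y _ _; rewrite mul1r /kruzkov_entropy.
apply: le_trans (ler_dist_dist _ _) _.
by rewrite (_ : x - c - (y - c) = x - y)//; ring.
Qed.

(** On opposite sides of [c], both differences are taken through [c] and the distances to [c] add up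
    to [|x - y|]; the window is enlarged to contain [c]. *)
Lemma locally_lipschitz_kruzkov_flux A c : locally_lipschitz A -> locally_lipschitz (kruzkov_flux A c).
Proof.
move=> LA M; have [K [K0 AK]] := LA (`|M| + `|c|); exists K; split => // x y.
have inM z : - M <= z <= M -> - (`|M| + `|c|) <= z <= `|M| + `|c|.
  by have := ler_norm M; have := normr_ge0 c; lra.
have cM : - (`|M| + `|c|) <= c <= `|M| + `|c| by rewrite -ler_norml lerDr.
move=> /inM xM /inM yM; rewrite /kruzkov_flux.
have AKc z : - (`|M| + `|c|) <= z <= `|M| + `|c| -> `|A z - A c| <= K * `|z - c| by move=> zM; exact: AK.
have xy := AK _ _ xM yM.
have [xc|xc|->] := ltgtP x c; have [yc|yc|->] := ltgtP y c; rewrite ?subrr ?sgr0 ?mul0r ?sub0r ?subr0.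
- rewrite !ltr0_sg ?subr_lt0// !mulN1r (_ : - (A x - A c) - - (A y - A c) = - (A x - A y)); last by ring.
  by rewrite normrN.
- rewrite ltr0_sg ?subr_lt0// gtr0_sg ?subr_gt0// mulN1r mul1r.
  rewrite -opprD normrN; apply: le_trans (ler_normD _ _) _.
  apply: le_trans (lerD (AKc _ xM) (AKc _ yM)) _.
  rewrite -mulrDr ler_pM2l// (ltr0_norm (_ : x - c < 0)) ?subr_lt0// (gtr0_norm (_ : 0 < y - c)) ?subr_gt0//.
  by rewrite ltr0_norm ?subr_lt0 ?(lt_trans xc)//; lra.
- by rewrite normrM normr_sg subr_eq0 lt_eqF// mul1r AKc.
- rewrite gtr0_sg ?subr_gt0// (ltr0_sg (_ : y - c < 0)) ?subr_lt0// mul1r mulN1r opprK.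
  apply: le_trans (ler_normD _ _) _.
  apply: le_trans (lerD (AKc _ xM) (AKc _ yM)) _.
  rewrite -mulrDr ler_pM2l// (gtr0_norm (_ : 0 < x - c)) ?subr_gt0// (ltr0_norm (_ : y - c < 0)) ?subr_lt0//.
  by rewrite gtr0_norm ?subr_gt0 ?(lt_trans yc)//; lra.
- rewrite !gtr0_sg ?subr_gt0// !mul1r (_ : (A x - A c) - (A y - A c) = A x - A y)//; by ring.
- by rewrite normrM normr_sg subr_eq0 gt_eqF// mul1r AKc.
- by rewrite normrN normrM normr_sg subr_eq0 lt_eqF// mul1r (distrC c) AKc.
- by rewrite normrN normrM normr_sg subr_eq0 gt_eqF// mul1r (distrC c) AKc.
- by rewrite !normr0 mulr0.
Qed.

(** [u] lies in [[- M, M]] only almost everywhere in the half plane. The truncation is bounded on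
    the whole plane, with the same pairings against humps, and it inherits the trace points at
    positive times. *)
Definition clamp M u z : R := Num.max (- M) (Num.min M ((u \_ half_plane) z)).

Lemma clamp_bound M u z : 0 < M -> - M <= clamp M u z <= M.
Proof.
move=> M0; rewrite /clamp le_max lexx/= ge_max ge_min lexx/= andbT; lra.
Qed.

Lemma measurable_clamp M u : measurable_fun half_plane u -> measurable_fun setT (clamp M u).
Proof.
move=> mu_; apply: measurable_maxr; first exact: measurable_cst.
apply: measurable_minr; first exact: measurable_cst.
exact: (measurable_restrictT u measurable_half_plane).1 mu_.
Qed.

Lemma clampE M u z : half_plane z -> - M <= u z <= M -> clamp M u z = u z.
Proof.
move=> hz /andP[u1 u2]; rewrite /clamp patchE mem_set// (elimT min_idPr)//.
by rewrite (elimT max_idPr).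
Qed.

Lemma weak_pairing_clamp M u A B t x s r w : Linfty_valued M u -> continuous A -> continuous B ->
  0 < r -> 0 < w ->
  weak_pairing A B (clamp M u) (moving_hump t x s r w) = weak_pairing A B u (moving_hump t x s r w).
Proof.
move=> [mu_ uM] cA cB r0 w0; rewrite /weak_pairing /Rintegral; congr fine.
have mt : measurable_fun setT (fun z : R * R => (z.1 - t) / r).
  by apply: measurable_funM; [apply: measurable_funB|]; first exact: measurable_fst; exact: measurable_cst.
have mx : measurable_fun setT (fun z : R * R => (z.2 - (x + s * (z.1 - t))) / w).
  apply: measurable_funM; last exact: measurable_cst.
  apply: measurable_funB; first exact: measurable_snd.
  apply: measurable_funD; first exact: measurable_cst.
  apply: measurable_funM; first exact: measurable_cst.
  by apply: measurable_funB; [exact: measurable_fst|exact: measurable_cst].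
have mb : measurable_fun setT (@hump R) by apply: continuous_measurable_fun; exact: continuous_hump.
have mdb : measurable_fun setT (@dhump R) by apply: continuous_measurable_fun; exact: continuous_dhump.
have mbt := measurableT_comp mb mt; have mdbt := measurableT_comp mdb mt.
have mbx := measurableT_comp mb mx; have mdbx := measurableT_comp mdb mx.
have mpt : measurable_fun setT (partial_t (moving_hump t x s r w)).
  rewrite (_ : partial_t _ = fun z => - s / w * hump ((z.1 - t) / r) * dhump ((z.2 - (x + s * (z.1 - t))) / w) +
    r^-1 * dhump ((z.1 - t) / r) * hump ((z.2 - (x + s * (z.1 - t))) / w)); last first.
    by apply/funext => z; rewrite partial_t_moving_hump.
  by apply: measurable_funD; apply: measurable_funM => //; apply: measurable_funM => //; exact: measurable_cst.
have mpx : measurable_fun setT (partial_x (moving_hump t x s r w)).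
  rewrite (_ : partial_x _ = fun z => w^-1 * hump ((z.1 - t) / r) *
    dhump ((z.2 - (x + s * (z.1 - t))) / w)); last first.
    by apply/funext => z; rewrite partial_x_moving_hump.
  by apply: measurable_funM => //; apply: measurable_funM => //; exact: measurable_cst.
have mA : measurable_fun setT A by exact: continuous_measurable_fun.
have mB : measurable_fun setT B by exact: continuous_measurable_fun.
have mI (U : R * R -> R) : measurable_fun half_plane U -> measurable_fun half_plane (fun z =>
    (A (U z) * partial_t (moving_hump t x s r w) z + B (U z) * partial_x (moving_hump t x s r w) z)%:E).
  move=> mv; apply/measurable_EFinP; apply: measurable_funD; apply: measurable_funM.
  - exact: measurableT_comp mA mv.
  - exact: (measurable_funTS mpt).
  - exact: measurableT_comp mB mv.
  - exact: (measurable_funTS mpx).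
apply: ae_eq_integral.
- exact: measurable_half_plane.
- exact: mI _ (measurable_funTS (measurable_clamp M mu_)).
- exact: mI.
- apply: (@filterS _ _ (ae_filter_ringOfSetsType _)) uM => z uz hz.
  by rewrite clampE// uz.
Qed.

Lemma trace_point_clamp M u h kappa t c : Linfty_valued M u -> 0 < t ->
  trace_point u h kappa t c -> trace_point (clamp M u) h kappa t c.
Proof.
move=> [_ /ae_plane_sections uM] t0 tr e e0.
have [d [p [d0 mp p0 up Ip]]] := tr e e0.
have [d' [d'0 d'd d't]] := min_spec d0 t0.
exists d', p; split => //.
- apply: ae_imp2 uM up _ => s us ups sd.
  have sd2 : `|s - t| < d by exact: lt_le_trans d'd.
  have s0 : 0 < s by move: sd; rewrite ltr_distl => /andP[? _]; lra.
  apply: ae_imp2 us (ups sd2) _ => x ux uxp /andP[x1 x2].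
  by rewrite clampE//; [apply: uxp; rewrite x1 (lt_le_trans x2)|exact: ux].
- by move=> r r0 rd; apply: Ip => //; exact: lt_le_trans d'd.
Qed.

Lemma ae_itv_exists (P : R -> Prop) a b : a < b -> {ae mu, forall x, a < x < b -> P x} ->
  exists x, a < x < b /\ P x.
Proof.
move=> ab [N [mN N0 PN]]; apply: contrapT => H.
have sub : `]a, b[%classic `<=` N.
  move=> x; rewrite /= in_itv/= => xab; apply: PN => /= Px; apply: H.
  by exists x; split => //; exact: Px.
have mI : measurable (`]a, b[%classic : set R) by exact: measurable_itv.
have : (mu `]a, b[%classic <= 0)%E.
  by apply: (le_trans (le_measure mu (mem_set mI) (mem_set mN) sub)); rewrite [leLHS]N0.
by rewrite lebesgue_measure_itv/= lte_fin ab -EFinB lee_fin leNgt subr_gt0 ab.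
Qed.

(** If [|c| > M], then [|u - c| >= |c| - M] everywhere, so the error bound is at least [|c| - M] at
    almost all times near [t], and its integral is at least twice what a trace point allows. *)
Lemma trace_point_bound u M h kappa t c : (forall z, - M <= u z <= M) -> kappa != 0 ->
  trace_point u h kappa t c -> - M <= c <= M.
Proof.
move=> uM k0 tr; rewrite -ler_norml leNgt; apply/negP => Mc.
have e0 : 0 < `|c| - M by lra.
have [d [p [d0 mp p0 up Ip]]] := tr _ e0.
have d20 : 0 < d / 2 by lra.
have d2d : d / 2 < d by lra.
have mI : measurable (`](t - d / 2)%R, (t + d / 2)%R[%classic : set R) by exact: measurable_itv.
have : ((d / 2 * 2 * (`|c| - M))%:E <= \int[mu]_(s in `](t - d / 2)%R, (t + d / 2)%R[) (p s)%:E)%E.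
  have -> : ((d / 2 * 2 * (`|c| - M))%:E =
      \int[mu]_(s in `](t - d / 2)%R, (t + d / 2)%R[) (`|c| - M)%:E)%E.
    rewrite integral_cst// [X in (_ * X)%E](_ : _ = (d / 2 * 2)%:E); first by rewrite -EFinM mulrC.
    have -> : (d / 2 * 2)%:E = mu `](t - d / 2)%R, (t + d / 2)%R[%classic; last by [].
    by rewrite lebesgue_measure_itv/= lte_fin ifT -?EFinD; [congr EFin; ring|lra].
  apply: ae_ge0_le_integral => //.
  - by move=> s _; rewrite lee_fin ltW.
  - by move=> s _; rewrite lee_fin.
  - by apply: measurable_funTS; have /measurable_EFinP := mp.
  apply: ae_imp up _ => s us; rewrite /= in_itv/= => st; rewrite lee_fin.
  have sd : `|s - t| < d by rewrite ltr_distl; apply/andP; split; lra.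
  have {}us : {ae mu, forall x, 0 < kappa * (x - h s) < d -> `|c| - M <= p s}.
    apply: ae_imp (us sd) _ => x ux xd; apply: le_trans (ux xd).
    have := uM (s, x); rewrite -ler_norml => uM'.
    by have := lerB_dist c (u (s, x)); rewrite distrC; lra.
  have [kp|kn|kE] := ltgtP kappa 0; last by rewrite kE eqxx in k0.
  - have ab : h s + d / kappa < h s by rewrite gtrDl pmulr_rlt0// invr_lt0.
    have [|x [_ //]] := @ae_itv_exists (fun=> `|c| - M <= p s) _ _ ab.
    apply: ae_imp us _ => x ux /andP[x1 x2]; apply: ux.
    rewrite nmulr_rgt0// subr_lt0 x2/= -ltr_ndivrMl// mulrC.
    by rewrite ltrBrDl.
  - have ab : h s < h s + d / kappa by rewrite ltrDl divr_gt0.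
    have [|x [_ //]] := @ae_itv_exists (fun=> `|c| - M <= p s) _ _ ab.
    apply: ae_imp us _ => x ux /andP[x1 x2]; apply: ux.
    rewrite pmulr_rgt0// subr_gt0 x1/= -ltr_pdivlMl// mulrC.
    by rewrite ltrBlDl.
move=> /le_trans/(_ (Ip _ d20 d2d)); rewrite lee_fin leNgt => /negP; apply.
have -> : d / 2 * 2 * (`|c| - M) = (`|c| - M) * (d / 2) + (`|c| - M) * (d / 2) by field.
by rewrite ltrDl mulr_gt0.
Qed.

Lemma jump_le u M A B h t s um up : 0 < M -> Linfty_valued M u -> locally_lipschitz A ->
  locally_lipschitz B -> 0 < t -> is_derive t (1 : R) h s ->
  trace_point u h (- 1) t um -> trace_point u h 1 t up ->
  (forall r w, 0 < r -> r < t -> 0 < w ->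
    0 <= weak_pairing A B u (moving_hump t (h t) s r w)) ->
  B up - B um - s * (A up - A um) <= 0.
Proof.
move=> M0 uM LA LB t0 dh tm tp pos.
have cA := locally_lipschitz_continuous LA; have cB := locally_lipschitz_continuous LB.
have {}tm := trace_point_clamp uM t0 tm; have {}tp := trace_point_clamp uM t0 tp.
have cl z := clamp_bound u z M0.
have k1 : 1 != 0 :> R by [].
have k2 : -1 != 0 :> R by rewrite oppr_eq0.
have umM := trace_point_bound cl k2 tm; have upM := trace_point_bound cl k1 tp.
pose D v := B v - s * A v.
have [K1 [K10 AK]] := continuous_bounded M cA.
have [K2 [K20 DK]] : exists c : R, 0 < c /\ forall x, - M <= x <= M -> `|D x| <= c.
  apply: continuous_bounded => x; apply: cvgB; first exact: cB.
  by apply: cvgM; [exact: cvg_cst|exact: cA].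
have [K3 [K30 AL]] := LA M; have [K4 [K40 BL]] := LB M.
have [K5 [b [K50 b0 hK dhK hb]]] := @hump_bounds R.
pose K := K1 + K2 + (K4 + `|s| * K3) + K5.
have sK : 0 <= `|s| * K3 by rewrite mulr_ge0// ltW.
have K0 : 0 < K by rewrite /K; lra.
apply: (@weak_jump_le R (clamp M u) A B h M K b t s um up) => //.
- by apply: measurable_clamp; case: uM.
- by move=> v vM; apply: le_trans (AK v vM) _; rewrite /K; lra.
- by move=> v vM; apply: le_trans (DK v vM) _; rewrite /K; lra.
- move=> v w vM wM; apply: (@le_trans _ _ ((K4 + `|s| * K3) * `|v - w|)).
    rewrite (_ : _ - _ = (B v - B w) - s * (A v - A w)); last by ring.
    apply: le_trans (ler_normB _ _) _; rewrite normrM mulrDl -mulrA.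
    by apply: lerD; [exact: BL|rewrite ler_wpM2l// AL].
  by rewrite ler_wpM2r// /K; lra.
- by move=> x; apply: le_trans (hK x) _; rewrite /K; lra.
- by move=> x; apply: le_trans (dhK x) _; rewrite /K; lra.
- by move=> r w r0 rt w0; rewrite weak_pairing_clamp//; exact: pos.
Qed.

(** Without integrability: positive and negative parts are exchanged, and [fine] sends the infinite
    cases to 0 on both sides. *)
Lemma RintegralN d (T : measurableType d) (m : {measure set T -> \bar R}) (D : set T) (f : T -> R) :
  \int[m]_(x in D) (- f x) = - \int[m]_(x in D) f x.
Proof.
rewrite /Rintegral; under eq_integral do rewrite EFinN.
rewrite integralE [in RHS]integralE -fineN.
rewrite (_ : (fun x => (- (f x)%:E)%E) = (\- (EFin \o f))%E)// funeposN funenegN.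
set a := integral _ _ _; set b := integral _ _ _; move: a b => [a| |] [b| |] //=.
by rewrite opprB.
Qed.

Lemma weak_pairingN A B u phi : weak_pairing (fun v => - A v) (fun v => - B v) u phi =
  - weak_pairing A B u phi.
Proof.
rewrite /weak_pairing -RintegralN; congr (Rintegral _ _ _); apply/funext => z; ring.
Qed.

End JumpConditions.

(** * The contraction property *)

Section Thresholds.
Context {R : realType}.
Implicit Types (Good : R -> R -> Prop) (a m r x y : R) (A : R -> R).

(* A family of thresholds can be regularized into a continuous one: take the
   largest [r] such that the threshold [r] is admissible at [m - r]. *)
Lemma lipschitz_threshold Good :
  (forall m m' a a', Good m a -> m <= m' -> a' <= a -> Good m' a') ->
  (forall m, 0 < m -> exists a : R, 0 < a /\ Good m a) ->
  exists A, (forall x y, `|A x - A y| <= 1 * `|x - y|) /\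
    forall m, 0 < m -> 0 < A m < 1 /\ forall a, 0 < a -> a < A m -> Good m a.
Proof.
(* The bound [1 / 2] keeps the threshold below 1; the alternative [r = 0] keeps the set nonempty. *)
move=> mono ex; pose S m : set R := [set r | 0 <= r <= 1 / 2 /\ (r = 0 \/ Good (m - r) r)].
have S0 m : S m 0 by split; [lra|left].
have Sub m : ubound (S m) (1 / 2) by move=> r [/andP[]].
have Ssup m : has_sup (S m) by split; [exists 0|exists (1 / 2)].
have Sle m r : S m r -> r <= sup (S m) by move=> Sr; apply: ub_le_sup => //; exists (1 / 2).
have Asym m m' : m <= m' -> sup (S m) <= sup (S m') <= sup (S m) + (m' - m).
  move=> mm; apply/andP; split.
    apply: ge_sup; first by exists 0.
    move=> r [r01 [r0|G]]; apply: Sle; split => //; [by left|right].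
    by apply: mono G _ _ => //; lra.
  apply: ge_sup; first by exists 0.
  move=> r [/andP[r0 r1] H]; have s0 := Sle m 0 (S0 m).
  have [rm|rm] := leP r (m' - m); first by lra.
  case: H => [rE|G]; first by lra.
  (* Shifting [m'] and [r] together by [m' - m] leaves [m' - r] unchanged, whence the Lipschitz
     constant 1. *)
  rewrite -lerBlDr; apply: Sle; split; first by lra.
  by right; apply: mono G _ _; lra.
exists (fun m => sup (S m)); split.
  move=> x y; rewrite mul1r; wlog xy : x y / x <= y.
    by move=> H; have [/H//|/ltW/H] := leP x y; rewrite distrC (distrC y).
  have /andP[H1 H2] := Asym _ _ xy.
  by rewrite ler0_norm ?subr_le0// ler0_norm ?subr_le0//; lra.
move=> m m0; have m20 : 0 < m / 2 by lra.
(* For [r <= m / 2], a threshold admissible at [m / 2] is admissible at [m - r]; this makes the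
   supremum positive. *)
have [a [a0 G]] := ex _ m20; have h0 : 0 < 1 / 2 :> R by lra.
have [r1 [r10 r1m r12]] := min_spec m20 h0.
have [r [r0 ra rr1]] := min_spec a0 r10.
have Sr : S m r by split; [lra|right; apply: mono G _ _; lra].
have le2 : sup (S m) <= 1 / 2 by apply: ge_sup; [exists 0|exact: Sub].
split; first by have := Sle m r Sr; lra.
move=> c c0 cA; have [r' Sr' cr'] := sup_gt (ex_intro _ 0 (S0 m)) cA.
case: Sr' => r'01 [rE|G']; first by lra.
by apply: mono G' _ _; lra.
Qed.

End Thresholds.

Section Regularity.
Context {R : realType}.
Implicit Types (f : R -> R) (n i : nat).

Lemma of_class_C_is_derive n f i : of_class_C n f -> (i < n)%N ->
  forall x : R, is_derive x (1 : R) (derive1n i f) (derive1n i.+1 f x).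
Proof. by move=> [df _] iN x; split; [exact: df|rewrite /= derive1E]. Qed.

Lemma of_class_C_continuous n f i : of_class_C n f -> (i <= n)%N -> continuous (derive1n i f).
Proof.
move=> [df cf]; rewrite leq_eqVlt => /predU1P[->//|iN] x.
by apply: differentiable_continuous; apply/derivable1_diffP; exact: df.
Qed.

Lemma cvg_ninfty_exists f (A : R) : f @ -oo --> +oo -> exists x : R, x < 0 /\ A < f x.
Proof.
move=> fy; have : \forall x \near -oo, x < 0 /\ A < f x.
  by near=> x; split; [near: x; exact: nbhs_ninfty_lt|near: x; move/cvgryPgt : fy; exact].
by move=> /filter_ex[x]; exists x.
Unshelve. all: by end_near. Qed.

End Regularity.

(** * Construction of the path for a given solution *)

Section ContractionPath.
Context {R : realType} (f f1 f2 eta e1 e2 : R -> R).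
Context (df : forall x : R, is_derive x (1 : R) f (f1 x)).
Context (df1 : forall x : R, is_derive x (1 : R) f1 (f2 x)).
Context (cf2 : continuous f2).
Context (f2_pos : forall x : R, 0 < x -> 0 < f2 x).
Context (f2_neg : forall x : R, x < 0 -> f2 x < 0).
Context (f1_ninfty : forall A : R, exists x : R, x < 0 /\ A < f1 x).
Context (de : forall x : R, is_derive x (1 : R) eta (e1 x)).
Context (de1 : forall x : R, is_derive x (1 : R) e1 (e2 x)).
Context (ce2 : continuous e2).
Context (e2_pos : forall x : R, 0 < e2 x).
Local Notation mu := (@lebesgue_measure R).
Implicit Types (u : R * R -> R) (h q v V : R -> R) (m a t s x eps uL uR tbar kappa K B M : R).

Lemma lipschitzT_curve K h t : lipschitzT K h -> lipschitz_curve t h.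
Proof. by move=> hK; exists K => -[x y] /= _; exact: hK. Qed.

Lemma one_sided_trace_later kappa u h v t : kappa != 0 -> 0 <= t ->
  one_sided_trace (side kappa) 0 u h v -> one_sided_trace (side kappa) t u h v.
Proof.
move=> k0 t0 [mv [B [Br vB]] tr].
have sub : `]t, +oo[%classic `<=` (`]0, +oo[%classic : set R).
  by move=> x; rewrite /= !in_itv/= !andbT; exact: le_lt_trans.
split; first exact: measurable_funS mv.
  by exists B; split => // y By x /sub; exact: vB.
move=> T tT; have T0 : 0 < T by exact: le_lt_trans tT.
pose S n x : \bar R := ereal_sup [set `|u (x, h x + y)%R - v x|%:E | y in side kappa n].
have S0 n x : (0 <= S n x)%E.
  have n0 : 0 < n.+1%:R^-1 :> R by rewrite invr_gt0.
  have yk : side kappa n (n.+1%:R^-1 / 2 / kappa).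
    by rewrite /side/= mulrC divfK//; move: n0; set d := n.+1%:R^-1; clearbody d; lra.
  apply: le_trans (ereal_sup_ubound _); last by exists (n.+1%:R^-1 / 2 / kappa).
  by rewrite lee_fin.
apply: squeeze_cvge (cvg_cst 0%E) (tr T T0).
apply: nearW => n /=; apply/andP; split; first by apply: integral_ge0 => x _; exact: S0.
rewrite integral_mkcond [leRHS]integral_mkcond; apply: le_lower_integral => x.
  by rewrite patchE; case: ifP => // _; exact: S0.
rewrite !patchE; case: ifPn => [|_]; last by case: ifP => // _; exact: S0.
rewrite inE/= in_itv/= => /andP[tx xT]; rewrite mem_set//= in_itv/= xT andbT.
exact: le_lt_trans tx.
Qed.

Lemma left_trace_later u h v t : 0 <= t -> left_trace 0 u h v -> left_trace t u h v.
Proof.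
rewrite /left_trace left_side; apply: one_sided_trace_later.
by rewrite oppr_eq0 oner_eq0.
Qed.

Lemma right_trace_later u h v t : 0 <= t -> right_trace 0 u h v -> right_trace t u h v.
Proof. by rewrite /right_trace right_side; apply: one_sided_trace_later; rewrite oner_eq0. Qed.

(** One parameter [m] bounds [eps], [uL] and [uL - uR] from below, which makes the property monotone
    in [m] and [a]. The entropy flux [q] is quantified inside, so that [a] is common to all of
    them. *)
Definition contraction_property M m a := forall q, entropy_flux f eta q ->
  forall eps uL uR, m <= eps -> m <= uL <= M -> - M <= uR -> uR <= uL - m -> oleinik f uL uR ->
  forall a1 a2, 0 < a1 -> 0 < a2 -> a2 / a1 <= a ->
  forall u, S_weak f eta q M uL eps u -> forall tbar x0, 0 <= tbar ->
  exists h um up : R -> R,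
    [/\ lipschitz_curve tbar h, h tbar = x0,
        left_trace tbar u h um, right_trace tbar u h up &
        {ae mu, forall t : R, tbar <= t ->
          a1 * (derive1 h t * rel_entropy eta (um t) uL - rel_flux f eta q (um t) uL)
          - a2 * (derive1 h t * rel_entropy eta (up t) uR - rel_flux f eta q (up t) uR) <= 0}].

Lemma contraction_property_ex M m : 0 < m -> m <= M -> m <= 1 ->
  (forall x, derive1 f x = f1 x) -> (forall x, derive1 eta x = e1 x) ->
  exists a : R, 0 < a /\ contraction_property M m a.
Proof.
move=> m0 mM m1 f1E e1E; have M0 : 0 < M by exact: lt_le_trans mM.
have [A [A0 AP]] := pointwise_contraction df df1 cf2 f2_pos f2_neg f1_ninfty de de1 ce2 e2_pos m0 mM m1.
exists A; split => // q qflux eps uL uR meps muL MuR uRL ole a1 a2 a10 a20 a21 u Su tbar x0 tb0.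
have dq x : is_derive x (1 : R) q (e1 x * f1 x) by rewrite -f1E -e1E; exact: qflux.
have [V [K [B [VK VB VP]]]] := AP q dq eps uL uR meps muL MuR uRL ole.
have [[uM wu] ent kru tru avoid] := Su.
have B0 : 0 <= B by apply: le_trans (VB 0).
pose K' : R := `|K| + 1; have K'0 : 0 < K' by rewrite ltr_pwDr.
have VK' x y : `|V x - V y| <= K' * `|x - y|.
  apply: le_trans (VK x y) _; rewrite ler_wpM2r//.
  by apply: le_trans (ler_norm K) _; rewrite lerDl.
have cV : continuous V by exact: (@lipschitzT_continuous _ K').
have mW : measurable_fun setT (fun z => V ((u \_ half_plane) z)).
  apply: (@measurableT_comp _ _ _ _ _ _ V); first exact: continuous_measurable_fun.
  by apply: (measurable_restrictT u measurable_half_plane).1; case: uM.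
(* The path is constant before [tbar] and Lipschitz on the whole line, so the strong trace property
   applies to it from time 0. *)
have [h [hB hx0 hW]] := filippov_exists tbar x0 mW (fun z => VB _).
have ch : continuous h := lipschitzT_continuous hB.
have [um [up [tm tp]]] := tru h (lipschitzT_curve 0 hB).
exists h, um, up; split.
- exact: lipschitzT_curve hB.
- exact: hx0.
- exact: left_trace_later.
- exact: right_trace_later.
have k1 : 1 != 0 :> R by rewrite oner_eq0.
have k2 : -1 != 0 :> R by rewrite oppr_eq0 oner_eq0.
have mu_ : measurable_fun half_plane u by case: uM.
have aem : {ae mu, forall t, 0 < t -> trace_point u h (- 1) t (um t)}.
  have tm' : one_sided_trace (side (- 1)) 0 u h um by rewrite -left_side.
  exact: ae_trace_point mu_ ch k2 tm'.
have aep : {ae mu, forall t, 0 < t -> trace_point u h 1 t (up t)}.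
  have tp' : one_sided_trace (side 1) 0 u h up by rewrite -right_side.
  exact: ae_trace_point mu_ ch k1 tp'.
have aeh := lipschitz_ae_derivable hB.
have aea := avoid h um up (lipschitzT_curve 0 hB) tm tp.
(* Traces are controlled at positive times only, and [tbar] may be 0. *)
have ae0 := ae_neq (0 : R).
have cl z := clamp_bound u z M0.
have LL : locally_lipschitz f.
  by apply: C1_locally_lipschitz df _ => x; exact: is_derive_continuous (df1 x).
have Leta : locally_lipschitz eta.
  by apply: C1_locally_lipschitz de _ => x; exact: is_derive_continuous (de1 x).
have Lq : locally_lipschitz q.
  apply: C1_locally_lipschitz dq _ => x; apply: cvgM.
    exact: is_derive_continuous (de1 x).
  exact: is_derive_continuous (df1 x).
have aeha : {ae mu, forall t, derivable h t 1 /\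
    (0 < t -> ~ (ball (phi_flat0 f eta q uL) eps (um t) /\ ball uL eps (up t))) /\ t != 0}.
  by apply: ae_imp3 aeh aea ae0 _ => t dht avt tn0.
apply: ae_imp3 aem aep aeha _ => t tmt tpt [dht [avt tn0]] tt.
have t0 : 0 < t by rewrite lt_neqAle eq_sym tn0 (le_trans tb0).
have {}tmt := tmt t0; have {}tpt := tpt t0; have {}avt := avt t0.
have umM := trace_point_bound cl k2 (trace_point_clamp uM t0 tmt).
have upM := trace_point_bound cl k1 (trace_point_clamp uM t0 tpt).
have dh : is_derive t (1 : R) h (derive1 h t) by split; rewrite ?derive1E.
have sV := filippov_velocity tb0 tt K'0 B0 VK' hW dh tmt tpt.
set s := derive1 h t in dh sV *.
have jump (P Q : R -> R) (LA : locally_lipschitz P) (LB : locally_lipschitz Q) :=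
  jump_le M0 uM LA LB t0 dh tmt tpt.
have test r w : 0 < r -> r < t -> 0 < w -> test_function (moving_hump t (h t) s r w).
  by move=> r0 rt w0; exact: test_function_moving_hump.
(* The pairings of a weak solution vanish, so the jump inequality holds for [(id, f)] and for its
   opposite. *)
have RH : s * (up t - um t) = f (up t) - f (um t).
  have H1 : f (up t) - f (um t) - s * (up t - um t) <= 0.
    apply: (jump id f) => // [|r w r0 rt w0]; first exact: locally_lipschitz_id.
    by rewrite wu//; exact: test.
  have := jump (fun x => - x) (fun x => - f x)
    (locally_lipschitzN (@locally_lipschitz_id R)) (locally_lipschitzN LL).
  move=> /(_ _)/wrap[r w r0 rt w0|/= H2]; last by lra.
  by rewrite (@weak_pairingN _ id f) wu ?oppr0//; exact: test.
have eta_ineq : q (up t) - q (um t) - s * (eta (up t) - eta (um t)) <= 0.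
  apply: jump => // r w r0 rt w0; apply: ent; first exact: test.
  by move=> z; exact: moving_hump_ge0.
have kru_ineq := jump _ _ (locally_lipschitz_kruzkov_entropy (phi_natural f uL))
  (locally_lipschitz_kruzkov_flux (phi_natural f uL) LL).
have {}kru_ineq := kru_ineq (fun r w r0 rt w0 => kru _ (test r w r0 rt w0) (fun z => moving_hump_ge0 _ _ _ _ _ z)).
have := VP (um t) (up t) s umM upM sV RH eta_ineq kru_ineq avt a1 a2 a10 a20 a21.
by rewrite /relQ /releta /rel_entropy /rel_flux e1E e1E.
Qed.

End ContractionPath.

(* [astar] takes [(eps, s0, d(uL, 0), d(uR, phi_natural uL))]; it is chosen once
   [f], [eta] and [M] are fixed. Continuity in the last argument is only
   claimed where that argument is positive. *)
Theorem theorem1p1 (R : realType) (M : R) (f eta : R -> R)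
    (M_gt0 : 0 < M)
    (f_flux : concave_convex_flux f)
    (eta_entropy : strictly_convex_entropy eta) :
  exists astar : R * R * R * R -> R,
    {within [set p | let '(eps, s0, dL, dR) := p in
                     [/\ 0 < eps, 0 < s0, 0 < dL & 0 < dR]],
       continuous astar} /\
    {within [set p | let '(eps, s0, dL, dR) := p in
                     [/\ 0 < eps, 0 < s0, 0 < dL & dR = 0]],
       continuous astar} /\
    forall q : R -> R, entropy_flux f eta q ->
    forall eps uL uR : R,
      0 < eps -> - M <= uL <= M -> 0 < uL -> - M <= uR <= M ->
      oleinik f uL uR ->
      let a := astar (eps, `|uL - uR|, `|uL|, `|uR - phi_natural f uL|) in
      0 < a < 1 /\
      forall a1 a2 : R, 0 < a1 -> 0 < a2 -> a2 / a1 < a ->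
      forall u : R * R -> R, S_weak f eta q M uL eps u ->
      forall tbar x0 : R, 0 <= tbar ->
      exists h um up : R -> R,
        [/\ lipschitz_curve tbar h, h tbar = x0,
            left_trace tbar u h um, right_trace tbar u h up &
            {ae lebesgue_measure, forall t : R, tbar <= t ->
               a1 * (derive1 h t * rel_entropy eta (um t) uL
                     - rel_flux f eta q (um t) uL)
               - a2 * (derive1 h t * rel_entropy eta (up t) uR
                       - rel_flux f eta q (up t) uR) <= 0}].
Proof.
have [Cf f2_sign _ _ f1_ninfty] := f_flux; have [Ce e2_pos] := eta_entropy.
have df : forall x : R, is_derive x (1 : R) f (derive1 f x) := of_class_C_is_derive Cf (isT : (0 < 4)%N).
have df1 : forall x : R, is_derive x (1 : R) (derive1 f) (derive1n 2 f x) :=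
  of_class_C_is_derive Cf (isT : (1 < 4)%N).
have cf2 := of_class_C_continuous Cf (isT : (2 <= 4)%N).
have de : forall x : R, is_derive x (1 : R) eta (derive1 eta x) := of_class_C_is_derive Ce (isT : (0 < 3)%N).
have de1 : forall x : R, is_derive x (1 : R) (derive1 eta) (derive1n 2 eta x) :=
  of_class_C_is_derive Ce (isT : (1 < 3)%N).
have ce2 := of_class_C_continuous Ce (isT : (2 <= 3)%N).
have f2_pos x : 0 < x -> 0 < derive1n 2 f x.
  by move=> x0; have := f2_sign x; rewrite gt_eqF// pmulr_rgt0//; exact.
have f2_neg x : x < 0 -> derive1n 2 f x < 0.
  by move=> x0; have := f2_sign x; rewrite lt_eqF// nmulr_rgt0//; exact.
have f1_big (C : R) := cvg_ninfty_exists C f1_ninfty.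
have mono (m m' a a' : R) : contraction_property f eta M m a -> m <= m' -> a' <= a ->
    contraction_property f eta M m' a'.
  move=> H mm aa q qflux eps uL uR meps /andP[muL uLM] MuR uRL ole a1 a2 a10 a20 a21.
  apply: H => //.
  - exact: le_trans meps.
  - by rewrite (le_trans mm).
  - by apply: le_trans uRL _; rewrite lerD2l lerN2.
  - exact: le_trans a21 aa.
have ex (m : R) : 0 < m -> exists a : R, 0 < a /\ contraction_property f eta M m a.
  (* The analysis is done for [m <= M] and [m <= 1]; larger values follow by monotonicity. *)
  move=> m0; have [m1 [m10 m1m m1M]] := min_spec m0 M_gt0.
  have [m2 [m20 m21 m2one]] := min_spec m10 (@ltr01 R).
  have [a [a0 H]] := contraction_property_ex df df1 cf2 f2_pos f2_neg f1_big de de1 ce2 e2_pos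
    m20 (le_trans m21 m1M) m2one (fun=> erefl) (fun=> erefl).
  by exists a; split => //; apply: mono H _ _ => //; exact: le_trans m1m.
have [A [AL AP]] := lipschitz_threshold mono ex.
(* The parameter [m] is the minimum of [eps], [s0] and [|uL|]; since [A] is 1-Lipschitz, continuity
   is preserved. *)
pose astar (p : R * R * R * R) : R := A (Num.min (Num.min p.1.1.1 p.1.1.2) p.1.2).
have castar : continuous astar.
  have c11 : continuous (fun p : R * R * R * R => p.1.1).
    by move=> p; apply: continuous_comp; exact: cvg_fst.
  have c1 : continuous (fun p : R * R * R * R => p.1.1.1).
    by move=> p; apply: (@continuous_comp _ _ _ (fun p => p.1.1) fst); [exact: c11|exact: cvg_fst].
  have c2 : continuous (fun p : R * R * R * R => p.1.1.2).
    by move=> p; apply: (@continuous_comp _ _ _ (fun p => p.1.1) snd); [exact: c11|exact: cvg_snd].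
  have c3 : continuous (fun p : R * R * R * R => p.1.2).
    by move=> p; apply: (@continuous_comp _ _ _ fst snd); [exact: cvg_fst|exact: cvg_snd].
  have cm : continuous (fun p : R * R * R * R => Num.min (Num.min p.1.1.1 p.1.1.2) p.1.2).
    move=> p; apply: (@continuous_min R _ (fun p : R * R * R * R => Num.min p.1.1.1 p.1.1.2)).
      by apply: (@continuous_min R _ (fun p : R * R * R * R => p.1.1.1)); [exact: c1|exact: c2].
    exact: c3.
  move=> p; apply: (@continuous_comp _ _ _
    (fun p : R * R * R * R => Num.min (Num.min p.1.1.1 p.1.1.2) p.1.2) A);
    by [exact: cm|exact: (lipschitzT_continuous AL)].
exists astar; split; first exact: continuous_subspaceT.
split; first exact: continuous_subspaceT.
move=> q qflux eps uL uR eps0 /andP[MuL uLM] uL0 /andP[MuR uRM] ole /=.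
have [k [k0 tk]] := tangent_exists df df1 f2_pos f2_neg f1_big uL0.
have /andP[_ uRL] : k <= uR < uL by exact: oleinik_bounds ole.
rewrite /astar/=; set m := Num.min _ _.
have s0 : 0 < `|uL - uR| by rewrite normr_gt0 subr_eq0 gt_eqF.
have m0 : 0 < m by rewrite !lt_min eps0 s0 normr_gt0 gt_eqF.
have [A01 G] := AP m m0; split => // a1 a2 a10 a20 a21 u Su tbar x0 tb0.
have meps : m <= eps by rewrite /m !ge_min lexx.
have muL : m <= uL by rewrite /m !ge_min (gtr0_norm uL0) lexx orbT.
have muR : uR <= uL - m.
  by rewrite lerBrDr -lerBrDl /m !ge_min (gtr0_norm (_ : 0 < uL - uR)) ?subr_gt0// lexx !orbT.
have uLM' : m <= uL <= M by rewrite muL.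
(* The ratio [a2 / a1] is itself an admissible threshold, being strictly below [A m]. *)
apply: (G _ (divr_gt0 a20 a10) a21 q qflux eps uL uR) => //.
Qed.
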